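(* Let $K$ be a cyclic cubic field. The following are equivalent. (i) $K$ has a power integral basis. (ii) There exists an integer $t\geq -1$ such that $K=K_t$ and $\Delta_t/c_K\in\mathbb N^3$. (iii) There exists an integer $t\geq -1$ such that $K=K_t$, $t\not\equiv 3,21 \pmod{27}$, and $v_p(\Delta_t)\not\equiv 2\pmod 3$ for all primes $p\neq 3$. In such a case, for $t$ as in (ii), put $n:=\sqrt[3]{\Delta_t/c_K}\in\mathbb N$. Then a power integral basis $\gamma\in\mathcal O_K$ is given by $$\gamma:=\frac{\theta_t-a}{n}\quad\text{for } a\in\mathbb Z \text{ with } a\equiv \tfrac t3 \bmod n,$$ where the condition on $a$ means: $a\equiv \frac t3 \pmod n$ if $3\mid n$ (in this case $3\mid t$), and $3a\equiv t\pmod n$ if $3\nmid n$.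
   Context: A cyclic cubic field is a Galois extension $K/\mathbb Q$ with Galois group cyclic of order 3; $\mathcal O_K$ is its ring of integers. An element $\gamma\in\mathcal O_K$ is called a power integral basis if $\mathcal O_K=\mathbb Z[\gamma]$, and $K$ has a power integral basis if such a $\gamma$ exists. $c_K$ is the conductor of $K$, i.e. the smallest positive integer $m$ with $K\subset\mathbb Q(\zeta_m)$; it satisfies $c_K=\sqrt{d_K}$ with $d_K$ the discriminant of $K$. For an integer $t\geq -1$, let $f_t(x)=x^3-tx^2-(t+3)x-1$, let $\theta_t$ be a root of $f_t$, $K_t:=\mathbb Q(\theta_t)$ (a cyclic cubic field), and $\Delta_t:=t^2+3t+9$. One has $c_{K_t}\mid\Delta_t$. $\mathbb N$ is the set of positive integers, $\mathbb N^3:=\{n^3\mid n\in\mathbb N\}$, and $v_p(n)$ is the exponent of the prime $p$ in the integer $n$. *)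

(* Defs.v *)
From HB Require Import structures.
From mathcomp Require Import all_boot all_order all_fingroup all_algebra.
From mathcomp Require Import all_solvable all_field.
From mathcomp Require boolp classical_sets.
Set Implicit Arguments.
Unset Strict Implicit.
Unset Printing Implicit Defensive.
Import Order.TTheory GRing.Theory Num.Theory.
Local Open Scope ring_scope.

Definition cyclic_cubic (K : splittingFieldType rat) : Prop :=
  [/\ galois 1%AS {:K}, cyclic 'Gal({:K} / 1%AS)
    & #|'Gal({:K} / 1%AS)%g| = 3%N].

Definition integer_elt (K : fieldExtType rat) (x : K) : Prop :=
  integralOver (intr : int -> K) x.

Definition power_integral_basis (K : fieldExtType rat) (g : K) : Prop :=
  integer_elt g /\
  forall x : K, integer_elt x <->
    exists p : {poly int}, x = (map_poly (intr : int -> K) p).[g].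

(* K is an abstract field, so the inclusion of K in Q(zeta_m) is an embedding
   of K whose image lies in the subfield generated by some primitive m-th root
   of unity z of an ambient number field L. *)
Definition in_cyclotomic (K : fieldExtType rat) (m : nat) : Prop :=
  exists (L : fieldExtType rat) (iota : 'AHom(K, L)) (z : L),
    m.-primitive_root z /\ (limg iota <= <<1; z>>)%VS.

Definition is_conductor (K : fieldExtType rat) (c : nat) : Prop :=
  [/\ (0 < c)%N, in_cyclotomic K c
    & forall m : nat, (0 < m)%N -> in_cyclotomic K m -> (c <= m)%N].

(* The default value 0 is taken only if K is in no cyclotomic field, which by
   Kronecker-Weber does not occur for abelian K. *)
Definition conductor (K : fieldExtType rat) : nat :=
  classical_sets.xget 0%N (is_conductor K).

Definition simplest_poly (t : int) : {poly int} :=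
  'X^3 - t *: 'X^2 - (t + 3) *: 'X - 1.

Definition Delta (t : int) : int := t ^+ 2 + 3 * t + 9.

Definition simplest_root (K : fieldExtType rat) (t : int) (theta : K) : Prop :=
  root (map_poly (intr : int -> K) (simplest_poly t)) theta.

(* For abstract K, "K = K_t" means K = Q(theta) for a root theta of f_t; the
   choice of root is immaterial, as f_t is irreducible and K_t is Galois. *)
Definition is_simplest_cubic (K : fieldExtType rat) (t : int) : Prop :=
  exists theta : K, simplest_root t theta /\ <<1; theta>>%VS = {:K}%VS.

(* "a = t/3 mod n"; %/ is an exact division here, as 3 | n implies 3 | t *)
Definition third_mod (t a : int) (n : nat) : Prop :=
  ((3 %| n)%N -> (a = (t %/ 3)%Z %[mod n])%Z) /\
  (~~ (3 %| n)%N -> (3 * a = t %[mod n])%Z).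

(* Main.v *)
Require Import Defs.
From HB Require Import structures.
From mathcomp Require Import all_boot all_order all_fingroup all_algebra.
From mathcomp Require Import all_solvable all_field.
From mathcomp Require Import ring zify.

(** Let [alpha = t - 3 omega] in [Z[omega]], so that [Delta t] is the norm of
    [alpha], and let [x'], [x''] denote the conjugates of [x] in [K].

    The conductor of [K_t] is explicit ([conductor_formulaE]): it is the product
    of the primes [p <> 3] with [v_p(Delta t)] not divisible by 3, times 9 when
    3 divides [t] and [t] is not 12 modulo 27.

    - Upper bound.  By Cardano's formula a root of [f_t] is
      [(t + rho + conj rho) / 3] with [rho^3 = alpha^2 conj(alpha)], an
      expression multiplicative in [alpha].  A prime of [Z[omega]] of norm
      [p = 1 mod 3] can be taken to be a Jacobi sum [J], and
      [J^2 conj(J) = p J] is then the cube of a Gauss sum, an element of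
      [Q(omega, zeta_p)] ([cubic_gauss_sum], [cube_root_in_cyclotomic]).  What
      remains of [alpha] besides rational factors is a unit and possibly a
      factor [1 - omega], whose cube roots cost at most a ninth root of unity;
      they cancel exactly when 3 is unramified, and [omega] itself is then
      removed by a Galois descent ([Qadj_omega_descent]).
    - Lower bound.  At each prime [p] of the formula [K] contains an Eisenstein
      element [x]: a root of [X^3 + p (a X^2 + b X + c)] with [p] not dividing
      [c].  It is nilpotent modulo [p].  If [p] does not divide [m], the ring
      [Z[zeta_m] / p] has no nilpotents, since some power of Frobenius is the
      identity on it; so [K] is not contained in [Q(zeta_m)].  For [p = 3] the
      same argument modulo [1 - zeta_3] shows that 9 divides [m]
      ([eisenstein_cyclotomic_dvd]).

    Discriminants enter through
    [diff_prod x = (x - x') (x' - x'') (x'' - x)], a square root of the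
    discriminant of [x].  An Eisenstein element [x] generates an order that is
    maximal at [p] ([eisenstein_maximal]), and Lagrange interpolation shows that
    [diff_prod g] multiplies the integers of [K] into [Z[g]] ([diff_prod_mul_mem]).

    If [Delta t = c n^3], then [g = (theta - a) / n] has
    [diff_prod g = c] up to sign, and [Z[g]] contains an Eisenstein element at
    every prime dividing [c].  Hence [Z[g]] is maximal at all primes.

    Conversely let [g] be a power integral basis and [d = g - g'].  As [g'] is an
    integral polynomial in [g], [u = d' / d] is an algebraic integer, and
    [d + d' + d'' = 0] reads [1 + u + u u' = 0]: this is the Moebius
    transformation permuting the roots of a simplest cubic, so [u] is a root of
    [f_t] for [t] the trace of [u].  Moreover [Delta t * D^2 = A^3] with
    [D = diff_prod g] and an integer [A], whence
    [v_p(Delta t) = v_p(D) mod 3].  For an Eisenstein element [x], [D] divides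
    [diff_prod x], which bounds [v_p(D)]; this yields the congruences of (iii).
    Conditions (ii) and (iii) are equivalent by comparing valuations with the
    formula for the conductor. *)

Set Implicit Arguments.
Unset Strict Implicit.
Unset Printing Implicit Defensive.
Import Order.TTheory GRing.Theory Num.Theory.
Local Open Scope ring_scope.

(** * Algebraic integers and divisibility *)

Section IntegerElements.
Variable L : fieldExtType rat.
Implicit Types x y : L.

Lemma intr_alg (n : int) : n%:~R = (n%:~R : rat)%:A :> L.
Proof. by rewrite -in_algE rmorph_int. Qed.

Lemma intr_ext_inj : injective (intr : int -> L).
Proof. by move=> m n; rewrite !intr_alg -!in_algE => /fmorph_inj/intr_inj. Qed.

Lemma intr_ext_eq0 (n : int) : ((n%:~R : L) == 0) = (n == 0).
Proof. by rewrite -(inj_eq intr_ext_inj). Qed.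

Lemma natr_ext_eq0 (n : nat) : ((n%:R : L) == 0) = (n == 0)%N.
Proof. by rewrite pmulrn intr_ext_eq0. Qed.

Lemma integer_int (n : int) : integer_elt (n%:~R : L).
Proof. exact: integral_id. Qed.

Lemma integer_nat (n : nat) : integer_elt (n%:R : L).
Proof. exact: integer_int n. Qed.

Lemma integerN x : integer_elt x -> integer_elt (- x).
Proof. exact: integral_opp. Qed.
Lemma integerD x y : integer_elt x -> integer_elt y -> integer_elt (x + y).
Proof. exact: integral_add. Qed.
Lemma integerB x y : integer_elt x -> integer_elt y -> integer_elt (x - y).
Proof. exact: integral_sub. Qed.
Lemma integerM x y : integer_elt x -> integer_elt y -> integer_elt (x * y).
Proof. exact: integral_mul. Qed.
Lemma integerX x n : integer_elt x -> integer_elt (x ^+ n).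
Proof. by move=> Hx; elim: n => [|n IH]; [exact: (integer_nat 1)|rewrite exprS; exact:
  integerM]. Qed.

Lemma integer_horner (p : {poly int}) x :
  integer_elt x -> integer_elt (map_poly intr p).[x].
Proof.
move=> Hx; apply: integral_horner => // i.
move=> /(nthP 0)[j _ <-]; rewrite coef_map_id0 //; exact: integer_int.
Qed.

(** A monic equation of degree [n] for [1/p], multiplied by [p^n], becomes
    [1 = 0] modulo [p]. *)
Lemma nonintegral_inv_prime (p : nat) : prime p -> ~ integer_elt (p%:R^-1 : L).
Proof.
move=> pp [P Pmon].
have p0 : (p%:R : L) != 0 by rewrite natr_ext_eq0; case: p pp.
rewrite rootE horner_coef => /eqP H.
have Hs : size (map_poly (intr : int -> L) P) = (size P).-1.+1.
  rewrite size_map_inj_poly //; last exact: intr_ext_inj.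
  by rewrite prednK // size_poly_gt0 monic_neq0.
move: H; rewrite Hs big_ord_recr /=.
set n := (size P).-1.
rewrite coef_map_id0 // -[P`_n]/(lead_coef P) (monicP Pmon) mul1r.
move/(congr1 (fun z => p%:R ^+ n * z)); rewrite mulr0 mulrDr.
rewrite exprVn divff ?expf_neq0 // mulr_sumr.
have -> : \sum_(i < n) p%:R ^+ n * ((map_poly (intr : int -> L) P)`_i * p%:R^-1 ^+ i)
   = ((p%:Z * \sum_(i < n) P`_i * p%:Z ^+ (n - i.+1))%:~R : L).
  rewrite intrM rmorph_sum /= mulr_sumr; apply: eq_bigr => i _.
  rewrite coef_map_id0 // intrM rmorphXn /= exprVn.
  have -> : (p%:R : L) ^+ n = p%:R * (p%:R ^+ (n - i.+1) * p%:R ^+ i).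
    by rewrite -exprD -exprS; congr (_ ^+ _); case: i => i /= ?; lia.
  have := expf_neq0 i p0; move: (_ ^+ i) (_ ^+ (n - _)) (_ %:~R) => v u w v0.
  by field.
rewrite -[1]/(1%:~R : L) -intrD => /eqP; rewrite intr_ext_eq0 => /eqP E.
have : (p%:Z %| 1)%Z.
  by apply/dvdzP; exists (- \sum_(i < n) P`_i * p%:Z ^+ (n - i.+1)); lia.
by rewrite dvdzE /= dvdn1 => /eqP p1; rewrite p1 in pp.
Qed.

(** If [p] did not divide [N], a Bezout relation would make [1/p] an integral
    combination of 1 and [y = N/p].  Divisibilities between algebraic integers
    descend to [Z] in this way, without norms. *)
Lemma prime_dvd_integer (p : nat) (N : int) y :
  prime p -> integer_elt y -> N%:~R = p%:R * y -> (p%:Z %| N)%Z.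
Proof.
move=> pp Hy E.
have [//|npN] := boolP (p%:Z %| N)%Z.
have cop : coprimez p N by rewrite /coprimez /gcdz -[_ == _]/(coprime _ _) prime_coprime.
have [[u v] /= Euv] := coprimezP _ _ cop.
case: (nonintegral_inv_prime pp).
have p0 : (p%:R : L) != 0 by rewrite natr_ext_eq0; case: p pp {E npN cop Euv}.
suff -> : (p%:R^-1 : L) = u%:~R + v%:~R * y.
  by apply: integerD; [|apply: integerM]; do ?exact: integer_int.
apply: (mulfI p0); rewrite divff // mulrDr [X in _ = _ + X]mulrCA -E.
have -> : (p%:R : L) = (p%:Z)%:~R by [].
by rewrite -!intrM -intrD -[1]/(1%:~R); congr (_%:~R); lia.
Qed.

Lemma mem1_intP x : x \in 1%VS -> integer_elt x -> exists n : int, x = n%:~R.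
Proof.
case/vlineP=> r ->{x} Hr; exists (numq r).
suff d1 : denq r = 1 by rewrite intr_alg -[in LHS](divq_num_den r) d1 divr1.
have dr := denq_gt0 r.
case: (eqVneq `|denq r|%N 1%N) => [|d1]; first by lia.
have pp := pdiv_prime (n := `|denq r|%N) ltac:(lia).
have pd := pdiv_dvd `|denq r|%N.
set p := pdiv _ in pp pd.
have [k Ek] : exists k, denq r = p%:Z * k.
  have /dvdzP[k ->] : (p%:Z %| denq r)%Z by rewrite dvdzE.
  by exists k; rewrite mulrC.
have /(prime_dvd_integer pp) : integer_elt (k%:~R * (r%:A : L)).
  by apply: integerM => //; exact: integer_int.
move=> /(_ (numq r)) H.
have : (p%:Z %| numq r)%Z.
  apply: H; have -> : (p%:R : L) = (p%:Z)%:~R by [].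
  rewrite mulrA -intrM -Ek !intr_alg -[_%:A * _]/(in_alg L _ * in_alg L _) -rmorphM /=.
  rewrite -in_algE; congr (in_alg L _); rewrite mulrC -[X in X * _]divq_num_den.
  by rewrite divfK // intr_eq0 denq_neq0.
move=> pn; have := coprime_num_den r; rewrite /coprime.
have : (p %| gcdn `|numq r| `|denq r|)%N by rewrite dvdn_gcd pd andbT.
by move=> H1 /eqP H2; move: H1; rewrite H2 dvdn1 => /eqP p1; rewrite p1 in pp.
Qed.

End IntegerElements.

(** Constants are tried first: a numeral is convertible to a sum of ones, which
    [integerD] would otherwise split. *)
Ltac solve_integer := repeat first
  [ assumption | exact: integer_int | exact: integer_nat | exact: (integer_nat _ 1)
  | apply: integerB | apply: integerD | apply: integerN | apply: integerM
  | apply: integerX ].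

(** * Eisenstein elements of cubic fields *)

Lemma prime_dvdzM (p : nat) (a b : int) : prime p ->
  (p%:Z %| a * b)%Z = (p%:Z %| a)%Z || (p%:Z %| b)%Z.
Proof. by move=> pp; rewrite !dvdzE /= abszM Euclid_dvdM. Qed.

Lemma prime_dvdzX (p : nat) (a : int) n : prime p ->
  (p%:Z %| a ^+ n)%Z -> (p%:Z %| a)%Z.
Proof. by move=> pp; rewrite !dvdzE /= abszX Euclid_dvdX // => /andP[]. Qed.

Lemma irrational_generates (L : fieldExtType rat) (x : L) : \dim {:L} = 3 ->
  x \notin 1%VS -> <<1; x>>%VS = {:L}%VS.
Proof.
move=> dL x1; apply/eqP; rewrite eqEdim subvf /=.
have : (\dim <<1; x>> %| \dim {:L})%N by apply: field_dimS; exact: subvf.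
rewrite dL => /prime_nt_dvdP -> //.
apply: contra x1 => d1; rewrite (_ : 1%VS = <<1; x>>%VS) ?memv_adjoin //.
by apply/eqP; rewrite eqEdim subv_adjoin (eqP d1) dimv1.
Qed.

Section Eisenstein.
Variable L : fieldExtType rat.
Implicit Types x y w : L.

(** For [p] prime, [x] is a root of a cubic Eisenstein polynomial: [p] is totally
    ramified in [Q(x)], and [x] has valuation 1/3 at the prime above [p]. *)
Definition eisenstein (p : nat) (x : L) : Prop :=
  exists a b c : int, ~~ (p%:Z %| c)%Z /\
    x ^+ 3 = - p%:R * (a%:~R * x ^+ 2 + b%:~R * x + c%:~R).

Lemma integer_cubic (a b c : int) x :
  x ^+ 3 = a%:~R * x ^+ 2 + b%:~R * x + c%:~R -> integer_elt x.
Proof.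
move=> E.
exists ('X^3 - (a%:P * 'X^2 + b%:P * 'X + c%:P)).
  have s2 : (size (a%:P * 'X^2)%R <= 3)%N.
    by rewrite mul_polyC (leq_trans (size_scale_leq _ _)) ?size_polyXn.
  have s1 : (size (b%:P * 'X)%R <= 3)%N.
    by rewrite mul_polyC (leq_trans (size_scale_leq _ _)) ?size_polyX.
  have s0 : (size (c%:P)%R <= 3)%N by rewrite size_polyC; case: (c != 0).
  have s21 : (size (a%:P * 'X^2 + b%:P * 'X)%R <= 3)%N.
    by rewrite (leq_trans (size_polyD _ _)) // geq_max s1 s2.
  rewrite monicE lead_coefDl ?lead_coefXn // size_polyN size_polyXn ltnS.
  by rewrite (leq_trans (size_polyD _ _)) // geq_max s21.
rewrite rootE !rmorphB /= !rmorphD /= !rmorphM /=. rewrite !map_polyX !map_polyC /=.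
move/eqP: E; rewrite -subr_eq0 => /eqP E.
by rewrite !(hornerD, hornerN, hornerM, hornerX, hornerC); apply/eqP; rewrite -[RHS]E; ring.
Qed.

Lemma eisenstein_integer p x : eisenstein p x -> integer_elt x.
Proof.
case=> a [b [c [_ E]]].
apply: (@integer_cubic (- p%:Z * a) (- p%:Z * b) (- p%:Z * c)).
by rewrite E !intrM !mulrNz; ring.
Qed.

(** As [x] has valuation 1/3, the valuation of [N x^2 / p] is [v_p(N) - 1/3],
    which is negative unless [p] divides [N].  In elementary terms: with
    [x^3 = - p (c + x r)], the cube of the hypothesis gives
    [N^3 c^2 = p y^3 - x s] for an integral [s], and the cube of this relation
    is divisible by [p], because [x^3] is. *)
Lemma eisenstein_sq_dvd p x y (N : int) : prime p -> eisenstein p x ->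
  integer_elt y -> N%:~R * x ^+ 2 = p%:R * y -> (p%:Z %| N)%Z.
Proof.
move=> pp ex Iy E; have Ix := eisenstein_integer ex.
case: ex => a [b [c [pc Ex]]].
have p0 : (p%:R : L) != 0 by rewrite natr_ext_eq0; case: p pp {E pc Ex}.
pose r := a%:~R * x + b%:~R.
have Er : x ^+ 3 = - p%:R * (c%:~R + x * r) by rewrite Ex /r; ring.
pose s := N%:~R ^+ 3 * (2 * c%:~R * r + x * r ^+ 2).
have E1 : N%:~R ^+ 3 * c%:~R ^+ 2 = p%:R * y ^+ 3 - x * s.
  apply: (mulfI (expf_neq0 2 p0)).
  have -> : p%:R ^+ 2 * (p%:R * y ^+ 3 - x * s) = (p%:R * y) ^+ 3 - p%:R ^+ 2 * (x * s) by
    ring.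
  rewrite -E; have -> : (N%:~R * x ^+ 2) ^+ 3 = N%:~R ^+ 3 * (x ^+ 3) ^+ 2 by ring.
  by rewrite Er /s; ring.
have Ir : integer_elt r.
  by apply: integerD; [apply: integerM => //|]; exact: integer_int.
have Is : integer_elt s.
  apply: integerM; first by apply: integerX; exact: integer_int.
  apply: integerD; last by apply: integerM => //; exact: integerX.
  by do 2?apply: integerM => //; [exact: (integer_nat _ 2)|exact: integer_int].
have E2 : ((N ^+ 9 * c ^+ 6)%:~R : L) = p%:R *
   (p%:R ^+ 2 * y ^+ 9 - 3%:R * p%:R * y ^+ 6 * x * s + 3%:R * y ^+ 3 * x ^+ 2 * s ^+ 2 +
     (c%:~R + x * r) * s ^+ 3).
  transitivity ((N%:~R ^+ 3 * c%:~R ^+ 2) ^+ 3 : L); first by rewrite intrM !rmorphXn /=; ring.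
  rewrite E1.
  have -> : (p%:R * y ^+ 3 - x * s) ^+ 3 = p%:R ^+ 3 * y ^+ 9 - 3%:R * p%:R ^+ 2 * y ^+ 6 * x
    * s
      + 3%:R * p%:R * y ^+ 3 * x ^+ 2 * s ^+ 2 - x ^+ 3 * s ^+ 3 by ring.
  by rewrite Er; ring.
have : (p%:Z %| N ^+ 9 * c ^+ 6)%Z.
  apply: (prime_dvd_integer pp _ E2).
  solve_integer.
rewrite prime_dvdzM // => /orP[/(prime_dvdzX pp) //|/(prime_dvdzX pp)].
by rewrite (negbTE pc).
Qed.

Lemma eisenstein_irrational p x : prime p -> eisenstein p x -> x \notin 1%VS.
Proof.
move=> pp ex; apply/negP => /mem1_intP /(_ (eisenstein_integer ex))[n En].
case: ex => a [b [c [pc]]]; rewrite {x}En.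
have -> : - p%:R = (- p%:Z)%:~R :> L by rewrite mulrNz.
rewrite -!rmorphXn -!intrM -!intrD -!intrM => /intr_ext_inj /= En.
have pn : (p%:Z %| n)%Z.
  by apply: (@prime_dvdzX _ _ 3) => //; rewrite En mulNr rpredN dvdz_mulr.
have [k Ek] := dvdzP pn; case/negP: pc.
apply/dvdzP; exists (- (k ^+ 3 * p%:Z + a * k ^+ 2 * p%:Z + b * k)).
have p0 : p%:Z != 0 by case: p pp {pn En Ek}.
by apply: (mulfI p0); move: En; rewrite Ek; nia.
Qed.

Lemma span_cubic x w : \dim {:L} = 3 -> x \notin 1%VS ->
  exists n : nat, (0 < n)%N /\ exists a b c : int,
    n%:R * w = a%:~R + b%:~R * x + c%:~R * x ^+ 2.
Proof.
move=> dL x1.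
have full := irrational_generates dL x1.
have wx : w \in <<1; x>>%VS by rewrite full memvf.
have := Fadjoin_poly_eq wx; have := Fadjoin_polyOver 1 x w.
have := size_Fadjoin_poly 1 x w.
have -> : adjoin_degree 1 x = 3%N.
  by have := dim_Fadjoin 1 x; rewrite full dL dimv1 muln1.
move: (Fadjoin_poly _ _ _) => q sq /polyOver1P[r Er] Ew.
have sr : (size r <= 3)%N by rewrite Er size_map_poly in sq.
pose d := denq r`_0 * denq r`_1 * denq r`_2.
have d0 : 0 < d by rewrite !mulr_gt0 // denq_gt0.
exists `|d|%N; split; first by rewrite absz_gt0 gt_eqF.
exists (numq r`_0 * denq r`_1 * denq r`_2), (denq r`_0 * numq r`_1 * denq r`_2),
  (denq r`_0 * denq r`_1 * numq r`_2).
have Ew2 : w = in_alg L r`_0 + in_alg L r`_1 * x + in_alg L r`_2 * x ^+ 2.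
  rewrite -{1}Ew Er (@horner_coef_wide _ 3) ?size_map_poly //.
  by rewrite !big_ord_recl big_ord0 !coef_map /= expr0 expr1 mulr1 addr0 addrA.
have Ed : (`|d|%N)%:R = in_alg L (d%:~R).
  by rewrite in_algE -intr_alg pmulrn -[in RHS](gtz0_abs d0) abszE.
have num i : in_alg L r`_i * in_alg L (denq r`_i)%:~R = in_alg L (numq r`_i)%:~R.
  by rewrite -rmorphM; congr (in_alg L _); rewrite -[X in X * _]divq_num_den divfK //
    intr_eq0 denq_neq0.
rewrite !intr_alg -!in_algE Ed !intrM !rmorphM /= Ew2 -!in_algE -!num.
by move: (in_alg _ r`_0) (in_alg _ r`_1) (in_alg _ r`_2) => u v t; ring.
Qed.

(** [Z[x]] is maximal at [p].  When [p] divides the denominator [n],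
    multiplication by [x^2], [x] and 1 isolates in turn the coefficients [a],
    [b] and [c], each of which is divisible by [p] by [eisenstein_sq_dvd]; so
    [p] can be removed from [n]. *)
Lemma eisenstein_maximal p x w : \dim {:L} = 3 -> prime p -> eisenstein p x ->
  integer_elt w ->
  exists n : nat, ~~ (p %| n)%N /\ exists a b c : int,
    n%:R * w = a%:~R + b%:~R * x + c%:~R * x ^+ 2.
Proof.
move=> dL pp ex Iw.
have Ix := eisenstein_integer ex.
have p0 : (p%:R : L) != 0 by rewrite natr_ext_eq0; case: p pp {ex}.
have [n [n0 [a [b [c En]]]]] := span_cubic w dL (eisenstein_irrational pp ex).
elim/ltn_ind: n n0 a b c En => n IH n0 a b c En.
have [pn|pn] := boolP (p %| n)%N; last by exists n; split => //; exists a, b, c.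
have [m Em] := dvdnP pn.
have [r [Ir Er]] : exists r, integer_elt r /\ x ^+ 3 = p%:R * r.
  case: (ex) => a1 [b1 [c1 [_ ->]]]; exists (- (a1%:~R * x ^+ 2 + b1%:~R * x + c1%:~R)).
  split; last by ring.
  solve_integer.
have pa : (p%:Z %| a)%Z.
  apply: (@eisenstein_sq_dvd p x (m%:R * w * x ^+ 2 - r * (b%:~R + c%:~R * x))) => //.
    solve_integer.
  have -> : a%:~R = p%:R * m%:R * w - b%:~R * x - c%:~R * x ^+ 2.
    by move: En; rewrite Em natrM => /eqP; rewrite -subr_eq0 => /eqP H; apply/eqP; rewrite
      -subr_eq0 -oppr_eq0 -[X in _ == X]H; apply/eqP; ring.
  have -> : (p%:R * m%:R * w - b%:~R * x - c%:~R * x ^+ 2) * x ^+ 2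
     = p%:R * m%:R * w * x ^+ 2 - x ^+ 3 * (b%:~R + c%:~R * x) by ring.
  by rewrite Er; ring.
have [a' Ea] := dvdzP pa.
have pb : (p%:Z %| b)%Z.
  apply: (@eisenstein_sq_dvd p x ((m%:R * w - a'%:~R) * x - r * c%:~R)) => //.
    solve_integer.
  have H : p%:R * (m%:R * w) = a'%:~R * p%:R + b%:~R * x + c%:~R * x ^+ 2.
    by move: En; rewrite Em Ea natrM intrM => <-; ring.
  have -> : p%:R * ((m%:R * w - a'%:~R) * x - r * c%:~R)
     = (p%:R * (m%:R * w) - a'%:~R * p%:R) * x - (p%:R * r) * c%:~R by ring.
  by rewrite H -Er; ring.
have [b' Eb] := dvdzP pb.
have pc : (p%:Z %| c)%Z.
  apply: (@eisenstein_sq_dvd p x ((m%:R * w - a'%:~R) - b'%:~R * x)) => //.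
    solve_integer.
  have H : p%:R * (m%:R * w) = a'%:~R * p%:R + b'%:~R * p%:R * x + c%:~R * x ^+ 2.
    by move: En; rewrite Em Ea Eb natrM !intrM => <-; ring.
  have -> : p%:R * ((m%:R * w - a'%:~R) - b'%:~R * x)
     = (p%:R * (m%:R * w) - a'%:~R * p%:R) - b'%:~R * p%:R * x by ring.
  by rewrite H; ring.
have [c' Ec] := dvdzP pc.
have p1 := prime_gt1 pp.
apply: (IH m _ _ a' b' c'); [by nia | by nia |].
apply: (mulfI p0); rewrite mulrA -natrM mulnC -Em En Ea Eb Ec !intrM; ring.
Qed.

End Eisenstein.

(** * Ramification in cyclotomic fields *)

Lemma PoszX (n k : nat) : Posz (n ^ k) = n%:Z ^+ k.
Proof. by elim: k => // k IH; rewrite expnS PoszM IH exprS. Qed.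

Lemma intz_fermat (p : nat) (c : int) : prime p -> (p%:Z %| c ^+ p - c)%Z.
Proof.
move=> pp; rewrite -eqz_mod_dvd -modzXm eq_sym -modz_mod eq_sym.
have p0 : p%:Z != 0 by case: p pp.
have := modz_ge0 c p0; case: (c %% p)%Z => // n _.
rewrite modz_nat -PoszX !modz_nat; apply/eqP; congr Posz.
by rewrite modnXm fermat_little.
Qed.

Section IntegerAdjunction.
Variables (L : fieldExtType rat) (z : L).
Implicit Types x y w : L.

(** The ring [Z[z]], in the form in which it occurs in
    [power_integral_basis]. *)
Definition Zadj y := exists q : {poly int}, y = (map_poly (intr : int -> L) q).[z].

Lemma Zadj_int (n : int) : Zadj n%:~R.
Proof. by exists n%:P; rewrite map_polyC hornerC. Qed.
Lemma Zadj_nat (n : nat) : Zadj n%:R.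
Proof. exact: (Zadj_int n). Qed.
Lemma Zadj_gen : Zadj z.
Proof. by exists 'X; rewrite map_polyX hornerX. Qed.
Lemma ZadjD x y : Zadj x -> Zadj y -> Zadj (x + y).
Proof. by case=> [p ->] [q ->]; exists (p + q); rewrite rmorphD hornerD. Qed.
Lemma ZadjN x : Zadj x -> Zadj (- x).
Proof. by case=> [p ->]; exists (- p); rewrite rmorphN hornerN. Qed.
Lemma ZadjM x y : Zadj x -> Zadj y -> Zadj (x * y).
Proof. by case=> [p ->] [q ->]; exists (p * q); rewrite rmorphM hornerM. Qed.
Lemma ZadjX x n : Zadj x -> Zadj (x ^+ n).
Proof.
by move=> Hx; elim: n => [|n IH]; [exact: (Zadj_nat 1)|rewrite exprS; exact: ZadjM].
Qed.
Lemma Zadj_sum (I : Type) (r : seq I) (P : pred I) (F : I -> L) :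
  (forall i, P i -> Zadj (F i)) -> Zadj (\sum_(i <- r | P i) F i).
Proof. by move=> H; elim/big_rec: _ => [|i y Pi Hy]; [exact: (Zadj_nat 0)|apply: ZadjD;
  auto]. Qed.

Lemma Zadj_horner (q : {poly int}) y : Zadj y -> Zadj (map_poly intr q).[y].
Proof.
move=> Zy; elim/poly_ind: q => [|q c IH].
  by rewrite rmorph0 horner0; exact: (Zadj_nat 0).
rewrite rmorphD rmorphM /= map_polyX map_polyC !hornerE.
by apply: ZadjD; [exact: ZadjM|exact: Zadj_int].
Qed.

Lemma integer_Zadj y : integer_elt z -> Zadj y -> integer_elt y.
Proof. by move=> Iz [q ->]; exact: integer_horner. Qed.

Lemma Zadj_denominator x : x \in <<1; z>>%VS -> exists c : nat, (0 < c)%N /\ Zadj (c%:R * x).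
Proof.
move=> /Fadjoin_polyP[q /polyOver1P[r ->] ->].
have [s [a a0 ->]] := rat_poly_scale r.
exists `|a|%N; split; first by rewrite absz_gt0.
have -> : (map_poly (in_alg L) (a%:~R^-1 *: map_poly intr s)).[z]
    = a%:~R^-1 * (map_poly intr s).[z].
  rewrite map_polyZ hornerZ -map_poly_comp /=; congr (_ * _).
    by rewrite intr_alg -!in_algE fmorphV.
  by congr (_.[z]); apply: eq_map_poly => i /=; rewrite intr_alg.
have -> : `|a|%N%:R = (sgz a)%:~R * a%:~R :> L by rewrite pmulrn abszEsg intrM.
have a1 : a%:~R != 0 :> L by rewrite intr_ext_eq0.
rewrite mulrA mulfK //; apply: ZadjM; first exact: Zadj_int.
by exists s.
Qed.

Lemma Zadj_add_prime_exp p x y : prime p -> Zadj x -> Zadj y ->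
  exists2 s, Zadj s & (x + y) ^+ p = x ^+ p + y ^+ p + p%:R * s.
Proof.
move=> pp Zx Zy; have p0 := prime_gt0 pp; case: p pp p0 => // p pp _.
exists (\sum_(i < p) x ^+ (p.+1 - i.+1) * y ^+ i.+1 *+ ('C(p.+1, i.+1) %/ p.+1)).
  apply: Zadj_sum => i _; rewrite -mulr_natr.
  by apply: ZadjM; [apply: ZadjM; exact: ZadjX|exact: Zadj_nat].
rewrite exprDn big_ord_recl big_ord_recr /= subn0 expr0 mulr1 bin0 mulr1n.
rewrite /bump /= add1n subnn expr0 mul1r binn mulr1n addrC -addrA; congr (_ + _).
rewrite [LHS]addrC -?addrA addrC; congr (_ + _).
rewrite mulr_sumr; apply: eq_bigr => i _.
rewrite mulr_natl -mulrnA add1n divnK //.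
by apply: prime_dvd_bin => //; case: i => i /=; lia.
Qed.

(** Modulo [p], the [p]-th power of an integral polynomial in [y] is the same
    polynomial in [y^p]. *)
Lemma Zadj_frobenius p (q : {poly int}) y : prime p -> Zadj y ->
  exists2 s, Zadj s & (map_poly intr q).[y] ^+ p = (map_poly intr q).[y ^+ p] + p%:R * s.
Proof.
move=> pp Zy; elim/poly_ind: q => [|q c [s Zs IH]].
  exists 0; first exact: (Zadj_nat 0).
  by rewrite rmorph0 !horner0 expr0n mulr0 addr0; case: p pp.
have Zq := Zadj_horner q Zy.
rewrite rmorphD rmorphM /= map_polyX map_polyC !(hornerD, hornerM, hornerX, hornerC).
have [t Zt ->] := Zadj_add_prime_exp pp (ZadjM Zq Zy) (Zadj_int c).
have [k Ek] := dvdzP (intz_fermat c pp).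
exists (s * y ^+ p + k%:~R + t).
  by apply: ZadjD => //; apply: ZadjD; [apply: ZadjM => //; exact: ZadjX|exact: Zadj_int].
rewrite exprMn IH -rmorphXn /=.
have -> : c ^+ p = c + k * p by rewrite -Ek addrC subrK.
by rewrite intrD intrM; ring.
Qed.

Lemma Zadj_frobenius_iter p f (q : {poly int}) : prime p ->
  exists2 s, Zadj s & (map_poly intr q).[z] ^+ (p ^ f) = (map_poly intr q).[z ^+ (p ^ f)] +
    p%:R * s.
Proof.
move=> pp; elim: f => [|f [s Zs IH]].
  by exists 0; [exact: (Zadj_nat 0)|rewrite expn0 !expr1 mulr0 addr0].
have Zq := Zadj_horner q (ZadjX (p ^ f) Zadj_gen).
rewrite expnSr !exprM IH.
have [t Zt ->] := Zadj_add_prime_exp pp Zq (ZadjM (Zadj_nat p) Zs).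
have [u Zu ->] := Zadj_frobenius q pp (ZadjX (p ^ f) Zadj_gen).
exists (u + (p%:R ^+ p.-1 * s ^+ p) + t).
  apply: ZadjD => //; apply: ZadjD => //.
  by apply: ZadjM; apply: ZadjX => //; exact: Zadj_nat.
rewrite exprMn; have -> : (p%:R : L) ^+ p = p%:R * p%:R ^+ p.-1.
  by rewrite -exprS prednK // prime_gt0.
ring.
Qed.

Lemma Zadj_horner_sub (q : {poly int}) u v pi : Zadj u -> Zadj v ->
  (exists2 s, Zadj s & u = v + pi * s) ->
  exists2 s, Zadj s & (map_poly intr q).[u] = (map_poly intr q).[v] + pi * s.
Proof.
move=> Zu Zv [s0 Zs0 E0]; elim/poly_ind: q => [|q d [s Zs H]].
  by exists 0; [exact: (Zadj_nat 0)|rewrite rmorph0 !horner0 mulr0 addr0].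
have Zq := Zadj_horner q Zv.
rewrite rmorphD rmorphM /= map_polyX map_polyC !(hornerD, hornerM, hornerX, hornerC).
exists (s * u + (map_poly intr q).[v] * s0).
  by apply: ZadjD; exact: ZadjM.
by rewrite H E0; ring.
Qed.

End IntegerAdjunction.

Section Ramification.
Variables (L : fieldExtType rat) (z : L).
Implicit Types x y w : L.
Local Notation Zadj := (Zadj z).

(** The monic equation of [y] expresses all its powers as integral combinations
    of finitely many of them. *)
Lemma integer_bounded_powers (c : nat) y : (0 < c)%N -> Zadj (c%:R * y) ->
  integer_elt y -> exists D : nat, (0 < D)%N /\ forall k, Zadj (D%:R * y ^+ k).
Proof.
move=> c0 Zy [P Pmon Py].
have P0 : (0 < size P)%N by rewrite size_poly_gt0 monic_neq0.
set n := (size P).-1.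
exists (c ^ n)%N; split; first by rewrite expn_gt0 c0.
have Hs : size (map_poly (intr : int -> L) P) = n.+1.
  by rewrite size_map_inj_poly ?prednK //; exact: intr_ext_inj.
have Ey : y ^+ n = - \sum_(i < n) (P`_i)%:~R * y ^+ i.
  move/eqP: Py; rewrite horner_coef Hs big_ord_recr /=.
  rewrite coef_map_id0 // -[P`_n]/(lead_coef P) (monicP Pmon) mul1r addrC.
  move/eqP; rewrite addr_eq0 => /eqP ->; congr (- _); apply: eq_bigr => i _.
  by rewrite coef_map_id0.
move=> k; elim/ltn_ind: k => k IH.
have [kn|kn] := ltnP k n.
  have -> : ((c ^ n)%:R : L) * y ^+ k = c%:R ^+ (n - k) * (c%:R * y) ^+ k.
    by rewrite exprMn mulrA -exprD subnK 1?ltnW // natrX.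
  by apply: ZadjM; apply: ZadjX => //; exact: Zadj_nat.
have -> : y ^+ k = - \sum_(i < n) (P`_i)%:~R * y ^+ (k - n + i).
  rewrite -{1}(subnK kn) exprD Ey mulrN mulr_sumr; congr (- _).
  by apply: eq_bigr => i _; rewrite exprD mulrCA.
rewrite mulrN mulr_sumr; apply: ZadjN; apply: Zadj_sum => i _.
rewrite mulrCA; apply: ZadjM; first exact: Zadj_int.
by apply: IH; case: i => i /=; lia.
Qed.

(** [Z[z] / pi] has no nilpotents, because [w^f = w] modulo [pi].  Let
    [w = d pi^i x] be in [Z[z]] with [d] prime to [p].  Its high powers contain
    high powers of [x^3], hence of [p], while the powers of [eps] have a common
    denominator; so up to an integer prime to [p] a high power of [w] is
    divisible by [pi], hence so is [w] itself.  This lowers [i] until only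
    [d x / pi] is left. *)
Lemma nilpotent_mem_uniformizer (p e f : nat) (pi nu kappa eps x : L) :
  prime p -> Zadj pi -> Zadj nu -> Zadj kappa ->
  p%:R = pi * nu -> pi ^+ e = p%:R * kappa -> (1 < f)%N ->
  (forall w, Zadj w -> exists2 s, Zadj s & w ^+ f = w + pi * s) ->
  x \in <<1; z>>%VS -> integer_elt eps -> x ^+ 3 = p%:R * eps ->
  exists2 d : nat, ~~ (p %| d)%N & exists2 a, Zadj a & d%:R * x = pi * a.
Proof.
move=> pp Zpi Znu Zk Enu Ek f1 frob xz Ieps Ex.
have p0 : (p%:R : L) != 0 by rewrite natr_ext_eq0; case: p pp {Enu Ek Ex}.
have pi0 : pi != 0 by move: p0; rewrite Enu mulf_eq0 negb_or => /andP[].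
have [c [c0 Zc]] := Zadj_denominator xz.
have [D [D0 HD]] : exists D : nat, (0 < D)%N /\ forall k, Zadj (D%:R * eps ^+ k).
  apply: (@integer_bounded_powers (c ^ 3 * p)%N) => //.
    by rewrite muln_gt0 expn_gt0 c0 prime_gt0.
  rewrite natrM -mulrA -Ex natrX -exprMn; exact: ZadjX.
have [D' /= pD' ED] := pfactor_coprime pp D0; set b := logn p D in ED.
have D'p : ~~ (p %| D')%N by rewrite -prime_coprime.
have key i d : Zadj (d%:R * (pi ^+ i * x)) ->
  exists2 a, Zadj a & D'%:R * (d%:R * (pi ^+ i * x)) = pi * a.
  move Ew0: (d%:R * (pi ^+ i * x)) => w Zw.
  have [s Zs Es] : exists2 s, Zadj s & D'%:R * w ^+ (3 * b.+1) = p%:R * s.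
    exists (d%:R ^+ (3 * b.+1) * (pi ^+ (i * (3 * b.+1))) * (D%:R * eps ^+ b.+1)).
      by apply: ZadjM => //; apply: ZadjM; apply: ZadjX => //; exact: Zadj_nat.
    apply: (mulfI (expf_neq0 b p0)).
    rewrite -Ew0 !exprMn -exprM [x ^+ _]exprM Ex exprMn ED natrM natrX.
    by rewrite [p%:R ^+ b.+1]exprS; ring.
  (* a power of f exceeding 3 * b.+1, so that both congruences apply to w *)
  have [r Zr Er] : exists2 r, Zadj r & w ^+ (f ^ (3 * b.+1)) = w + pi * r.
    elim: (3 * b.+1)%N => [|k [r Zr Er]].
      by exists 0; [exact: (Zadj_nat _ 0)|rewrite expn0 expr1 mulr0 addr0].
    have [t Zt Et] := frob _ (ZadjD Zw (ZadjM Zpi Zr)).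
    by exists (r + t); [exact: ZadjD | rewrite expnSr exprM Er Et; ring].
  exists (nu * s * w ^+ (f ^ (3 * b.+1) - 3 * b.+1) - D'%:R * r).
    apply: ZadjD; first by apply: ZadjM; [exact: ZadjM|exact: ZadjX].
    by apply: ZadjN; apply: ZadjM => //; exact: Zadj_nat.
  have Ew : w = w ^+ (f ^ (3 * b.+1)) - pi * r by rewrite Er addrK.
  have Ewx : w ^+ (f ^ (3 * b.+1)) = w ^+ (f ^ (3 * b.+1) - 3 * b.+1) * w ^+ (3 * b.+1).
    by rewrite -exprD subnK // ltnW // ltn_expl.
  transitivity (w ^+ (f ^ (3 * b.+1) - 3 * b.+1) * (D'%:R * w ^+ (3 * b.+1)) - D'%:R * (pi *
    r)).
    by rewrite {1}Ew Ewx; ring.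
  by rewrite Es Enu; ring.
(* descent on the power of pi in the denominator *)
have step i d : ~~ (p %| d)%N -> Zadj (d%:R * (pi ^+ i * x)) ->
  exists2 d : nat, ~~ (p %| d)%N & exists2 a, Zadj a & d%:R * x = pi * a.
  elim: i d => [|i IH] d pd /key[a Za Ea].
    exists (D' * d)%N; first by rewrite Euclid_dvdM // negb_or D'p.
    by exists a => //; rewrite -Ea natrM expr0 mul1r mulrA.
  apply: (IH (D' * d)%N); first by rewrite Euclid_dvdM // negb_or D'p.
  suff -> : (D' * d)%:R * (pi ^+ i * x) = a by [].
  by apply: (mulfI pi0); rewrite -Ea natrM exprS; ring.
have [c' /= pc' Ec] := pfactor_coprime pp c0; set j := logn p c in Ec.
apply: (step (e * j)%N c'); first by rewrite -prime_coprime.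
have -> : c'%:R * (pi ^+ (e * j) * x) = kappa ^+ j * (c%:R * x).
  by rewrite exprM Ek exprMn Ec natrM natrX; ring.
by apply: ZadjM => //; exact: ZadjX.
Qed.

(** Since [pi^2] is divisible by [p], the element [pi] has valuation at least
    1/2, whereas an Eisenstein element has valuation 1/3 and can therefore not
    be divisible by [pi], even up to an integer prime to [p]. *)
Lemma eisenstein_uniformizer_contra (p f : nat) (pi nu kappa s x : L) :
  prime p -> integer_elt z -> Zadj pi -> Zadj nu -> Zadj kappa -> Zadj s ->
  p%:R = pi * nu -> pi ^+ 2 = p%:R * kappa -> (0 < f)%N ->
  z ^+ (p ^ f) = z + pi * s ->
  x \in <<1; z>>%VS -> ~ eisenstein p x.
Proof.
move=> pp Iz Zpi Znu Zk Zs Enu Ek f0 Ef xz ex.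
have Ix := eisenstein_integer ex.
have [eps [Ieps Ee]] : exists r, integer_elt r /\ x ^+ 3 = p%:R * r.
  case: (ex) => a1 [b1 [c1 [_ ->]]]; exists (- (a1%:~R * x ^+ 2 + b1%:~R * x + c1%:~R)).
  by split; [solve_integer|ring].
have [|w Zw|d pd [a Za Ea]] := nilpotent_mem_uniformizer (f := (p ^ f)%N) pp Zpi Znu Zk Enu
  Ek _ _ xz Ieps Ee.
- by rewrite -(exp1n f) ltn_exp2r // prime_gt1.
- case: Zw => q ->; have [r Zr ->] := Zadj_frobenius_iter z f q pp.
  have [t Zt ->] : exists2 t, Zadj t &
      (map_poly intr q).[z ^+ (p ^ f)] = (map_poly intr q).[z] + pi * t.
    apply: Zadj_horner_sub (ZadjX _ (Zadj_gen z)) (Zadj_gen z) _.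
    by exists s.
  by exists (t + nu * r); [apply: ZadjD => //; exact: ZadjM|rewrite Enu; ring].
case/negP: pd; suff : (p%:Z %| d%:Z ^+ 2)%Z by move/(prime_dvdzX pp).
apply: (eisenstein_sq_dvd (y := kappa * a ^+ 2) pp ex).
  by apply: integerM (integer_Zadj Iz Zk) (integerX _ (integer_Zadj Iz Za)).
have -> : ((d%:Z ^+ 2)%:~R : L) = d%:R ^+ 2 by rewrite expr2 intrM.
by rewrite -exprMn Ea exprMn Ek -mulrA.
Qed.

(** If [p] does not divide [m], then [z^(p^f) = z] for [f = totient m], and
    [pi = p] is admissible.  If [p = 3] and [m = 3 m'] with [m'] prime to 3,
    then [z^(3^f)] for [f = totient m'] is [z] times a power of the cube root of
    unity [w = z^m'], and [pi = 1 - w] is admissible since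
    [(1 - w)^2 = - 3 w]. *)
Lemma eisenstein_cyclotomic_dvd (m p : nat) x : (0 < m)%N -> m.-primitive_root z ->
  x \in <<1; z>>%VS -> prime p -> eisenstein p x -> (p ^ (1 + (p == 3)) %| m)%N.
Proof.
move=> m0 zm xz pp ex.
have Iz : integer_elt z.
  exists ('X^m - 1); first by rewrite monicXnsubC.
  by rewrite rmorphB /= map_polyXn rmorph1 rootE !hornerE (prim_expr_order zm) subrr.
have pm : (p %| m)%N.
  apply: contraT => npm.
  have cop : coprime p m by rewrite prime_coprime.
  case: (@eisenstein_uniformizer_contra p (totient m) p%:R 1 p%:R 0 x) => //.
  - exact: Zadj_nat.
  - exact: (Zadj_nat _ 1).
  - exact: Zadj_nat.
  - exact: (Zadj_nat _ 0).
  - by rewrite mulr1.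
  - by rewrite totient_gt0.
  - rewrite mulr0 addr0 -[RHS]expr1; apply/eqP.
    by rewrite (eq_prim_root_expr zm) Euler_exp_totient.
have [p3|] := eqVneq p 3%N; last by rewrite expn1.
subst p; rewrite /= (_ : 3 ^ 2 = 9)%N //.
have [m' Em] := dvdnP pm.
rewrite Em (_ : 9 = 3 * 3)%N // dvdn_pmul2r //; apply: contraT => npm'.
have m'0 : (0 < m')%N by lia.
have wz : 3.-primitive_root (z ^+ m').
  by have := dvdn_prim_root zm pm; rewrite Em mulnK.
set w := z ^+ m' in wz.
have w3 : w ^+ 3 = 1 by exact: prim_expr_order.
have w1 : 1 - w != 0.
  rewrite subr_eq0 eq_sym; have := prim_order_dvd wz 1.
  by rewrite expr1 => <-.
have ww : w ^+ 2 + w + 1 = 0.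
  apply: (mulfI w1); rewrite mulr0.
  have -> : (1 - w) * (w ^+ 2 + w + 1) = 1 - w ^+ 3 by ring.
  by rewrite w3 subrr.
have Zw : Zadj w by exact: ZadjX (Zadj_gen z).
have cop : coprime 3 m' by rewrite prime_coprime.
have f0 : (0 < totient m')%N by rewrite totient_gt0.
have [l El] : exists l, (3 ^ totient m' = 1 + m' * l)%N.
  have := Euler_exp_totient cop => /eqP; rewrite eqn_mod_dvd ?expn_gt0 //.
  by move=> /dvdnP[l El]; exists l; have : (0 < 3 ^ totient m')%N by [rewrite expn_gt0]; lia.
case: (@eisenstein_uniformizer_contra 3 (totient m') (1 - w) (2 + w) (- w) (- z * \sum_(i <
  l) w ^+ i) x) => //.
- by apply: ZadjD; [exact: (Zadj_nat _ 1)|exact: ZadjN].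
- by apply: ZadjD => //; exact: (Zadj_nat _ 2).
- exact: ZadjN.
- apply: ZadjM; first by apply: ZadjN; exact: Zadj_gen.
  by apply: Zadj_sum => i _; exact: ZadjX.
- by rewrite -[LHS]addr0 -[X in _ + X]oppr0 -ww; ring.
- by rewrite -[LHS]addr0 -[X in _ + X]oppr0 -ww; ring.
- have := subrX1 w l; rewrite El exprD expr1 exprM -/w => E.
  have -> : w ^+ l = 1 + (w - 1) * \sum_(i < l) w ^+ i by rewrite -E addrC subrK.
  ring.
Qed.
End Ramification.

Lemma eisenstein_rmorph (K L : fieldExtType rat) (f : {rmorphism K -> L}) p x :
  eisenstein p x -> eisenstein p (f x).
Proof.
case=> a [b [c [pc E]]]; exists a, b, c; split => //.
by rewrite -rmorphXn E !(rmorphM, rmorphN, rmorphD) /= !rmorph_int rmorph_nat.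
Qed.

Lemma eisenstein_in_cyclotomic (K : fieldExtType rat) (p m : nat) (x : K) :
  (0 < m)%N -> in_cyclotomic K m -> prime p -> eisenstein p x ->
  (p ^ (1 + (p == 3)) %| m)%N.
Proof.
move=> m0 [L [iota [z [zm sub]]]] pp ex.
apply: (eisenstein_cyclotomic_dvd m0 zm _ pp (eisenstein_rmorph iota ex)).
by apply: (subvP sub); exact: memv_img (memvf x).
Qed.

(** * Cubic Gauss sums *)

Section EisensteinIntegers.
Definition omega : algC := sval (C_prim_root_exists (isT : (0 < 3)%N)).
Local Notation w := omega.

Lemma omega_prim : 3.-primitive_root w.
Proof. exact: svalP (C_prim_root_exists (isT : (0 < 3)%N)). Qed.

Lemma omega3 : w ^+ 3 = 1.
Proof. exact: prim_expr_order omega_prim. Qed.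

Lemma omega_neq1 : w != 1.
Proof. by have := prim_order_dvd omega_prim 1; rewrite expr1 => <-. Qed.

Lemma omega2 : w ^+ 2 = - 1 - w.
Proof.
have w1 : w - 1 != 0 by rewrite subr_eq0 omega_neq1.
apply: (mulfI w1); have -> : (w - 1) * w ^+ 2 = w ^+ 3 - w ^+ 2 by ring.
by rewrite omega3; ring.
Qed.

Lemma unity_conjC n (x : algC) : (0 < n)%N -> x ^+ n = 1 -> x^* = x ^+ n.-1.
Proof.
move=> n0 xn; have x0 : x != 0.
  by apply: contra_eqN xn => /eqP ->; rewrite expr0n eqn0Ngt n0 eq_sym oner_eq0.
have nx : `|x| = 1.
  apply/eqP; rewrite -(@pexpr_eq1 _ _ n) ?normr_ge0 ?lt0n_neq0 //.
  by rewrite -normrX xn normr1.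
apply: (mulfI x0); rewrite -normCK nx expr1n -exprS prednK //.
Qed.

Lemma omega_conj : w^* = - 1 - w.
Proof. by rewrite (unity_conjC (n := 3)) ?omega3 // omega2. Qed.

Definition eisint (a b : int) : algC := a%:~R + b%:~R * w.
Definition eisnorm (a b : int) : int := a ^+ 2 - a * b + b ^+ 2.

Lemma eisintM a b c d :
  eisint a b * eisint c d = eisint (a * c - b * d) (a * d + b * c - b * d).
Proof.
rewrite /eisint !(intrD, intrM, mulrNz).
have -> : (a%:~R + b%:~R * w) * (c%:~R + d%:~R * w)
  = a%:~R * c%:~R + (a%:~R * d%:~R + b%:~R * c%:~R) * w + b%:~R * d%:~R * w ^+ 2 by ring.
by rewrite omega2; ring.
Qed.

Lemma eisint_conj a b : (eisint a b)^* = eisint (a - b) (- b).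
Proof.
rewrite /eisint rmorphD rmorphM /= !rmorph_int omega_conj !(intrD, mulrNz); ring.
Qed.

Lemma eisintK a b : eisint a b * (eisint a b)^* = (eisnorm a b)%:~R.
Proof.
rewrite eisint_conj eisintM /eisint /eisnorm.
have -> : a * - b + b * (a - b) - b * - b = 0 by ring.
by rewrite mul0r addr0; congr (_%:~R); ring.
Qed.

Lemma eisint_eq0 (a b : int) : eisint a b = 0 -> a = 0 /\ b = 0.
Proof.
move=> E; have := eisintK a b; rewrite E mul0r => /esym/eqP; rewrite intr_eq0 /eisnorm => /eqP.
by split; nia.
Qed.

Lemma eisint_inj a b c d : eisint a b = eisint c d -> a = c /\ b = d.
Proof.
move=> E; have [] := @eisint_eq0 (a - c) (b - d); last by lia.
move/eqP: E; rewrite -subr_eq0 => /eqP E; rewrite -[RHS]E /eisint !(intrD, mulrNz); ring.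
Qed.

Lemma eisnormM a b c d a' b' : eisint a b = eisint c d * eisint a' b' ->
  eisnorm a b = eisnorm c d * eisnorm a' b'.
Proof.
by rewrite eisintM => /eisint_inj[-> ->]; rewrite /eisnorm; ring.
Qed.

Lemma Aint_dvdz (n N : int) y : n != 0 -> y \in Aint -> N%:~R = n%:~R * y -> (n %| N)%Z.
Proof.
move=> n0 Ay E; have n0' : (n%:~R : algC) != 0 by rewrite intr_eq0.
have Ey : y = N%:~R / n%:~R by rewrite E mulrC mulKf.
have : y \in Num.int.
  by apply: Cint_rat_Aint => //; rewrite Ey rpred_div // rpred_int_num // intr_int.
case/intrP=> m Em; apply/dvdzP; exists m.
by apply/(@intr_inj algC); rewrite E Em mulrC intrM.
Qed.

(** The trace and the norm of [(a + b omega) / 3] are rational algebraic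
    integers. *)
Lemma eisint_dvd3 a b y : y \in Aint -> eisint a b = 3%:R * y -> (3 %| a)%Z /\ (3 %| b)%Z.
Proof.
move=> Ay E.
have Ayc : y^* \in Aint by rewrite Aint_aut.
have /dvdzP[m Em] : (3 %| 2 * a - b)%Z.
  apply: (@Aint_dvdz _ _ (y + y^*)) => //; first exact: rpredD.
  rewrite mulrDr -[3%:~R]/(3%:R) -E -[X in _ * X^*]/y.
  have -> : 3%:R * y^* = (eisint a b)^* by rewrite E rmorphM /= rmorph_nat.
  by rewrite eisint_conj /eisint !(intrD, intrM, mulrNz); ring.
have /dvdzP[n En] : (9 %| eisnorm a b)%Z.
  apply: (@Aint_dvdz _ _ (y * y^*)) => //; first exact: rpredM.
  by rewrite -eisintK E rmorphM /= rmorph_nat; ring.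
have : (3%:Z %| a ^+ 2)%Z by apply/dvdzP; exists (n + a * m - m ^+ 2); rewrite /eisnorm in
  En; nia.
move/(prime_dvdzX (p := 3) isT) => a3; split => //.
have /dvdzP[a' Ea] := a3.
by apply/dvdzP; exists (2 * a' - m); lia.
Qed.

Section CubicGaussSum.
Variable p : nat.
Hypotheses (pp : prime p) (p1 : (p %% 3 = 1)%N).
Local Notation F := 'F_p.

(** The map [a -> a^((p - 1) / 3)] sends the units of [F_p] onto the cube roots
    of unity [1, r, r^2] of [F_p]; the character is its composition with
    [r -> omega]. *)
Lemma cubic_residue_char : exists chi : F -> algC,
  [/\ chi 0 = 0, {morph chi : a b / a * b},
      forall a, a != 0 -> exists i : nat, chi a = w ^+ i
    & exists2 h, h != 0 & chi h != 1].
Proof.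
pose k := (p %/ 3)%N.
have pk : p = (k * 3).+1 by rewrite {1}(divn_eq p 3) p1 addn1.
have k0 : (0 < k)%N by have := prime_gt1 pp; lia.
have cF : #|F| = p by rewrite card_Fp.
have ord (a : F) : a != 0 -> (a ^+ k) ^+ 3 = 1.
  move=> a0; apply: (mulfI a0); rewrite -exprM -exprS -pk mulr1.
  by have := expf_card a; rewrite cF.
have [h h0 hk] : exists2 h : F, h != 0 & h ^+ k != 1.
  apply/exists_inP; apply: contraT; rewrite negb_exists_in => /forall_inP H.
  have := @max_unity_roots _ k (enum [pred x : F | x != 0]) k0 _ (enum_uniq _).
  rewrite -cardE.
  have -> : #|[pred x : F | x != 0]| = (k * 3)%N.
    have := cardC1 (0 : F); rewrite cF [in RHS]pk /= => <-.
    by apply: eq_card => x; rewrite !inE.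
  have -> : all k.-unity_root (enum [pred x : F | x != 0]).
    apply/allP => x; rewrite mem_enum inE => /H; rewrite negbK unity_rootE => //.
  by move=> /(_ isT); lia.
pose r := h ^+ k; have r3 : r ^+ 3 = 1 by exact: ord.
have r1 : r - 1 != 0 by rewrite subr_eq0.
have r2 : r ^+ 2 = - 1 - r.
  apply: (mulfI r1); have -> : (r - 1) * r ^+ 2 = r ^+ 3 - r ^+ 2 by ring.
  by rewrite r3; ring.
have powr (a : F) : a != 0 -> exists i : nat, a ^+ k = r ^+ i.
  move=> a0; have := ord a a0; set y := a ^+ k => y3.
  have : (y - 1) * ((y - r) * (y - r ^+ 2)) = 0.
    rewrite r2; have -> : (y - 1) * ((y - r) * (y - (- 1 - r))) = y ^+ 3 - 1 + (y - 1) * (- r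
      ^+ 2 - r - 1) by ring.
    by rewrite y3 r2; ring.
  move/eqP; rewrite !mulf_eq0 !subr_eq0 => /or3P[] /eqP ->;
    [by exists 0%N | by exists 1%N | by exists 2%N].
pose psi (y : F) : algC := if y == 1 then 1 else if y == r then w else w ^+ 2.
have psiX n : psi (r ^+ n) = w ^+ n.
  have -> : r ^+ n = r ^+ (n %% 3).
    by rewrite {1}(divn_eq n 3) exprD mulnC exprM r3 expr1n mul1r.
  have -> : w ^+ n = w ^+ (n %% 3).
    by rewrite {1}(divn_eq n 3) exprD mulnC exprM omega3 expr1n mul1r.
  have : (n %% 3 < 3)%N by rewrite ltn_mod.
  have nr1 : (r == 1) = false by apply/negbTE.
  case: (n %% 3)%N => [|[|[|//]]] _; rewrite /psi ?expr0 ?expr1 ?eqxx // ?nr1 //.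
  case: eqP => [E|_].
    by move: r3 hk; rewrite exprS E mulr1 -/r => ->; rewrite eqxx.
  case: eqP => // /eqP; rewrite expr2 -subr_eq0 -{3}[r]mulr1 -mulrBr mulf_eq0 (negbTE r1) orbF.
  by rewrite /r expf_eq0 (negbTE h0) andbF.
exists (fun a => if a == 0 then 0 else psi (a ^+ k)); split.
- by rewrite eqxx.
- move=> a b; rewrite mulf_eq0; case: eqP => [|/eqP a0]; first by rewrite mul0r.
  case: eqP => [|/eqP b0]; first by rewrite mulr0.
  have [[i Ei] [j Ej]] := (powr a a0, powr b b0).
  by rewrite /= exprMn Ei Ej -exprD !psiX exprD.
- by move=> a a0; rewrite (negbTE a0); have [i ->] := powr a a0; exists i; rewrite psiX.
- exists h => //; rewrite (negbTE h0) -/r -[r]expr1 psiX expr1 omega_neq1 //.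
Qed.

(** With the Jacobi sum [J = sum_c chi(c) chi(1 - c)] one has
    [g^2 = J conj(g)] and [g conj(g) = p], so [g^3 = p J] and
    [J conj(J) = p].  Cubing is additive modulo 3 and [chi^3] is trivial, so
    [g^3] is the sum of the [zeta^(3 a)] over nonzero [a], which is -1, modulo 3;
    as [p = 1 mod 3], also [J = -1] modulo 3. *)
Lemma cubic_gauss_sum (zeta : algC) : p.-primitive_root zeta ->
  exists (chi : F -> algC) (c d : int),
  let g := \sum_(a : F) chi a * zeta ^+ a in
  [/\ forall a, chi a = 0 \/ exists i : nat, chi a = w ^+ i,
      g ^+ 3 = p%:R * eisint c d, eisnorm c d = p,
      (3 %| c + 1)%Z & (3 %| d)%Z].
Proof.
move=> zp; have [chi [chi0 chiM chiw [h h0 chih]]] := cubic_residue_char.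
pose e (a : F) := zeta ^+ a.
have eN n : e n%:R = zeta ^+ n.
  by rewrite /e val_Fp_nat // (prim_expr_mod zp).
have eD a b : e (a + b) = e a * e b.
  by rewrite -[a]natr_Zp -[b]natr_Zp -natrD !eN exprD.
have e0 : e 0 = 1 by rewrite -[0]/(0%:R : F) eN expr0.
have eV a : (e a)^* = e (- a).
  have ea0 : e a != 0.
    rewrite expf_neq0 //; apply: contra_eq_neq (prim_expr_order zp) => ->.
    by rewrite expr0n eqn0Ngt prime_gt0 // eq_sym oner_neq0.
  have ep : e a ^+ p = 1 by rewrite -exprM mulnC exprM (prim_expr_order zp) expr1n.
  apply: (mulfI ea0); rewrite -eD subrr e0 (unity_conjC (prime_gt0 pp) ep).
  by rewrite -exprS prednK // prime_gt0.
have char3 i : (w ^+ i)^* = (w ^+ i) ^+ 2.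
  by apply: (unity_conjC (n := 3)) => //; rewrite -exprM mulnC exprM omega3 expr1n.
have chiV a : (chi a)^* = chi a ^+ 2.
  by have [->|/chiw[i ->]] := eqVneq a 0; [rewrite chi0 rmorph0 expr0n|exact: char3].
have chi3 a : a != 0 -> chi a ^+ 3 = 1.
  by case/chiw=> i ->; rewrite -exprM mulnC exprM omega3 expr1n.
have chiU a : a != 0 -> chi a * (chi a)^* = 1.
  by move=> a0; rewrite chiV -exprS chi3.
have chi1 : chi 1 = 1.
  have /chiw[i Ei] : (1 : F) != 0 by exact: oner_neq0.
  have c0 : chi 1 != 0.
    by have := chi3 _ (oner_neq0 F); apply: contra_eq_neq => ->; rewrite expr0n eq_sym
      oner_neq0.
  by apply: (mulfI c0); rewrite -chiM !mulr1.
have chiN1 : chi (- 1) = 1.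
  have n1 : (- 1 : F) != 0 by rewrite oppr_eq0 oner_neq0.
  by rewrite -[RHS](chi3 _ n1) !exprS expr0 mulr1 -!chiM mulrN1 opprK mulr1.
have chiN a : chi (- a) = chi a by rewrite -mulN1r chiM chiN1 mul1r.
have sum_chi : \sum_a chi a = 0.
  have h1 : chi h - 1 != 0 by rewrite subr_eq0.
  apply: (mulfI h1); rewrite mulr0 mulrBl mul1r mulr_sumr.
  rewrite [X in _ - X](reindex_inj (mulfI h0)) /=.
  by rewrite (eq_bigr _ (fun a _ => chiM h a)) subrr.
have sum_e (d : F) : \sum_b e (b * d) = if d == 0 then p%:R else 0.
  case: eqP => [->|/eqP d0].
    rewrite (eq_bigr (fun=> 1)) => [|b _]; last by rewrite mulr0 e0.
    by rewrite sumr_const card_Fp.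
  transitivity (\sum_b e b); first by rewrite [RHS](reindex_inj (mulIf d0)).
  have z1 : e 1 - 1 != 0.
    have -> : e 1 = zeta by exact: (eN 1%N).
    rewrite subr_eq0; apply: contraTneq (prime_gt1 pp) => z1.
    by have := prim_order_dvd zp 1; rewrite z1 expr1 eqxx dvdn1 => /eqP ->.
  apply: (mulfI z1); rewrite mulr0 mulrBl mul1r mulr_sumr.
  rewrite [X in _ - X](reindex_inj (addrI 1)) /=.
  by rewrite (eq_bigr _ (fun a _ => eD 1 a)) subrr.
pose G := \sum_a chi a * e a.
have GG : G * G^* = p%:R.
  rewrite /G rmorph_sum /= mulr_sumr.
  rewrite (eq_bigr (fun b => \sum_c chi c * (if b == 0 then 0 else e (b * (c - 1))))).
    rewrite exchange_big /= (eq_bigr (fun c => chi c * ((if c == 1 then p%:R else 0) - 1))).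
      under eq_bigr do rewrite mulrBr mulr1.
      rewrite sumrB sum_chi subr0 (bigD1 1) //= ?eqxx chi1 mul1r big1 ?addr0 // => c /negbTE
        ->.
      by rewrite mulr0.
    move=> c _; rewrite -mulr_sumr; congr (_ * _).
    have := sum_e (c - 1); rewrite subr_eq0 => <-.
    rewrite (bigD1 0) //= ?eqxx add0r [in RHS](bigD1 0) //= mul0r e0 addrAC subrr add0r.
    by apply: eq_bigr => b /negbTE ->.
  move=> b _; rewrite rmorphM /= eV.
  have [->|b0] := eqVneq b 0.
    by rewrite chi0 rmorph0 mul0r mulr0 big1 // => c _; rewrite mulr0.
  rewrite (reindex_inj (mulfI b0)) mulr_suml /=; apply: eq_bigr => c _.
  have -> : b * (c - 1) = b * c - b by ring.
  rewrite eD chiM -[RHS]mul1r -(chiU _ b0); ring.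
pose J := \sum_c chi c * chi (1 - c).
have sum_chi2 : \sum_a (chi a)^* = 0 by rewrite -rmorph_sum /= sum_chi rmorph0.
have G2 : G ^+ 2 = J * G^*.
  have -> : G ^+ 2 = \sum_s (\sum_a chi a * chi (s - a)) * e s.
    rewrite expr2 {1}/G mulr_suml (eq_bigr (fun a => \sum_s chi a * chi (s - a) * e s)).
      by rewrite exchange_big /=; apply: eq_bigr => s _; rewrite mulr_suml.
    move=> a _; rewrite /G mulr_sumr (reindex_inj (addIr (- a))) /=.
    apply: eq_bigr => s _.
    have -> : e s = e (s - a) * e a by rewrite -eD subrK.
    ring.
  have -> : J * G^* = \sum_s (chi s)^* * J * e s.
    rewrite /G rmorph_sum /= (reindex_inj oppr_inj) /= mulr_sumr.
    by apply: eq_bigr => s _; rewrite rmorphM /= eV opprK chiN; ring.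
  apply: eq_bigr => s _; congr (_ * _).
  have [->|s0] := eqVneq s 0.
    rewrite chi0 rmorph0 mul0r -[RHS]sum_chi2; apply: eq_bigr => a _.
    by rewrite sub0r chiN chiV expr2.
  rewrite (reindex_inj (mulfI s0)) /= /J mulr_sumr; apply: eq_bigr => c _.
  have -> : s - s * c = s * (1 - c) by ring.
  by rewrite !chiM chiV; ring.
have p0 : (p%:R : algC) != 0 by rewrite pnatr_eq0 -lt0n prime_gt0.
have G3 : G ^+ 3 = p%:R * J by rewrite exprS G2 mulrCA GG mulrC.
have JJ : J * J^* = p%:R.
  apply: (mulfI p0); rewrite -{1}GG.
  transitivity ((J * G^*) * (J * G^*)^*); first by rewrite rmorphM /= conjCK; ring.
  by rewrite -G2 rmorphXn /= -exprMn GG expr2.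
have Aw : w \in Aint by exact: (Aint_prim_root omega_prim).
have Ae a : e a \in Aint by rewrite rpredX // (Aint_prim_root zp).
have Achi a : chi a \in Aint.
  by have [->|/chiw[i ->]] := eqVneq a 0; [rewrite chi0 rpred0|rewrite rpredX].
have [c [d EJ]] : exists c d, J = eisint c d.
  have Ew i : exists c d, w ^+ i = eisint c d.
    elim: i => [|i [c [d IH]]].
      by exists 1, 0; rewrite expr0 /eisint mul0r addr0.
    exists (- d), (c - d); rewrite exprS IH /eisint !(intrD, mulrNz).
    have -> : w * (c%:~R + d%:~R * w) = c%:~R * w + d%:~R * w ^+ 2 by ring.
    by rewrite omega2; ring.
  have Ec a : exists c d, chi a = eisint c d.
    have [->|/chiw[i ->]] := eqVneq a 0; last exact: Ew.
    by exists 0, 0; rewrite chi0 /eisint mul0r addr0.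
  rewrite /J; elim/big_rec: _ => [|a x _ [c [d ->]]].
    by exists 0, 0; rewrite /eisint mul0r addr0.
  have [[c1 [d1 ->]] [c2 [d2 ->]]] := (Ec a, Ec (1 - a)).
  rewrite eisintM; set u := _ - _; set v := _ - _.
  by exists (u + c), (v + d); rewrite /eisint !intrD; ring.
have cube_mod (x y : algC) : x \in Aint -> y \in Aint ->
  exists2 s, s \in Aint & (x + y) ^+ 3 = x ^+ 3 + y ^+ 3 + 3%:R * s.
  move=> Ax Ay; exists (x * y * (x + y)); last by ring.
  by rewrite rpredM ?rpredD // rpredM.
have [s As Es] : exists2 s, s \in Aint & G ^+ 3 = \sum_a (chi a * e a) ^+ 3 + 3%:R * s.
  have : exists x s, [/\ x \in Aint, s \in Aint, G = x & x ^+ 3 = \sum_a (chi a * e a) ^+ 3 +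
    3%:R * s].
    rewrite /G; elim/big_rec2: _ => [|a y x _ [x' [s [Ax As -> E]]]].
      by exists 0, 0; rewrite expr0n mulr0 addr0; split => //; exact: rpred0.
    have [t At Et] := cube_mod (chi a * e a) x' (rpredM (Achi a) (Ae a)) Ax.
    exists (chi a * e a + x'), (t + s); split=> //; do ?[exact: rpredD | by rewrite rpredD //
      rpredM].
    by rewrite Et E; ring.
  by case=> x [s [_ As -> E]]; exists s.
have three0 : (3%:R : F) != 0.
  apply/eqP => E; have := val_Fp_nat pp 3; rewrite E /= => /esym/eqP.
  rewrite -/(p %| 3)%N dvdn_prime2 // => /eqP E3; by have := p1; rewrite E3.
have sum3 : \sum_a (chi a * e a) ^+ 3 = - 1.
  rewrite (bigD1 0) //= chi0 mul0r expr0n add0r.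
  have := sum_e 3%:R; rewrite (negbTE three0) (bigD1 0) //= mul0r e0 => /eqP.
  rewrite addrC addr_eq0 => /eqP <-; apply: eq_bigr => a a0.
  by rewrite exprMn chi3 // mul1r mulr_natr !mulrS addr0 !eD exprS expr2.
have [c3 d3] : (3 %| c + 1)%Z /\ (3 %| d)%Z.
  pose k := (p %/ 3)%N; have pk : p = (k * 3 + 1)%N by rewrite {1}(divn_eq p 3) p1.
  have AJ : J \in Aint by rewrite EJ /eisint rpredD // ?rpredM // ?Aint_int ?intr_int.
  apply: (@eisint_dvd3 _ _ (s - k%:R * J)).
    by rewrite rpredB // rpredM // rpred_nat.
  have : (k * 3 + 1)%:R * J = - 1 + 3%:R * s by rewrite -pk -G3 Es sum3.
  rewrite natrD natrM => E.
  have -> : eisint (c + 1) d = (k%:R * 3%:R + 1) * J + 1 - 3%:R * k%:R * J.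
    by rewrite EJ /eisint intrD; ring.
  by rewrite E; ring.
exists chi, c, d; split => //.
- by move=> a; have [->|/chiw] := eqVneq a 0; [left|right].
- by rewrite G3 EJ.
- by apply/(@intr_inj algC); rewrite -eisintK -EJ JJ.
Qed.
End CubicGaussSum.

(** * Cube roots of Eisenstein integers in cyclotomic fields *)

Section CyclotomicValues.
Variables (m : nat) (z : algC).
Hypotheses (m0 : (0 < m)%N) (zm : m.-primitive_root z).

Definition Qadj (z x : algC) := exists q : {poly rat}, x = (map_poly ratr q).[z].
(** The ring [Q(z)[omega]].  Its elements come with their coordinates over
    [Q(z)], on which an automorphism moving only [omega] can be computed. *)
Definition Qadj_omega (z x : algC) :=
  exists a b, [/\ Qadj z a, Qadj z b & x = a + b * w].

Lemma Qadj_rat (r : rat) : Qadj z (ratr r).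
Proof. by exists r%:P; rewrite map_polyC hornerC. Qed.
Lemma Qadj_int (n : int) : Qadj z n%:~R.
Proof. by rewrite -(ratr_int algC); exact: Qadj_rat. Qed.
Lemma QadjD x y : Qadj z x -> Qadj z y -> Qadj z (x + y).
Proof. by case=> [p ->] [q ->]; exists (p + q); rewrite rmorphD hornerD. Qed.
Lemma QadjM x y : Qadj z x -> Qadj z y -> Qadj z (x * y).
Proof. by case=> [p ->] [q ->]; exists (p * q); rewrite rmorphM hornerM. Qed.
Lemma QadjN x : Qadj z x -> Qadj z (- x).
Proof. by case=> [p ->]; exists (- p); rewrite rmorphN hornerN. Qed.
Lemma QadjX x n : Qadj z x -> Qadj z (x ^+ n).
Proof.
by move=> Hx; elim: n => [|n IH]; [exact: (Qadj_int 1)|rewrite exprS; exact: QadjM].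
Qed.
Lemma Qadj_gen : Qadj z z.
Proof. by exists 'X; rewrite map_polyX hornerX. Qed.
Lemma Qadj_unity n x : (n %| m)%N -> x ^+ n = 1 -> Qadj z x.
Proof.
move=> /dvdnP[k Em] xn; have xm : x ^+ m = 1 by rewrite Em mulnC exprM xn expr1n.
have [i ->] := prim_rootP zm xm.
by apply: QadjX; exact: Qadj_gen.
Qed.
Lemma Qadj_conj x : Qadj z x -> Qadj z x^*.
Proof.
case=> q ->; elim/poly_ind: q => [|q c IH].
  by rewrite rmorph0 horner0 rmorph0; exact: (Qadj_int 0).
rewrite rmorphD rmorphM /= map_polyX map_polyC !(hornerD, hornerM, hornerX, hornerC).
rewrite rmorphD rmorphM /=; apply: QadjD.
  apply: QadjM => //; rewrite (unity_conjC m0 (prim_expr_order zm)).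
  by apply: QadjX; exact: Qadj_gen.
by rewrite fmorph_rat; exact: Qadj_rat.
Qed.

Lemma Qadj_Qadj_omega x : Qadj z x -> Qadj_omega z x.
Proof. by move=> Hx; exists x, 0; split => //; [exact: (Qadj_int 0)|rewrite mul0r addr0]. Qed.
Lemma Qadj_omega_omega : Qadj_omega z w.
Proof.
by exists 0, 1; split; [exact: (Qadj_int 0)|exact: (Qadj_int 1)|rewrite mul1r add0r].
Qed.
Lemma Qadj_omegaD x y : Qadj_omega z x -> Qadj_omega z y -> Qadj_omega z (x + y).
Proof.
case=> [a [b [Ha Hb ->]]] [c [d [Hc Hd ->]]]; exists (a + c), (b + d).
by split; [exact: QadjD|exact: QadjD|ring].
Qed.
Lemma Qadj_omegaM x y : Qadj_omega z x -> Qadj_omega z y -> Qadj_omega z (x * y).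
Proof.
case=> [a [b [Ha Hb ->]]] [c [d [Hc Hd ->]]].
exists (a * c - b * d), (a * d + b * c - b * d); split.
- by apply: QadjD; [|apply: QadjN]; exact: QadjM.
- by apply: QadjD; [apply: QadjD|apply: QadjN]; exact: QadjM.
have -> : (a + b * w) * (c + d * w) = a * c + (a * d + b * c) * w + b * d * w ^+ 2 by ring.
by rewrite omega2; ring.
Qed.
Lemma Qadj_omega_int (n : int) : Qadj_omega z n%:~R.
Proof. by apply: Qadj_Qadj_omega; exact: Qadj_int. Qed.
Lemma Qadj_omegaX x n : Qadj_omega z x -> Qadj_omega z (x ^+ n).
Proof.
by move=> Hx; elim: n => [|n IH]; [exact: (Qadj_omega_int 1)|rewrite exprS; exact:
  Qadj_omegaM].
Qed.
Lemma Qadj_omega_eisint a b : Qadj_omega z (eisint a b).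
Proof. by exists a%:~R, b%:~R; split => //; exact: Qadj_int. Qed.
Lemma Qadj_omega_conj x : Qadj_omega z x -> Qadj_omega z x^*.
Proof.
case=> [a [b [Ha Hb ->]]]; exists (a^* - b^*), (- b^*); split.
- by apply: QadjD; [|apply: QadjN]; exact: Qadj_conj.
- by apply: QadjN; exact: Qadj_conj.
by rewrite rmorphD rmorphM /= omega_conj; ring.
Qed.

Lemma cubic_gauss_sum_cyclotomic p : prime p -> (p %% 3 = 1)%N -> (p %| m)%N ->
  exists (g : algC) c d, [/\ Qadj_omega z g, g ^+ 3 = p%:R * eisint c d,
   eisnorm c d = p, (3 %| c + 1)%Z & (3 %| d)%Z].
Proof.
move=> pp p1 pm; have [zeta zp] := C_prim_root_exists (prime_gt0 pp).
have [chi [c [d [chiw G3 N c3 d3]]]] := cubic_gauss_sum pp p1 zp.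
exists (\sum_a chi a * zeta ^+ a), c, d; split => //.
elim/big_rec: _ => [|a x _ Hx]; first exact: (Qadj_omega_int 0).
apply: Qadj_omegaD => //; apply: Qadj_omegaM.
  have [->|[i ->]] := chiw a; first exact: (Qadj_omega_int 0).
  by apply: Qadj_omegaX; exact: Qadj_omega_omega.
apply: Qadj_omegaX; apply: Qadj_Qadj_omega; apply: (Qadj_unity pm).
exact: prim_expr_order zp.
Qed.
End CyclotomicValues.

Lemma eisint_dvd_aux (p : nat) (a b c d : int) : prime p -> eisnorm c d = p ->
  (p%:Z %| eisnorm a b)%Z -> (p%:Z %| b * c - a * d)%Z ->
  exists a' b', eisint a b = eisint c d * eisint a' b'.
Proof.
move=> pp N pN pY.
have pX : (p%:Z %| a * c - a * d + b * d)%Z.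
  apply: (@prime_dvdzX _ _ 2 pp).
  have -> : (a * c - a * d + b * d) ^+ 2 = eisnorm c d * eisnorm a b
     + (b * c - a * d) * (a * c - a * d + b * d - (b * c - a * d)) by rewrite /eisnorm; ring.
  by rewrite rpredD //; [exact: dvdz_mull|exact: dvdz_mulr].
have [[X EX] [Y EY]] := (dvdzP pX, dvdzP pY).
have p0 : p%:Z != 0 by case: p pp {N pN pY pX EX EY}.
exists X, Y; rewrite eisintM; congr eisint; apply: (mulIf p0).
- have -> : (c * X - d * Y) * p = c * (X * p) - d * (Y * p) by ring.
  by rewrite -EX -EY -N /eisnorm; ring.
- have -> : (c * Y + d * X - d * Y) * p = c * (Y * p) + d * (X * p) - d * (Y * p) by ring.
  by rewrite -EX -EY -N /eisnorm; ring.
Qed.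

(** The product of the [omega]-coordinates of [alpha conj(pi)] and [alpha pi] is
    a combination of the norms of [pi = c + d omega] and [alpha = a + b omega],
    so [p] divides one of the two. *)
Lemma eisint_dvd_or (p : nat) (a b c d : int) : prime p -> eisnorm c d = p ->
  (p%:Z %| eisnorm a b)%Z ->
  (exists a' b', eisint a b = eisint c d * eisint a' b') \/
  (exists a' b', eisint a b = eisint (c - d) (- d) * eisint a' b').
Proof.
move=> pp N pN.
have : (p%:Z %| (b * c - a * d) * (a * d + b * c - b * d))%Z.
  have -> : (b * c - a * d) * (a * d + b * c - b * d) = b ^+ 2 * eisnorm c d - d ^+ 2 *
    eisnorm a b.
    by rewrite /eisnorm; ring.
  by rewrite N rpredB // dvdz_mull.
rewrite prime_dvdzM // => /orP[] H; [left|right]; apply: (eisint_dvd_aux pp) => //.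
- by rewrite -N /eisnorm; ring.
- by have -> : b * (c - d) - a * (- d) = a * d + b * c - b * d by ring.
Qed.

Lemma intr_Fp_eq0 (p : nat) (a : int) : prime p -> ((a%:~R : 'F_p) == 0) = (p%:Z %| a)%Z.
Proof.
by move=> pp; rewrite (dvdz_pcharf (pchar_Fp pp)).
Qed.

(** Cubing is injective on [F_p] when [p = 2 mod 3], so [a^3 + b^3 = 0] forces
    [a = - b], and then the norm is [3 a^2]. *)
Lemma eisnorm_inert (p : nat) (a b : int) : prime p -> (p %% 3 = 2)%N ->
  (p%:Z %| eisnorm a b)%Z -> (p%:Z %| a)%Z /\ (p%:Z %| b)%Z.
Proof.
move=> pp p2; rewrite -!intr_Fp_eq0 // => /eqP.
have -> : (eisnorm a b)%:~R = a%:~R ^+ 2 - a%:~R * b%:~R + b%:~R ^+ 2 :> 'F_p.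
  by rewrite /eisnorm !(intrD, mulrNz, intrM).
move: (a%:~R : 'F_p) (b%:~R : 'F_p) => A B E.
have pk : p = (3 * (p %/ 3) + 2)%N by rewrite {1}(divn_eq p 3) p2 mulnC.
have Ef (x : 'F_p) : x ^+ (3 * (p %/ 3) + 2) = x.
  by rewrite -pk; have := expf_card x; rewrite card_Fp.
have E3 : (- A) ^+ 3 = B ^+ 3.
  by rewrite -[LHS]addr0 -[X in _ + X](mulr0 (A + B)) -E; ring.
have EA : (- A) ^+ (3 * (p %/ 3)) * A ^+ 2 = - A.
  by rewrite -[RHS]Ef exprD [(- A) ^+ 2]sqrrN.
have EB : B ^+ (3 * (p %/ 3)) * B ^+ 2 = B by rewrite -exprD Ef.
move: EA; rewrite exprM E3 -exprM => EA.
have : A * B * (A + B) = 0.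
  move/(congr1 (fun x => x * B ^+ 2)): EA; rewrite mulrAC EB => /eqP; rewrite -subr_eq0 =>
    /eqP H.
  by rewrite -[RHS]H; ring.
move/eqP; rewrite !mulf_eq0 -orbA => /or3P[] /eqP H.
- by move: E; rewrite H !expr0n mul0r subr0 add0r => /eqP; rewrite sqrf_eq0 => ->.
- by move: E; rewrite H !expr0n mulr0 subr0 addr0 => /eqP; rewrite sqrf_eq0 => ->.
have EBA : B = - A by apply/eqP; rewrite -addr_eq0 addrC H.
have : 3%:R * A ^+ 2 = 0 by rewrite -E EBA; ring.
move/eqP; rewrite mulf_eq0 sqrf_eq0 EBA oppr_eq0 => /orP[|/eqP ->]; last by rewrite eqxx.
rewrite -[3%:R]/(3%:~R) intr_Fp_eq0 // dvdzE /= dvdn_prime2 // => /eqP p3.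
by rewrite p3 in p2.
Qed.

Definition primitive_pair (a b : int) : Prop :=
  forall p : nat, prime p -> (p%:Z %| a)%Z -> (p%:Z %| b)%Z -> False.

Lemma primitive_eisint_factor a b c d a' b' :
  eisint a b = eisint c d * eisint a' b' -> primitive_pair a b -> primitive_pair a' b'.
Proof.
rewrite eisintM => /eisint_inj[-> ->] prim p pp pa pb; apply: (prim p) => //.
  by rewrite rpredB // dvdz_mull.
by rewrite rpredB ?rpredD // dvdz_mull.
Qed.

Lemma eisint_factor_dvd3 a b c d a' b' :
  eisint a b = eisint c d * eisint a' b' -> (3 %| c + 1)%Z -> (3 %| d)%Z ->
  (3 %| b)%Z -> (3 %| b')%Z.
Proof.
rewrite eisintM => /eisint_inj[_ Eb] /dvdzP[k Ek] /dvdzP[l El] /dvdzP[n En].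
apply/dvdzP; exists (k * b' + l * a' - l * b' - n).
have Ec : c = k * 3 - 1 by rewrite -Ek addrK.
by move: En; rewrite Eb El Ec; lia.
Qed.

Lemma eisintX c d v : exists c' d', eisint c d ^+ v = eisint c' d'.
Proof.
elim: v => [|v [c' [d' IH]]]; first by exists 1, 0; rewrite /eisint mul0r addr0.
by rewrite exprS IH eisintM; do 2!eexists.
Qed.

(** A prime [pi] of norm [p] and its conjugate cannot both divide [a + b omega],
    since their product [p] does not; so the power of [p] in the norm is
    entirely due to [pi]. *)
Lemma eisint_prime_power_factor (p v : nat) (a b c d : int) : prime p -> eisnorm c d = p ->
  (3 %| c + 1)%Z -> (3 %| d)%Z -> primitive_pair a b ->
  (exists a' b', eisint a b = eisint c d * eisint a' b') ->
  ((p ^ v.+1)%N%:Z %| eisnorm a b)%Z -> (3 %| b)%Z ->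
  exists a' b', [/\ eisint a b = eisint c d ^+ v.+1 * eisint a' b', primitive_pair a' b',
    (3 %| b')%Z & eisnorm a b = (p ^ v.+1)%N%:Z * eisnorm a' b'].
Proof.
move=> pp N c3 d3 prim Jdvd; elim: v => [|v IH] pv b3.
  case: Jdvd => a' [b' E]; exists a', b'; rewrite expr1 expn1; split => //.
  - exact: primitive_eisint_factor E prim.
  - exact: eisint_factor_dvd3 E c3 d3 b3.
  - by rewrite -N (eisnormM E).
have p0 : p%:Z != 0 by case: p pp {N Jdvd IH pv}.
have [|//|a' [b' [E prim' b'3 EN]]] := IH.
  by apply: dvdz_trans pv; rewrite expnS PoszM dvdz_mull.
have pN : (p%:Z %| eisnorm a' b')%Z.
  by move: pv; rewrite EN (expnSr p v.+1) PoszM dvdz_mul2l // PoszX expf_eq0 (negbTE p0) andbF.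
have [[a1 [b1 E1]]|[a1 [b1 E1]]] := eisint_dvd_or pp N pN.
  exists a1, b1; split.
  - by rewrite exprSr -mulrA -E1.
  - exact: primitive_eisint_factor E1 prim'.
  - exact: eisint_factor_dvd3 E1 c3 d3 b'3.
  - by rewrite EN (expnSr p v.+1) PoszM -mulrA -N -(eisnormM E1).
exfalso; have [u1 [u2 Eu]] := eisintX c d v.
have E2 : eisint a b = (eisint c d * (eisint c d)^*) * (eisint u1 u2 * eisint a1 b1).
  by rewrite E E1 exprS Eu eisint_conj; ring.
move: E2; rewrite eisintK N.
have pE x y : p%:Z%:~R * eisint x y = eisint (p%:Z * x) (p%:Z * y).
  by rewrite /eisint !intrM; ring.
rewrite eisintM pE.
by move=> /eisint_inj[Ea Eb]; apply: (prim p) => //; rewrite ?Ea ?Eb dvdz_mulr.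
Qed.

Lemma eisnorm_ge0 a b : 0 <= eisnorm a b.
Proof. by rewrite /eisnorm; nia. Qed.

(** Strong induction on the norm, splitting off the full power [pi^v] of one
    prime at a time.  Its contribution to [alpha^2 conj(alpha)] is
    [(p pi)^v]: the cube of a power of a Gauss sum, and already the cube of an
    Eisenstein integer when 3 divides [v], which is why such primes need not
    divide [m].  The condition that 3 divides the [omega]-coordinate is
    inherited by the cofactor because the Jacobi sums are -1 modulo 3; in the
    end it excludes all units except 1 and -1, which are cubes. *)
Lemma cube_root_in_cyclotomic (m : nat) (z : algC) : (0 < m)%N -> m.-primitive_root z ->
  forall (n : nat) (a b : int), eisnorm a b = n -> primitive_pair a b -> (3 %| b)%Z ->
  (forall p : nat, prime p -> (p %| n)%N -> ~~ (3 %| logn p n)%N -> (p %| m)%N) ->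
  exists2 beta, Qadj_omega z beta & beta ^+ 3 = eisint a b ^+ 2 * (eisint a b)^*.
Proof.
move=> m0 zm; elim/ltn_ind => n IH a b Nn prim b3 Hm.
have /dvdzP[b' Eb] := b3.
have a3 : ~~ (3%:Z %| a)%Z by apply/negP => a3; exact: (prim 3%N).
have n0 : (0 < n)%N.
  by rewrite lt0n; apply: contra a3 => /eqP n0; apply/dvdzP; exists 0; move: Nn; rewrite
    /eisnorm n0; nia.
have [n1|n1] := eqVneq n 1%N.
  have [Ea b0] : a ^+ 2 = 1 /\ b = 0.
    move: Nn; rewrite /eisnorm n1 Eb => H.
    have b'0 : b' = 0 by nia.
    by rewrite b'0; split; nia.
  exists (eisint a b); first exact: Qadj_omega_eisint.
  by rewrite eisint_conj b0 oppr0 subr0 exprSr.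
set p := pdiv n; have pp : prime p by rewrite pdiv_prime //; lia.
have pn : (p %| n)%N := pdiv_dvd n.
have pN : (p%:Z %| eisnorm a b)%Z by rewrite Nn.
have p3 : p <> 3%N.
  move=> p3; case/negP: a3; apply: (@prime_dvdzX _ _ 2) => //.
  have -> : a ^+ 2 = eisnorm a b + b * (a - b) by rewrite /eisnorm; ring.
  by rewrite -p3 rpredD // dvdz_mulr // p3.
have p1 : (p %% 3 = 1)%N.
  have : (p %% 3 < 3)%N by rewrite ltn_mod.
  case Ep: (p %% 3)%N => [|[|[|//]]] // _.
    have : (3 %| p)%N by rewrite /dvdn Ep.
    by rewrite dvdn_prime2 // => /eqP; move: p3 => /[swap] <-.
  by have [pa pb] := eisnorm_inert pp Ep pN; case: (prim p).
set v := logn p n; have v0 : (0 < v)%N by rewrite logn_gt0 mem_primes pp n0.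
(* a prime factor of norm p and a cube root in the field for its power *)
have [c [d [[g Kg Eg] N c3 d3 Jdvd]]] : exists c d, [/\
    exists2 g, Qadj_omega z g & g ^+ 3 = (eisint c d ^+ 2 * (eisint c d)^*) ^+ v,
    eisnorm c d = p, (3 %| c + 1)%Z, (3 %| d)%Z &
    exists a' b', eisint a b = eisint c d * eisint a' b'].
  have cube_part c d : eisnorm c d = p ->
      (~~ (3 %| v)%N -> exists2 g, Qadj_omega z g & g ^+ 3 = p%:R * eisint c d) ->
      exists2 g, Qadj_omega z g & g ^+ 3 = (eisint c d ^+ 2 * (eisint c d)^*) ^+ v.
    move=> N Hg; have -> : eisint c d ^+ 2 * (eisint c d)^* = p%:R * eisint c d.
      by rewrite expr2 -mulrA eisintK N mulrC.
    have [/dvdnP[k ->]|/Hg[g Kg Eg]] := boolP (3 %| v)%N.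
      exists ((p%:R * eisint c d) ^+ k); last by rewrite exprM.
      apply: Qadj_omegaX; apply: Qadj_omegaM; [exact: (Qadj_omega_int z p)|exact:
        Qadj_omega_eisint].
    by exists (g ^+ v); [exact: Qadj_omegaX|rewrite exprAC Eg].
  have [c [d [N c3 d3 Hg]]] : exists c d, [/\ eisnorm c d = p, (3 %| c + 1)%Z, (3 %| d)%Z &
      ~~ (3 %| v)%N -> exists2 g, Qadj_omega z g & g ^+ 3 = p%:R * eisint c d].
    have [v3|v3] := boolP (3 %| v)%N.
      have [zeta zp] := C_prim_root_exists (prime_gt0 pp).
      by have [chi [c [d [_ _ N c3 d3]]]] := cubic_gauss_sum pp p1 zp; exists c, d; split.
    have [g [c [d [Kg Eg N c3 d3]]]] := cubic_gauss_sum_cyclotomic zm pp p1 (Hm p pp pn v3).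
    by exists c, d; split => // _; exists g.
  have [[a1 [b1 E1]]|[a1 [b1 E1]]] := eisint_dvd_or pp N pN.
    by exists c, d; split => //; [exact: cube_part|exists a1, b1].
  have N' : eisnorm (c - d) (- d) = p by rewrite -N /eisnorm; ring.
  exists (c - d), (- d); split => //.
  - apply: cube_part => // /Hg[g Kg Eg]; exists g^*; first exact: (Qadj_omega_conj m0 zm Kg).
    by rewrite -rmorphXn Eg rmorphM /= rmorph_nat eisint_conj.
  - by rewrite addrAC rpredB.
  - by rewrite rpredN.
  - by exists a1, b1.
have pv : ((p ^ v.-1.+1)%N%:Z %| eisnorm a b)%Z.
  by rewrite prednK // Nn dvdzE /= pfactor_dvdnn.
have {b' Eb} [a' [b' []]] := eisint_prime_power_factor pp N c3 d3 prim Jdvd pv b3.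
rewrite prednK // => E prim' b'3 EN.
have Enn : n = (p ^ v * `|eisnorm a' b'|)%N.
  by have := EN; rewrite Nn => /(congr1 absz); rewrite abszM.
set n' := `|eisnorm a' b'|%N in Enn.
have pv0 : (0 < p ^ v)%N by rewrite expn_gt0 prime_gt0.
have n'0 : (0 < n')%N by move: n0; rewrite Enn muln_gt0 => /andP[].
have [|||beta Kb Eb3] := IH n' _ a' b' _ prim' b'3.
- have : (1 < p ^ v)%N by rewrite -(exp1n v) ltn_exp2r // prime_gt1.
  by rewrite Enn; nia.
- by rewrite /n' gez0_abs // eisnorm_ge0.
- move=> q pq qn' v3; apply: Hm => //; first by rewrite Enn dvdn_mull.
  have qp : q != p.
    apply/eqP => qp; have : (p ^ v.+1 %| n)%N.
      by rewrite Enn expnSr dvdn_pmul2l // -qp.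
    by rewrite pfactor_dvdn // ltnn.
  by rewrite Enn lognM // lognX logn_prime // (negbTE qp) muln0.
exists (g * beta); first exact: Qadj_omegaM.
have EJ : (eisint c d ^+ v)^* = (eisint c d)^* ^+ v by rewrite rmorphXn.
rewrite exprMn Eg Eb3 E rmorphM /= EJ exprMn exprAC.
by move: (_ ^+ v) (_ ^+ v) => x y; ring.
Qed.

(** * Roots of simplest cubics in cyclotomic fields *)

Lemma horner_simplest (R : comNzRingType) (t : int) (x : R) :
  (map_poly (intr : int -> R) (simplest_poly t)).[x] =
  x ^+ 3 - t%:~R * x ^+ 2 - (t%:~R + 3%:R) * x - 1.
Proof.
rewrite /simplest_poly !rmorphB /= !map_polyZ !map_polyX rmorph1 /= map_polyXn.
rewrite !(hornerD, hornerN, hornerZ, hornerXn, hornerX) hornerC /= rmorphD /= map_polyXn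
  hornerXn.
by [].
Qed.

Lemma Delta_eisnorm t : Delta t = eisnorm t (- 3).
Proof. by rewrite /Delta /eisnorm; ring. Qed.

Lemma Delta_gt0 t : 0 < Delta t.
Proof. by rewrite /Delta; nia. Qed.

(** Cardano's formula: [rho^3 = Delta alpha] and [rho conj(rho) = Delta], the
    latter because both sides are nonnegative reals with the same cube. *)
Lemma simplest_root_of_resolvent t (rho : algC) :
  rho ^+ 3 = eisint t (- 3) ^+ 2 * (eisint t (- 3))^* ->
  (map_poly intr (simplest_poly t)).[(t%:~R + rho + rho^*) / 3%:R] = 0.
Proof.
set al := eisint t (- 3) => E3; set D : algC := (Delta t)%:~R.
have aD : al * al^* = D by rewrite eisintK -Delta_eisnorm.
have Dre : D^* = D by rewrite rmorph_int.
have rD : rho * rho^* = D.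
  apply: (@pexpIrn _ 3) => //.
  - by rewrite nnegrE -normCK exprn_ge0.
  - by rewrite nnegrE ler0z ltW // Delta_gt0.
  rewrite exprMn -rmorphXn /= E3 rmorphM rmorphXn /= conjCK -aD; ring.
have rD3 : rho ^+ 3 = D * al by rewrite E3 -aD; ring.
have rcD3 : rho^* ^+ 3 = D * al^* by rewrite -rmorphXn rD3 rmorphM /= Dre.
have tr : al + al^* = 2%:R * t%:~R + 3%:R.
  by rewrite /al eisint_conj /eisint !(intrD, mulrNz); ring.
rewrite horner_simplest; set r' := rho^* in rD rcD3 *.
apply: (mulfI (_ : (27%:R : algC) != 0)); first by rewrite pnatr_eq0.
rewrite mulr0.
have three0 : (3%:R : algC) != 0 by rewrite pnatr_eq0.
transitivity ((rho ^+ 3 + r' ^+ 3) + 3%:R * (rho * r' - D) * (rho + r') - (2%:R * t%:~R +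
  3%:R) * D).
  by rewrite /D /Delta !(intrD, intrM); field.
by rewrite rD3 rcD3 rD subrr mulr0 mul0r addr0 -mulrDr tr; ring.
Qed.

Lemma third_simplest_root (F : fieldType) (t x y : F) :
  let f := fun x : F => x ^+ 3 - t * x ^+ 2 - (t + 3%:R) * x - 1 in
  x != y -> f x = 0 -> f y = 0 -> f (t - x - y) = 0.
Proof.
move=> f xy fx fy; have xy0 : x - y != 0 by rewrite subr_eq0.
have E : x ^+ 2 + x * y + y ^+ 2 - t * (x + y) - (t + 3%:R) = 0.
  apply: (mulfI xy0); rewrite mulr0 -[RHS](subrr (0 : F)) -{1}fx -fy /f; ring.
rewrite -[RHS]fx /f; apply/eqP; rewrite -subr_eq0; apply/eqP.
rewrite -[RHS](mulr0 (t - x - y - x)) -E; ring.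
Qed.

(** Write [x = a + b omega].  As 3 does not divide [m], some automorphism fixes
    [z] and maps [omega] to [omega^2].  It yields a second root
    [a + b omega^2], and the third root [t - 2 a + b] lies in [Q(z)]. *)
Lemma Qadj_omega_descent (m : nat) (z x : algC) t : (0 < m)%N -> m.-primitive_root z ->
  ~~ (3 %| m)%N -> Qadj_omega z x ->
  (map_poly intr (simplest_poly t)).[x] = 0 ->
  exists2 y, Qadj z y & (map_poly intr (simplest_poly t)).[y] = 0.
Proof.
move=> m0 zm m3 [a [b [Qa Qb Ex]]] fx.
have [b0|b0] := eqVneq b 0; first by exists a => //; rewrite -fx Ex b0 mul0r addr0.
have cop : coprime m 3 by rewrite coprime_sym prime_coprime.
pose k := chinese m 3 1 2.
have km : k = 1 %[mod m] := chinese_modl cop 1 2.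
have k3 : k = 2 %[mod 3] := chinese_modr cop 1 2.
have ck : coprime k (m * 3).
  by rewrite coprimeMr -(coprime_modl k m) -(coprime_modl k 3) km k3 coprime_modl coprime1n.
have [u Hu] := Qn_aut_exists ck.
have uz : u z = z.
  rewrite Hu; last by rewrite exprM (prim_expr_order zm) expr1n.
  by rewrite -[RHS]expr1; apply/eqP; rewrite (eq_prim_root_expr zm) km.
have uw : u w = w ^+ 2.
  rewrite Hu; last by rewrite mulnC exprM omega3 expr1n.
  by apply/eqP; rewrite (eq_prim_root_expr omega_prim) k3.
have uQ y : Qadj z y -> u y = y.
  case=> q ->; rewrite -horner_map /= uz -map_poly_comp; congr (_.[z]).
  by apply: eq_map_poly => r /=; rewrite fmorph_rat.
have ux : u x = a + b * w ^+ 2 by rewrite Ex rmorphD rmorphM /= uw !uQ.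
exists (t%:~R - x - u x).
  have -> : t%:~R - x - u x = t%:~R - a - a + b by rewrite ux Ex omega2; ring.
  apply: QadjD => //; apply: QadjD; last exact: QadjN.
  by apply: QadjD; [exact: Qadj_int|exact: QadjN].
rewrite horner_simplest; apply: third_simplest_root.
- rewrite ux Ex -subr_eq0; have -> : a + b * w - (a + b * w ^+ 2) = b * w * (1 - w) by ring.
  have w0 : w != 0 by apply/eqP => w0; have /esym/eqP := omega3; rewrite w0 expr0n oner_eq0.
  have w1 : 1 - w != 0 by rewrite subr_eq0 eq_sym omega_neq1.
  by rewrite !mulf_neq0.
- by rewrite -horner_simplest.
rewrite -[RHS](rmorph0 u) -fx horner_simplest !(rmorphB, rmorphD, rmorphM, rmorph_int,
  rmorph_nat, rmorph1).
by [].
Qed.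

(** [x^2 conj(x)] generates the Kummer extension attached to [x].  The condition
    is multiplicative in [x], so it can be checked on the factors of
    [alpha]. *)
Definition resolvent_cube (S : algC -> Prop) (x : algC) :=
  exists2 r, S r & r ^+ 3 = x ^+ 2 * x^*.

Lemma resolvent_cubeM (S : algC -> Prop) x y : (forall a b, S a -> S b -> S (a * b)) ->
  resolvent_cube S x -> resolvent_cube S y -> resolvent_cube S (x * y).
Proof.
move=> SM [r Sr Er] [s Ss Es]; exists (r * s); first exact: SM.
by rewrite exprMn Er Es rmorphM /=; ring.
Qed.

Lemma resolvent_cube_int (S : algC -> Prop) (n : int) :
  S n%:~R -> resolvent_cube S n%:~R.
Proof. by move=> Sn; exists n%:~R => //; rewrite rmorph_int exprSr. Qed.

Lemma logn_coprime_factor (p n N c : nat) : prime p -> p <> 3%N -> N = (3 ^ c * n)%N ->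
  (0 < n)%N -> logn p N = logn p n.
Proof.
move=> pp p3 -> n0; rewrite lognM ?expn_gt0 // lognX logn_prime //.
by case: eqP => [/esym //|]; rewrite muln0.
Qed.

Section Resolvent.
Variables (t : int) (m : nat) (z : algC).
Hypotheses (m0 : (0 < m)%N) (zm : m.-primitive_root z).
Hypothesis Hm : forall p, prime p -> p <> 3%N -> (p %| `|Delta t|)%N ->
  ~~ (3 %| logn p `|Delta t|)%N -> (p %| m)%N.

Lemma resolvent_cube_primary (a b : int) (c : nat) :
  primitive_pair a b -> (3 %| b)%Z -> ~~ (3 %| a)%Z -> Delta t = 3 ^+ c * eisnorm a b ->
  resolvent_cube (Qadj_omega z) (eisint a b).
Proof.
move=> prim b3 a3 ED.
have EDn : `|Delta t|%N = (3 ^ c * `|eisnorm a b|)%N by rewrite ED abszM abszX.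
have N0 : (0 < `|eisnorm a b|)%N.
  by have := Delta_gt0 t; rewrite ED lt0n absz_eq0; apply: contraTneq => ->; rewrite mulr0.
have [|p pp pn v3|beta Kb Eb] := cube_root_in_cyclotomic m0 zm (n := `|eisnorm a b|%N) (a :=
  a) (b := b) _ prim b3.
- by rewrite gez0_abs // eisnorm_ge0.
- have p3 : p <> 3%N.
    move=> p3; case/negP: a3; apply: (@prime_dvdzX 3 _ 2) => //.
    have -> : a ^+ 2 = eisnorm a b + b * (a - b) by rewrite /eisnorm; ring.
    by rewrite rpredD // ?dvdz_mulr // dvdzE /= -p3.
  apply: Hm => //; first by rewrite EDn dvdn_mull.
  by rewrite (logn_coprime_factor pp p3 EDn).
by exists beta.
Qed.

Lemma resolvent_cube_3ndvd : ~~ (3 %| t)%Z ->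
  resolvent_cube (Qadj_omega z) (eisint t (- 3)).
Proof.
move=> t3; apply: (@resolvent_cube_primary _ _ 0) => //.
- move=> p pp pt p3; case/negP: t3; have : (p %| 3)%N by move: p3; rewrite dvdzE.
  rewrite dvdn_prime2 // => /eqP E; by rewrite E in pt *.
- by rewrite expr0 mul1r Delta_eisnorm.
Qed.

Lemma primitive_pair_unit (a b u v : int) : u * a + v * b = 1 -> primitive_pair a b.
Proof.
move=> E p pp pa pb; have : (p%:Z %| u * a + v * b)%Z by rewrite rpredD // dvdz_mull.
by rewrite E dvdzE /= dvdn1 => /eqP p1; rewrite p1 in pp.
Qed.

Lemma eisint_3dvd s : eisint (3 * s) (- 3) = 3%:~R * eisint s (- 1).
Proof. by rewrite /eisint !(intrM, mulrNz); ring. Qed.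

Lemma eisint_lambda k :
  eisint (1 + 3 * k) (- 1) = (1 - w) * eisint (1 + 2 * k) k.
Proof.
rewrite /eisint !(intrD, intrM, mulrNz).
transitivity (1 + 3%:R * k%:~R - w + (- k%:~R) * (w ^+ 2 + w + 1)); first by rewrite omega2;
  ring.
by ring.
Qed.

(** Here [alpha] is [3 (1 - omega) omega] times an element whose
    [omega]-coordinate is divisible by 3.  The cube roots of unity needed for
    [1 - omega] and for [omega] cancel:
    [((1 - omega) omega)^2 conj((1 - omega) omega) = (omega - 1)^3]. *)
Lemma resolvent_cube_12mod27 : (t = 12 %[mod 27])%Z ->
  resolvent_cube (Qadj_omega z) (eisint t (- 3)).
Proof.
move=> t12; have [k Ek] : exists k, t = 12 + 27 * k.
  by exists (t %/ 27)%Z; have := divz_eq t 27; rewrite t12; lia.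
have -> : t = 3 * (1 + 3 * (1 + 3 * k)) by rewrite Ek; ring.
rewrite eisint_3dvd; apply: resolvent_cubeM; first by move=> *; exact: Qadj_omegaM.
  by apply: resolvent_cube_int; exact: Qadj_omega_int.
rewrite eisint_lambda; move Ek1 : (1 + 3 * k) => k1.
have -> : (1 - w) * eisint (1 + 2 * k1) k1 = ((1 - w) * w) * eisint (- 1 - k1) (- 1 - 2 * k1).
  rewrite /eisint !(intrD, intrM, mulrNz).
  transitivity ((1 - w) * ((- 1 - k1%:~R) * w + (- 1 - 2%:R * k1%:~R) * w ^+ 2)).
    by rewrite omega2; ring.
  by ring.
apply: resolvent_cubeM; first by move=> *; exact: Qadj_omegaM.
  exists (w - 1).
    by apply: Qadj_omegaD; [exact: Qadj_omega_omega|exact: (Qadj_omega_int z (-1))].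
  rewrite rmorphM rmorphB rmorph1 /= omega_conj.
  have -> : ((1 - w) * w) ^+ 2 * ((1 - (- 1 - w)) * (- 1 - w)) = w ^+ 3 * (w - 1) ^+ 3
     + (w - 1) ^+ 2 * w ^+ 2 * (-2 - 2 * w - 2 * w^+2) by ring.
  by rewrite {2}omega2 omega3; ring.
apply: (@resolvent_cube_primary _ _ 3).
- by apply: (@primitive_pair_unit _ _ (-2) 1); ring.
- by apply/dvdzP; exists (- 1 - 2 * k); rewrite -Ek1; ring.
- by apply/dvdzP => -[q]; rewrite -Ek1; lia.
- by rewrite Ek /Delta /eisnorm -Ek1; ring.
Qed.

Lemma Qadj_omega_Qadj x : (3 %| m)%N -> Qadj_omega z x -> Qadj z x.
Proof.
move=> m3 [a [b [Qa Qb ->]]]; apply: QadjD => //; apply: QadjM => //.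
exact: (Qadj_unity zm m3 omega3).
Qed.

(** With a ninth root of unity, hence a cube root [eta] of [omega], the units
    and [1 - omega] satisfy the condition; each residue class of [t] has its own
    factorisation of [alpha] into these, 3, and an element whose
    [omega]-coordinate is divisible by 3. *)
Lemma resolvent_cube_9dvd : (9 %| m)%N -> resolvent_cube (Qadj z) (eisint t (- 3)).
Proof.
move=> m9; have m3 : (3 %| m)%N by apply: dvdn_trans m9.
have weak x : resolvent_cube (Qadj_omega z) x -> resolvent_cube (Qadj z) x.
  by case=> r Qr Er; exists r => //; exact: Qadj_omega_Qadj.
have [t3|] := boolP (3 %| t)%Z; last by move/resolvent_cube_3ndvd/weak.
have [zeta z9] := C_prim_root_exists (isT : (0 < 9)%N).
have Q9 : Qadj z zeta := Qadj_unity zm m9 (prim_expr_order z9).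
have wz : w ^+ 1 = (zeta ^+ 3) ^+ 1 \/ w ^+ 1 = (zeta ^+ 3) ^+ 2.
  have z3 : 3.-primitive_root (zeta ^+ 3) by exact: (dvdn_prim_root z9 (isT : (3 %| 9)%N)).
  have [i Ei] := prim_rootP z3 omega3; case: i Ei => [[|[|[|//]]] //= _] Ei.
  - by have := omega_neq1; rewrite Ei expr0 eqxx.
  - by left; rewrite expr1.
  - by right; rewrite expr1.
have [eta Qeta Eeta] : exists2 eta, Qadj z eta & eta ^+ 3 = w.
  case: wz; rewrite !expr1 => ->; first by exists zeta.
  by exists (zeta ^+ 2); [exact: QadjX|rewrite exprAC].
have QM a b : Qadj z a -> Qadj z b -> Qadj z (a * b) by move=> *; exact: QadjM.
have cw : resolvent_cube (Qadj z) w.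
  exists eta => //; rewrite Eeta omega_conj.
  have -> : w ^+ 2 * (-1 - w) = w - w * (w ^+ 2 + w + 1) by ring.
  by rewrite omega2; ring.
have cN1 : resolvent_cube (Qadj z) (- 1).
  by apply: (@resolvent_cube_int _ (-1)); exact: (Qadj_int z (-1)).
have clam : resolvent_cube (Qadj z) (1 - w).
  exists (eta ^+ 2 * (w - 1)).
    apply: QadjM; first exact: QadjX.
    apply: QadjD; last exact: (Qadj_int z (-1)).
    exact: (Qadj_unity zm m3 omega3).
  rewrite exprMn exprAC Eeta rmorphB rmorph1 /= omega_conj.
  have -> : w ^+ 2 * (w - 1) ^+ 3 = w ^+ 3 * (w ^+ 2 + 3 * (1 - w)) - w ^+ 2 by ring.
  have -> : (1 - w) ^+ 2 * (1 - (- 1 - w)) = w ^+ 3 - 3 * w + 2 by ring.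
  by rewrite omega3 omega2; ring.
case/dvdzP: t3 => s Es; have {}Es : t = 3 * s by rewrite Es mulrC.
rewrite Es eisint_3dvd; apply: resolvent_cubeM => //.
  by apply: resolvent_cube_int; exact: Qadj_int.
have [k [Ek|[Ek|Ek]]] : exists k, s = 3 * k \/ s = 3 * k + 2 \/ s = 1 + 3 * k.
  exists (s %/ 3)%Z; have := divz_eq s 3; have := modz_ge0 s (isT : 3%Z != 0).
  by have := ltz_pmod s (isT : 0 < 3%Z); lia.
- have -> : eisint s (- 1) = (- 1 * w) * eisint (1 + s) s.
    rewrite /eisint !(intrD, mulrNz).
    transitivity (s%:~R - w - s%:~R * (w ^+ 2 + w + 1)); first by rewrite omega2; ring.
    by ring.
  apply: resolvent_cubeM => //; first exact: resolvent_cubeM.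
  apply: weak; apply: (@resolvent_cube_primary _ _ 2).
  + by apply: (@primitive_pair_unit _ _ 1 (-1)); ring.
  + by apply/dvdzP; exists k; rewrite Ek mulrC.
  + by apply/dvdzP => -[q]; lia.
  + by rewrite Es /Delta /eisnorm; ring.
- have -> : eisint s (- 1) = (w * w) * eisint 1 (1 + s).
    rewrite /eisint !(intrD, mulrNz).
    transitivity (s%:~R - w + (w * w + w + 1) + (1 + s%:~R) * (w ^+ 3 - 1)).
      by rewrite omega3 -expr2 omega2; ring.
    by ring.
  apply: resolvent_cubeM => //; first exact: resolvent_cubeM.
  apply: weak; apply: (@resolvent_cube_primary _ _ 2).
  + by apply: (@primitive_pair_unit _ _ 1 0); ring.
  + by apply/dvdzP; exists (k + 1); rewrite Ek; ring.
  + by apply/dvdzP => -[q]; lia.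
  + by rewrite Es /Delta /eisnorm; ring.
rewrite Ek eisint_lambda; apply: resolvent_cubeM => //.
have [l [El|[El|El]]] : exists l, k = 3 * l \/ k = 3 * l + 2 \/ k = 1 + 3 * l.
  exists (k %/ 3)%Z; have := divz_eq k 3; have := modz_ge0 k (isT : 3%Z != 0).
  by have := ltz_pmod k (isT : 0 < 3%Z); lia.
- apply: weak; apply: (@resolvent_cube_primary _ _ 3).
  + by apply: (@primitive_pair_unit _ _ 1 (-2)); ring.
  + by apply/dvdzP; exists l; rewrite El mulrC.
  + by apply/dvdzP => -[q]; lia.
  + by rewrite Es Ek /Delta /eisnorm; ring.
- have -> : eisint (1 + 2 * k) k = (w * w) * eisint (- k) (1 + k).
    rewrite /eisint !(intrD, intrM, mulrNz).
    transitivity (- k%:~R * w ^+ 2 + (1 + k%:~R) * w ^+ 3); first by rewrite omega3 omega2;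
      ring.
    by ring.
  apply: resolvent_cubeM => //; first exact: resolvent_cubeM.
  apply: weak; apply: (@resolvent_cube_primary _ _ 3).
  + by apply: (@primitive_pair_unit _ _ 1 1); ring.
  + by apply/dvdzP; exists (l + 1); rewrite El; ring.
  + by apply/dvdzP => -[q]; lia.
  + by rewrite Es Ek /Delta /eisnorm; ring.
have -> : eisint (1 + 2 * k) k = w * eisint (- 1 - k) (- 1 - 2 * k).
  rewrite /eisint !(intrD, intrM, mulrNz).
  transitivity ((- 1 - k%:~R) * w + (- 1 - 2%:R * k%:~R) * w ^+ 2); first by rewrite omega2;
    ring.
  by ring.
apply: resolvent_cubeM => //.
apply: weak; apply: (@resolvent_cube_primary _ _ 3).
+ by apply: (@primitive_pair_unit _ _ (-2) 1); ring.
+ by apply/dvdzP; exists (- 1 - 2 * l); rewrite El; ring.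
+ by apply/dvdzP => -[q]; lia.
+ by rewrite Es Ek /Delta /eisnorm; ring.
Qed.

End Resolvent.
End EisensteinIntegers.

(** * The conductor of a simplest cubic field *)

(** A field generated by [x] embeds as soon as [x] can be sent to an element [y]
    satisfying the same polynomial equations. *)
Section Embedding.
Variables (K L : fieldExtType rat) (x : K) (y : L).
Hypothesis gen : forall u : K, exists p : {poly rat}, (map_poly (in_alg K) p).[x] == u.
Hypothesis ker : forall p : {poly rat},
  (map_poly (in_alg K) p).[x] = 0 -> (map_poly (in_alg L) p).[y] = 0.

Definition embed_gen (u : K) : L := (map_poly (in_alg L) (xchoose (gen u))).[y].

Lemma embed_genE (p : {poly rat}) :
  embed_gen (map_poly (in_alg K) p).[x] = (map_poly (in_alg L) p).[y].
Proof.
have := xchooseP (gen (map_poly (in_alg K) p).[x]) => /eqP E.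
rewrite /embed_gen; set q := xchoose _ in E *; apply/eqP; rewrite -subr_eq0.
by rewrite -hornerN -hornerD -rmorphB; apply/eqP/ker; rewrite rmorphB !hornerE E subrr.
Qed.

Lemma embed_gen_linear : linear embed_gen.
Proof.
move=> a u v; have [[p /eqP Ep] [q /eqP Eq]] := (gen u, gen v).
have -> : a *: u + v = (map_poly (in_alg K) (a *: p + q)).[x].
  by rewrite rmorphD /= map_polyZ !hornerE Ep Eq /= mulr_algl.
rewrite -Ep -Eq !embed_genE rmorphD /= map_polyZ !hornerE /= mulr_algl //.
Qed.

Lemma embed_gen_monoid : monoid_morphism embed_gen.
Proof.
split.
  have -> : (1 : K) = (map_poly (in_alg K) 1).[x] by rewrite rmorph1 hornerC.
  by rewrite embed_genE rmorph1 hornerC.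
move=> u v; have [[p /eqP Ep] [q /eqP Eq]] := (gen u, gen v).
by rewrite -Ep -Eq -hornerM -rmorphM !embed_genE rmorphM hornerM.
Qed.

HB.instance Definition _ := GRing.isLinear.Build rat K L _ embed_gen embed_gen_linear.
HB.instance Definition _ := GRing.isMonoidMorphism.Build K L embed_gen embed_gen_monoid.

Lemma embed_gen_exists : exists iota : 'AHom(K, L), forall p : {poly rat},
  iota (map_poly (in_alg K) p).[x] = (map_poly (in_alg L) p).[y].
Proof.
exists (linfun_ahom embed_gen) => p.
by rewrite /= lfunE /= embed_genE.
Qed.
End Embedding.

Lemma simplest_poly_monic_size t :
  simplest_poly t \is monic /\ size (simplest_poly t) = 4%N.
Proof.
have -> : simplest_poly t = 'X^3 - (t *: 'X^2 + (t + 3) *: 'X + 1).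
  by rewrite /simplest_poly !opprD !addrA.
have s2 : (size (t *: 'X^2 : {poly int})%R <= 3)%N.
  by rewrite (leq_trans (size_scale_leq _ _)) ?size_polyXn.
have s1 : (size ((t + 3) *: 'X : {poly int})%R <= 3)%N.
  by rewrite (leq_trans (size_scale_leq _ _)) ?size_polyX.
have s21 : (size (t *: 'X^2 + (t + 3) *: 'X : {poly int})%R <= 3)%N.
  by rewrite (leq_trans (size_polyD _ _)) // geq_max s1 s2.
have s3 : (size (- (t *: 'X^2 + (t + 3) *: 'X + 1) : {poly int})%R < size ('X^3 : {poly
  int})%R)%N.
  by rewrite size_polyN size_polyXn ltnS (leq_trans (size_polyD _ _)) // geq_max s21
    size_poly1.
by rewrite monicE lead_coefDl // lead_coefXn size_polyDl // size_polyXn.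
Qed.

Lemma in_cyclotomic_of_root (K : fieldExtType rat) (theta : K) (t : int) (m : nat) (z y :
  algC) :
  \dim {:K} = 3 -> <<1; theta>>%VS = {:K}%VS -> simplest_root t theta ->
  m.-primitive_root z -> Qadj z y -> (map_poly intr (simplest_poly t)).[y] = 0 ->
  in_cyclotomic K m.
Proof.
move=> dK full rt zm [q Ey] fy.
have [Q [QC [[|zQ [|//]] //= [EzQ] genQ]]] := num_field_exists [:: z].
pose yQ := (map_poly (in_alg Q) q).[zQ].
have EyQ : QC yQ = y.
  rewrite Ey /yQ -horner_map /= EzQ -map_poly_comp; congr (_.[z]).
  by apply: eq_map_poly => r /=; exact: (fmorph_eq_rat (QC \o in_alg Q)).
have gen (u : K) : exists p : {poly rat}, (map_poly (in_alg K) p).[theta] == u.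
  have : u \in <<1; theta>>%VS by rewrite full memvf.
  by case/Fadjoin_polyP=> p /polyOver1P[r ->] ->; exists r.
pose f : {poly rat} := map_poly intr (simplest_poly t).
have fK (R : fieldExtType rat) : map_poly (in_alg R) f = map_poly intr (simplest_poly t).
  by rewrite /f -map_poly_comp; apply: eq_map_poly => n /=; rewrite intr_alg.
have [mon0 sf0] := simplest_poly_monic_size t.
have sf : size f = 4%N by rewrite size_map_inj_poly //; exact: intr_inj.
have mon : f \is monic.
  rewrite monicE /lead_coef sf coef_map /=.
  by move: mon0; rewrite monicE /lead_coef sf0 => /eqP ->.
have minf : minPoly 1 theta = map_poly (in_alg K) f.
  apply/eqP; rewrite -eqp_monic ?monic_minPoly ?map_monic //.
  rewrite -dvdp_size_eqp.
    rewrite size_minPoly size_map_poly sf.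
    by have := dim_Fadjoin 1 theta; rewrite full dK dimv1 muln1 => <-.
  apply: minPoly_dvdp; first by apply/polyOver1P; exists f.
  by rewrite fK.
have ker (p : {poly rat}) : (map_poly (in_alg K) p).[theta] = 0 -> (map_poly (in_alg Q)
  p).[yQ] = 0.
  move=> p0; have : (map_poly (in_alg K) f %| map_poly (in_alg K) p).
    rewrite -minf; apply: minPoly_dvdp; first by apply/polyOver1P; exists p.
    by rewrite rootE p0.
  rewrite dvdp_map => /dvdpP[r ->]; rewrite rmorphM hornerM /= fK.
  apply/eqP; rewrite mulf_eq0; apply/orP; right.
  rewrite -(fmorph_eq0 QC) -horner_map /= EyQ -map_poly_comp; apply/eqP; rewrite -[RHS]fy.
  by congr (_.[y]); apply: eq_map_poly => n /=; rewrite rmorph_int.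
have [iota _] := embed_gen_exists gen ker.
exists Q, iota, zQ; split; first by rewrite -(fmorph_primitive_root QC) EzQ.
by rewrite adjoin_seq1 in genQ; rewrite genQ subvf.
Qed.

Definition ramified_at3 (t : int) : bool := (3 %| t)%Z && (t != 12 %[mod 27])%Z.

(** The ramified primes: 3 contributes 9, as its ramification is wild, and a
    prime [p <> 3] is ramified exactly when the cube-free part of [Delta t] is
    divisible by [p]. *)
Definition conductor_formula (t : int) : nat :=
  ((if ramified_at3 t then 9 else 1) *
   \prod_(p <- primes `|Delta t| | (p != 3) && ~~ (3 %| logn p `|Delta t|)) p)%N.

Lemma logn_prod_primes (s : seq nat) (P : pred nat) q : uniq s -> all prime s -> prime q ->
  logn q (\prod_(p <- s | P p) p) = ((q \in s) && P q : nat).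
Proof.
move=> + + pq; elim: s => [|p s IH] /=; first by rewrite big_nil logn1.
move=> /andP[ps us] /andP[pp als]; rewrite big_cons inE.
have sgt0 : (0 < \prod_(j <- s | P j) j)%N.
  rewrite big_seq_cond prodn_cond_gt0 // => j /andP[js _].
  by apply: prime_gt0; exact: (allP als).
have [Eqp|nqp] := eqVneq q p.
  rewrite /= -Eqp; case: ifP => Pq; last by rewrite IH // Pq andbF.
  rewrite lognM ?sgt0 ?(prime_gt0 pq) // IH // logn_prime // eqxx Eqp (negbTE ps) //.
case: ifP => Pp; last by rewrite IH.
by rewrite lognM ?sgt0 ?(prime_gt0 pp) // IH // logn_prime // (negbTE nqp).
Qed.

Lemma prod_primes_gt0 (s : seq nat) (P : pred nat) : all prime s ->
  (0 < \prod_(p <- s | P p) p)%N.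
Proof.
move=> als; rewrite big_seq_cond prodn_cond_gt0 // => j /andP[js _].
by apply: prime_gt0; exact: (allP als).
Qed.

Lemma all_prime_primes n : all prime (primes n).
Proof. by apply/allP => p; rewrite mem_primes => /and3P[]. Qed.

Lemma absDelta_gt0 t : (0 < `|Delta t|)%N.
Proof. by rewrite absz_gt0 gt_eqF // Delta_gt0. Qed.

Lemma conductor_formula_gt0 t : (0 < conductor_formula t)%N.
Proof.
rewrite /conductor_formula muln_gt0 prod_primes_gt0 ?all_prime_primes // andbT.
by case: ifP.
Qed.

Lemma logn_conductor_formula t q : prime q ->
  logn q (conductor_formula t) =
  if q == 3%N then (if ramified_at3 t then 2 else 0)
  else (~~ (3 %| logn q `|Delta t|)%N : nat).
Proof.
move=> pq; rewrite /conductor_formula lognM ?prod_primes_gt0 ?all_prime_primes //; last by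
  case: ifP.
rewrite logn_prod_primes ?primes_uniq ?all_prime_primes //.
have -> : logn q (if ramified_at3 t then 9 else 1) = if q == 3%N then (if ramified_at3 t then
  2 else 0)%N else 0%N.
  case: ifP => _; last by rewrite logn1; case: ifP.
  by rewrite (lognX q 3 2) logn_prime //; case: eqP.
case: eqP => [->|_]; first by rewrite andbF addn0.
rewrite andTb add0n mem_primes pq absDelta_gt0 /=.
have [//|nd] := boolP (q %| _)%N.
by rewrite lognE pq absDelta_gt0 (negbTE nd) dvdn0.
Qed.

Lemma simplest_root_cyclotomic (t : int) : exists z y, [/\ (conductor_formula
  t).-primitive_root z,
  Qadj z y & (map_poly (intr : int -> algC) (simplest_poly t)).[y] = 0].
Proof.
set m := conductor_formula t; have m0 : (0 < m)%N by exact: conductor_formula_gt0.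
have [z zm] := C_prim_root_exists m0; exists z.
have Hm p : prime p -> p <> 3%N -> (p %| `|Delta t|)%N -> ~~ (3 %| logn p `|Delta t|)%N -> (p
  %| m)%N.
  move=> pp /eqP p3 pD v3; have : (0 < logn p m)%N.
    by rewrite logn_conductor_formula // (negbTE p3) v3.
  by rewrite logn_gt0 mem_primes => /and3P[].
have [r3|r3] := boolP (ramified_at3 t).
  have m9 : (9 %| m)%N by rewrite /m /conductor_formula r3 dvdn_mulr.
  have [rho Qr Er] := resolvent_cube_9dvd m0 zm Hm m9.
  exists ((t%:~R + rho + rho^*) / 3%:R); split => //; last exact: simplest_root_of_resolvent.
  rewrite mulrC; apply: QadjM; last first.
    by apply: QadjD; [apply: QadjD => //; exact: Qadj_int|exact: (Qadj_conj m0 zm)].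
  have -> : (3%:R^-1 : algC) = ratr (3%:R^-1) by rewrite fmorphV rmorph_nat.
  exact: Qadj_rat.
have m3 : ~~ (3 %| m)%N.
  apply/negP => m3; have : (0 < logn 3 m)%N by rewrite logn_gt0 mem_primes m0 m3.
  by rewrite logn_conductor_formula // (negbTE r3).
have [rho Qr Er] : resolvent_cube (Qadj_omega z) (eisint t (- 3)).
  move: r3; rewrite /ramified_at3 negb_and => /orP[t3|].
    exact: resolvent_cube_3ndvd m0 zm Hm t3.
  by rewrite negbK => /eqP t12; exact: resolvent_cube_12mod27 m0 zm Hm t12.
have [|y Qy fy] := Qadj_omega_descent (t := t) (x := (t%:~R + rho + rho^*) / 3%:R) m0 zm m3 _
  (simplest_root_of_resolvent Er).
  rewrite mulrC; apply: Qadj_omegaM; last first.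
    by apply: Qadj_omegaD; [apply: Qadj_omegaD => //; exact: Qadj_omega_int|exact:
      (Qadj_omega_conj m0 zm)].
  have -> : (3%:R^-1 : algC) = ratr (3%:R^-1) by rewrite fmorphV rmorph_nat.
  by apply: Qadj_Qadj_omega; exact: Qadj_rat.
by exists y.
Qed.

Lemma in_cyclotomic_conductor_formula (K : fieldExtType rat) (t : int) :
  \dim {:K} = 3 -> is_simplest_cubic K t -> in_cyclotomic K (conductor_formula t).
Proof.
move=> dK [theta [rt full]]; have [z [y [zm Qy fy]]] := simplest_root_cyclotomic t.
exact: in_cyclotomic_of_root dK full rt zm Qy fy.
Qed.

(** * Eisenstein elements of simplest cubic fields *)

Section Witnesses.
Variable K : fieldExtType rat.
Implicit Types x z theta : K.

Lemma eisenstein_depressed p z (P Q : int) : prime p -> z ^+ 3 = P%:~R * z + Q%:~R ->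
  (p%:Z %| P)%Z -> (p%:Z %| Q)%Z -> ~~ (p%:Z ^+ 2 %| Q)%Z -> eisenstein p z.
Proof.
move=> pp Ez /dvdzP[P' EP] /dvdzP[Q' EQ] Q2; exists 0, (- P'), (- Q'); split.
  apply: contra Q2; rewrite rpredN => /dvdzP[q Eq]; apply/dvdzP; exists q.
  by rewrite EQ Eq; ring.
by rewrite Ez EP EQ !(mulrNz, intrM); ring.
Qed.

(** Here [z] has valuation 2/3 at [p], so that [z^2 / p] has valuation 1/3. *)
Lemma eisenstein_square p z (P Q : int) : prime p -> z ^+ 3 = P%:~R * z + Q%:~R ->
  (p%:Z ^+ 2 %| P)%Z -> (p%:Z ^+ 2 %| Q)%Z -> ~~ (p%:Z ^+ 3 %| Q)%Z ->
  eisenstein p (z ^+ 2 / p%:R).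
Proof.
move=> pp Ez /dvdzP[P' EP] /dvdzP[Q' EQ] Q3.
have p0 : (p%:R : K) != 0 by rewrite natr_ext_eq0; case: p pp {EP EQ Q3}.
exists (- 2 * P'), (p%:Z * P' ^+ 2), (- Q' ^+ 2); split.
  apply: contra Q3; rewrite rpredN => /(prime_dvdzX pp) /dvdzP[q Eq].
  by apply/dvdzP; exists q; rewrite EQ Eq; ring.
have E2 : (z ^+ 3 - P%:~R * z) ^+ 2 = Q%:~R ^+ 2 by rewrite Ez addrAC subrr add0r.
rewrite EP EQ !intrM in E2.
apply: (mulfI (expf_neq0 3 p0)); move/eqP: E2; rewrite -subr_eq0 => /eqP E2.
apply/eqP; rewrite -subr_eq0 -[X in _ == X]E2; apply/eqP.
by rewrite !(mulrNz, intrM); field.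
Qed.

Lemma simplest_rootE t theta : simplest_root t theta <->
  theta ^+ 3 = t%:~R * theta ^+ 2 + (t%:~R + 3%:R) * theta + 1.
Proof.
rewrite /simplest_root rootE horner_simplest; split=> [/eqP E|E].
  apply/eqP; rewrite -subr_eq0; apply/eqP; rewrite -[RHS]E; ring.
by apply/eqP; rewrite E; ring.
Qed.

Section Root.
Variables (t : int) (theta : K).
Hypothesis rt : simplest_root t theta.
Local Notation D := (Delta t).

Lemma simplest_depressed : (3%:R * theta - t%:~R) ^+ 3 =
  (3 * D)%:~R * (3%:R * theta - t%:~R) + ((2 * t + 3) * D)%:~R.
Proof.
have E := (simplest_rootE t theta).1 rt.
transitivity (27%:R * theta ^+ 3 - 27%:R * t%:~R * theta ^+ 2 + 9%:R * t%:~R ^+ 2 * theta -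
  t%:~R ^+ 3).
  by ring.
by rewrite E /Delta !(intrD, intrM); ring.
Qed.

Lemma simplest_depressed3 s : t = 3 * s -> (theta - s%:~R) ^+ 3 =
  (3 * (s ^+ 2 + s + 1))%:~R * (theta - s%:~R) + ((2 * s + 1) * (s ^+ 2 + s + 1))%:~R.
Proof.
move=> Es; have E := (simplest_rootE t theta).1 rt.
transitivity (theta ^+ 3 - 3%:R * s%:~R * theta ^+ 2 + 3%:R * s%:~R ^+ 2 * theta - s%:~R ^+ 3).
  by ring.
by rewrite E Es !(intrD, intrM); ring.
Qed.

Lemma prime_Delta_dvd p : prime p -> p <> 3%N -> (p%:Z %| D)%Z -> ~~ (p%:Z %| 2 * t + 3)%Z.
Proof.
move=> pp p3 pD; apply/negP => p2; apply: p3; apply/eqP.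
rewrite -dvdn_prime2 //.
suff : (p%:Z %| 3%:Z ^+ 3)%Z by move/(prime_dvdzX pp); rewrite dvdzE.
have -> : 3%:Z ^+ 3 = 4 * D - (2 * t + 3) * (2 * t + 3) by rewrite /Delta; ring.
by rewrite rpredB // dvdz_mull.
Qed.

(** Dividing the depressed root by [n] removes the cube [n^3] from [Delta t]. *)
Lemma depressed_scaled (n : nat) (D' : int) : (0 < n)%N -> D = n%:Z ^+ 3 * D' ->
  ((3%:R * theta - t%:~R) / n%:R) ^+ 3 =
  (3 * n%:Z * D')%:~R * ((3%:R * theta - t%:~R) / n%:R) + ((2 * t + 3) * D')%:~R.
Proof.
move=> n0 ED; have n0' : (n%:R : K) != 0 by rewrite natr_ext_eq0 -lt0n.
apply: (mulfI (expf_neq0 3 n0')); rewrite expr_div_n mulrCA divff ?expf_neq0 // mulr1.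
rewrite simplest_depressed ED !(intrM); move: (3%:R * theta - _) => y.
by field.
Qed.

Lemma eisenstein_tame1 p (n : nat) (D' : int) : prime p -> p <> 3%N -> (0 < n)%N ->
  D = n%:Z ^+ 3 * D' -> (p%:Z %| D')%Z -> ~~ (p%:Z ^+ 2 %| D')%Z ->
  eisenstein p ((3%:R * theta - t%:~R) / n%:R).
Proof.
move=> pp p3 n0 ED pD pD2.
apply: (eisenstein_depressed pp (depressed_scaled n0 ED)); do 1?exact: dvdz_mull.
rewrite Gauss_dvdzr // coprimez_pexpl // /coprimez /gcdz -[_ == _]/(coprime _ _).
by rewrite prime_coprime // -dvdzE prime_Delta_dvd // ED dvdz_mull.
Qed.

Lemma eisenstein_tame2 p (n : nat) (D' : int) : prime p -> p <> 3%N -> (0 < n)%N ->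
  D = n%:Z ^+ 3 * D' -> (p%:Z ^+ 2 %| D')%Z -> ~~ (p%:Z ^+ 3 %| D')%Z ->
  eisenstein p (((3%:R * theta - t%:~R) / n%:R) ^+ 2 / p%:R).
Proof.
move=> pp p3 n0 ED pD pD2.
apply: (eisenstein_square pp (depressed_scaled n0 ED)); do 1?exact: dvdz_mull.
rewrite Gauss_dvdzr // coprimez_pexpl // /coprimez /gcdz -[_ == _]/(coprime _ _).
rewrite prime_coprime // -dvdzE prime_Delta_dvd // ED dvdz_mull //.
by apply: dvdz_trans pD; rewrite expr2 dvdz_mulr.
Qed.

(** The shifts are chosen so that the constant term of the shifted cubic is
    divisible by 3, and then it is divisible by 3 only once. *)
Lemma eisenstein_wild1 s : t = 3 * s -> ~~ (3 %| s - 1)%Z ->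
  exists a : int, eisenstein 3 (theta - a%:~R).
Proof.
move=> Es s1; have E := simplest_depressed3 Es; set z := theta - s%:~R in E.
have [k [Ek|[Ek|Ek]]] : exists k, s = 3 * k \/ s = 3 * k + 2 \/ s = 3 * k + 1.
  exists (s %/ 3)%Z; have := divz_eq s 3; have := modz_ge0 s (isT : 3%Z != 0).
  by have := ltz_pmod s (isT : 0 < 3%Z); lia.
- exists (s + 1); have -> : theta - (s + 1)%:~R = z - 1 by rewrite /z intrD; ring.
  exists 1, (- (s ^+ 2 + s)), (- 18 * k ^+ 3 - 18 * k ^+ 2 - 6 * k - 1); split.
    by apply/dvdzP => -[q]; lia.
  transitivity (z ^+ 3 - 3%:R * z ^+ 2 + 3%:R * z - 1); first by ring.
  by rewrite E Ek; ring.
- exists (s - 1); have -> : theta - (s - 1)%:~R = z + 1 by rewrite /z intrD; ring.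
  exists (- 1), (- (s ^+ 2 + s)), (- 5 - 24 * k - 36 * k ^+ 2 - 18 * k ^+ 3); split.
    by apply/dvdzP => -[q]; lia.
  transitivity (z ^+ 3 + 3%:R * z ^+ 2 + 3%:R * z + 1); first by ring.
  by rewrite E Ek; ring.
by case/negP: s1; apply/dvdzP; exists k; rewrite Ek; ring.
Qed.

Lemma simplest_depressed9 k : t = 3 + 9 * k -> (theta - (1 + 3 * k)%:~R) ^+ 3 =
  (9 * (1 + 3 * k + 3 * k ^+ 2))%:~R * (theta - (1 + 3 * k)%:~R) +
  (9 * ((1 + 2 * k) * (1 + 3 * k + 3 * k ^+ 2)))%:~R.
Proof.
move=> Ek; rewrite simplest_depressed3; last by rewrite Ek; ring.
have -> : 3 * ((1 + 3 * k) ^+ 2 + (1 + 3 * k) + 1) = 9 * (1 + 3 * k + 3 * k ^+ 2) by ring.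
suff -> : (2 * (1 + 3 * k) + 1) * ((1 + 3 * k) ^+ 2 + (1 + 3 * k) + 1) =
  9 * ((1 + 2 * k) * (1 + 3 * k + 3 * k ^+ 2)) by [].
by ring.
Qed.

Lemma eisenstein_wild2 k : t = 3 + 9 * k -> ~~ (3 %| k - 1)%Z ->
  eisenstein 3 ((theta - (1 + 3 * k)%:~R) ^+ 2 / 3%:R).
Proof.
move=> Ek k1; apply: (eisenstein_square (p := 3) _ (simplest_depressed9 Ek)) => //.
- by rewrite dvdz_mulr.
- by rewrite dvdz_mulr.
rewrite (_ : 3%:Z ^+ 3 = 9 * 3) // dvdz_mul2l //; apply: contra k1 => /dvdzP[q Eq].
by apply/dvdzP; exists (- q + (1 + 2 * k) * (k + k ^+ 2) + k); lia.
Qed.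

(** For [p <> 3], dividing by the largest cube [p^(3 k)] in [Delta t] leaves
    valuation 1 or 2; for [p = 3] the two wild cases are separated by
    [t = 3 mod 9]. *)
Lemma exists_eisenstein p : prime p -> (p %| conductor_formula t)%N ->
  exists x, eisenstein p x.
Proof.
move=> pp pc; have : (0 < logn p (conductor_formula t))%N.
  by rewrite logn_gt0 mem_primes pp conductor_formula_gt0.
rewrite logn_conductor_formula //; case: eqP => [->|p3].
  case: ifP => // /andP[/dvdzP[s Es] t12] _; have {}Es : t = 3 * s by rewrite Es mulrC.
  have [/dvdzP[k Ek]|s1] := boolP (3 %| s - 1)%Z; last first.
    by have [a Ha] := eisenstein_wild1 Es s1; eexists; exact: Ha.
  eexists; apply: (@eisenstein_wild2 k); first by lia.
  apply: contra t12 => /dvdzP[l El]; have -> : t = l * 27 + 12 by lia.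
  by rewrite modzMDl.
have [//|v3 _] := boolP (3 %| logn p `|D|)%N.
set v := logn p `|D| in v3; pose k := (v %/ 3)%N.
have Ev := divn_eq v 3; have vm : (v %% 3 < 3)%N by rewrite ltn_mod.
have pn (j : nat) : (p%:Z ^+ j %| D)%Z = (j <= v)%N.
  by rewrite -PoszX dvdzE /= pfactor_dvdn // absDelta_gt0.
have [D' ED] : exists D', D = (p ^ k)%N%:Z ^+ 3 * D'.
  have : (p%:Z ^+ (k * 3) %| D)%Z by rewrite pn /k; lia.
  by move=> /dvdzP[D' ED]; exists D'; rewrite PoszX -exprM ED mulrC.
have pD j : (p%:Z ^+ j %| D')%Z = (k * 3 + j <= v)%N.
  rewrite -pn ED PoszX -exprM exprD dvdz_mul2l // expf_eq0.
  by case: (p) pp => // *; rewrite andbF.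
have k0 : (0 < p ^ k)%N by rewrite expn_gt0 prime_gt0.
case: (v %% 3)%N v3 vm Ev => [|[|[|//]]] v3 vm Ev.
- by case/negP: v3; rewrite Ev addn0 dvdn_mull.
- eexists; apply: (eisenstein_tame1 pp p3 k0 ED).
    by have := pD 1%N; rewrite expr1 => ->; rewrite /k; lia.
  by rewrite pD /k; lia.
- by eexists; apply: (eisenstein_tame2 pp p3 k0 ED); rewrite pD /k; lia.
Qed.
End Root.

Lemma conductor_formulaE t : \dim {:K} = 3 -> is_simplest_cubic K t ->
  conductor K = conductor_formula t.
Proof.
move=> dK sK; have Kc := in_cyclotomic_conductor_formula dK sK.
have min m : (0 < m)%N -> in_cyclotomic K m -> (conductor_formula t <= m)%N.
  move=> m0 Km; apply: dvdn_leq => //.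
  apply/dvdn_partP; first exact: conductor_formula_gt0.
  move=> p; rewrite mem_primes => /and3P[pp _ pc].
  case: sK => theta [rt _]; have [x ex] := exists_eisenstein rt pp pc.
  apply: dvdn_trans (eisenstein_in_cyclotomic m0 Km pp ex).
  rewrite p_part; apply: dvdn_exp2l; rewrite logn_conductor_formula //.
  by case: eqP => _; [case: ifP|case: (3 %| _)%N].
have c0 := conductor_formula_gt0 t.
rewrite /conductor; apply: classical_sets.xget_unique.
  by split.
by move=> c [c1 Kc1 minc]; apply/eqP; rewrite eqn_leq min // minc.
Qed.
End Witnesses.

(** * Discriminants in a cyclic cubic field *)

Lemma integer_rmorph (K L : fieldExtType rat) (f : {rmorphism K -> L}) x :
  integer_elt x -> integer_elt (f x).
Proof.
case=> p pmon px; exists p => //.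
have -> : map_poly (intr : int -> L) p = map_poly f (map_poly intr p).
  by rewrite -map_poly_comp; apply: eq_map_poly => n /=; rewrite rmorph_int.
by rewrite rmorph_root.
Qed.

Lemma cyclic_cubic_automorphism (K : splittingFieldType rat) : cyclic_cubic K ->
  \dim {:K} = 3 /\ exists s : 'AEnd(K), (forall x, s (s (s x)) = x) /\
    (forall x, s x = x -> x \in 1%VS).
Proof.
case=> gal cyc card3.
split.
  by have := galois_dim gal; rewrite card3 dimv1 divn1.
have [g Eg] := cyclicP cyc; exists (gal_repr g : 'AEnd(K)); split.
  move=> x; rewrite -!galM ?memvf //.
  have : (g ^+ 3 = 1)%g by rewrite -card3 Eg -[X in (_ ^+ X)%g]/(#[g]%g) expg_order.
  by rewrite !expgS expg0 mulg1 mulgA => ->; rewrite gal_id.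
move=> x gx; have := galois_fixedField gal => /= <-.
apply/fixedFieldP; first exact: memvf.
move=> h; rewrite Eg => /cycleP[i ->].
by elim: i => [|i IH]; rewrite ?expg0 ?gal_id // expgSr galM ?memvf // IH.
Qed.

Section CyclicCubic.
Variables (K : splittingFieldType rat) (s : 'AEnd(K)).
Hypotheses (dK : \dim {:K} = 3) (s3 : forall x, s (s (s x)) = x).
Hypothesis sfix : forall x, s x = x -> x \in 1%VS.
Implicit Types x y z w g : K.

Lemma integer_s x : integer_elt x -> integer_elt (s x).
Proof. exact: integer_rmorph. Qed.

Lemma invariant_int x : s x = x -> integer_elt x -> exists n : int, x = n%:~R.
Proof. by move=> /sfix /mem1_intP. Qed.

Lemma s_int (n : int) : s n%:~R = n%:~R.
Proof. exact: rmorph_int. Qed.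

(** A square root of the discriminant of [x]; being invariant under [s], it is
    rational. *)
Definition diff_prod x := (x - s x) * (s x - s (s x)) * (s (s x) - x).

Lemma diff_prod_int x : integer_elt x -> exists n : int, diff_prod x = n%:~R.
Proof.
move=> Ix; apply: invariant_int.
  by rewrite /diff_prod !(rmorphM, rmorphB) /= s3; ring.
have := integer_s Ix; have := integer_s (integer_s Ix); rewrite /diff_prod => *.
by solve_integer.
Qed.

Lemma irrational_neq x : x \notin 1%VS -> x - s x != 0.
Proof.
by apply: contra; rewrite subr_eq0 => /eqP E; apply: sfix.
Qed.

Lemma diff_prod_neq0 x : x \notin 1%VS -> diff_prod x != 0.
Proof.
move=> x1; have d0 := irrational_neq x1.
rewrite /diff_prod !mulf_neq0 //.
  by rewrite -rmorphB fmorph_eq0.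
have -> : s (s x) - x = s (s (x - s x)) by rewrite !rmorphB /= s3.
by rewrite !fmorph_eq0.
Qed.

(** Lagrange interpolation of [w] at the conjugates of [g], with the denominator
    cleared: the coefficients are integral and invariant under [s]. *)
Lemma diff_prod_mul_mem g w (D : int) : integer_elt g -> integer_elt w -> diff_prod g = D%:~R
  ->
  exists a b c : int, D%:~R * w = a%:~R + b%:~R * g + c%:~R * g ^+ 2.
Proof.
move=> Ig Iw ED; rewrite -ED.
have Ig1 := integer_s Ig; have Ig2 := integer_s Ig1.
have Iw1 := integer_s Iw; have Iw2 := integer_s Iw1.
pose g1 := s g; pose g2 := s g1; pose w1 := s w; pose w2 := s w1.
have [a Ea] : exists a : int, - (w * g1 * g2 * (g1 - g2) + w1 * g2 * g * (g2 - g) + w2 * g *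
  g1 * (g - g1)) = a%:~R.
  apply: invariant_int; last by rewrite /w2 /w1 /g2 /g1; solve_integer.
  by rewrite /w2 /w1 /g2 /g1 !(rmorphM, rmorphB, rmorphN, rmorphD) /= !s3; ring.
have [b Eb] : exists a : int, (w * (g1 ^+ 2 - g2 ^+ 2) + w1 * (g2 ^+ 2 - g ^+ 2) + w2 * (g ^+
  2 - g1 ^+ 2)) = a%:~R.
  apply: invariant_int; last by rewrite /w2 /w1 /g2 /g1; solve_integer.
  by rewrite /w2 /w1 /g2 /g1 !(rmorphM, rmorphB, rmorphN, rmorphD) /= !s3; ring.
have [c Ec] : exists a : int, - (w * (g1 - g2) + w1 * (g2 - g) + w2 * (g - g1)) = a%:~R.
  apply: invariant_int; last by rewrite /w2 /w1 /g2 /g1; solve_integer.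
  by rewrite /w2 /w1 /g2 /g1 !(rmorphM, rmorphB, rmorphN, rmorphD) /= !s3; ring.
exists a, b, c; rewrite -Ea -Eb -Ec /diff_prod -/g1 -/g2; ring.
Qed.

(** A difference [w - s w] is a multiple of [x - s x], up to the denominator
    [d]; the product of the three cofactors is an integer. *)
Lemma diff_prod_transfer x w (d a b c : int) : integer_elt x ->
  d%:~R * w = a%:~R + b%:~R * x + c%:~R * x ^+ 2 ->
  exists n : int, d%:~R ^+ 3 * diff_prod w = diff_prod x * n%:~R.
Proof.
move=> Ix E; have Ix1 := integer_s Ix; have Ix2 := integer_s Ix1.
have E1 : d%:~R * s w = a%:~R + b%:~R * s x + c%:~R * s x ^+ 2.
  by have := congr1 s E; rewrite !(rmorphM, rmorphD) /= !s_int.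
have E2 : d%:~R * s (s w) = a%:~R + b%:~R * s (s x) + c%:~R * s (s x) ^+ 2.
  by have := congr1 s E1; rewrite !(rmorphM, rmorphD) /= !s_int.
have [n En] : exists n : int, (b%:~R + c%:~R * (x + s x)) * (b%:~R + c%:~R * (s x + s (s x)))
  * (b%:~R + c%:~R * (s (s x) + x)) = n%:~R.
  apply: invariant_int; last by solve_integer.
  by rewrite !(rmorphM, rmorphD) /= !s_int s3; ring.
exists n; rewrite -En.
transitivity ((d%:~R * w - d%:~R * s w) * (d%:~R * s w - d%:~R * s (s w)) * (d%:~R * s (s w)
  - d%:~R * w)).
  by rewrite /diff_prod; ring.
by rewrite E2 E1 E /diff_prod; ring.
Qed.

Lemma diff_prod_scale x w (d e : K) : s d = d -> s e = e -> w = (d * x - e) -> diff_prod w =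
  d ^+ 3 * diff_prod x.
Proof.
move=> sd se ->; have sE y : s (d * y - e) = d * s y - e by rewrite rmorphB rmorphM /= sd se.
by rewrite /diff_prod !sE; ring.
Qed.

Lemma cubic_vieta x (a b c : int) : x \notin 1%VS ->
  x ^+ 3 = a%:~R * x ^+ 2 + b%:~R * x + c%:~R ->
  [/\ x + s x + s (s x) = a%:~R, x * s x + s x * s (s x) + s (s x) * x = - b%:~R
    & x * s x * s (s x) = c%:~R].
Proof.
move=> x1 E; have d0 := irrational_neq x1.
have E1 : s x ^+ 3 = a%:~R * s x ^+ 2 + b%:~R * s x + c%:~R.
  by have := congr1 s E; rewrite !(rmorphM, rmorphD) /= !s_int.
have E2 : s (s x) ^+ 3 = a%:~R * s (s x) ^+ 2 + b%:~R * s (s x) + c%:~R.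
  by have := congr1 s E1; rewrite !(rmorphM, rmorphD) /= !s_int.
have d1 : s x - s (s x) != 0 by rewrite -rmorphB fmorph_eq0.
have d2 : s (s x) - x != 0.
  have -> : s (s x) - x = s (s (x - s x)) by rewrite !rmorphB /= s3.
  by rewrite !fmorph_eq0.
move: E E1 E2 d0 d1 d2; move: (s x) (s (s x)) => y z E E1 E2 d0 d1 d2.
have Q : x ^+ 2 + x * y + y ^+ 2 - a%:~R * (x + y) - b%:~R = 0.
  apply: (mulfI d0); rewrite mulr0.
  transitivity ((x ^+ 3 - y ^+ 3) - a%:~R * (x ^+ 2 - y ^+ 2) - b%:~R * (x - y)); first by
    ring.
  by rewrite E E1; ring.
have Q1 : y ^+ 2 + y * z + z ^+ 2 - a%:~R * (y + z) - b%:~R = 0.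
  apply: (mulfI d1); rewrite mulr0.
  transitivity ((y ^+ 3 - z ^+ 3) - a%:~R * (y ^+ 2 - z ^+ 2) - b%:~R * (y - z)); first by
    ring.
  by rewrite E1 E2; ring.
have T : x + y + z = a%:~R.
  apply: (mulfI d2); apply/eqP; rewrite -subr_eq0; apply/eqP.
  rewrite -[RHS](subrr (0 : K)) -{1}Q1 -Q; ring.
have Ez : z = a%:~R - x - y by rewrite -T; ring.
have Eb : b%:~R = x ^+ 2 + x * y + y ^+ 2 - a%:~R * (x + y) by apply/eqP; rewrite eq_sym
  -subr_eq0 Q.
split => //; first by rewrite Eb Ez; ring.
have -> : c%:~R = x ^+ 3 - a%:~R * x ^+ 2 - b%:~R * x by rewrite E; ring.
by rewrite Eb Ez; ring.
Qed.

Lemma diff_prod_simplest t theta : theta \notin 1%VS -> simplest_root t theta ->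
  diff_prod theta = (Delta t)%:~R \/ diff_prod theta = - (Delta t)%:~R.
Proof.
move=> th1 rt; have E := (simplest_rootE t theta).1 rt.
have [|T1 T2 T3] := @cubic_vieta theta t (t + 3) 1 th1; first by rewrite E intrD.
suff : diff_prod theta ^+ 2 = (Delta t)%:~R ^+ 2.
  by move/eqP; rewrite eqf_sqr => /orP[] /eqP ->; [left|right].
have disc (x y z e1 e2 e3 : K) : x + y + z = e1 -> x * y + y * z + z * x = e2 -> x * y * z =
  e3 ->
  ((x - y) * (y - z) * (z - x)) ^+ 2 = e1 ^+ 2 * e2 ^+ 2 - 4%:R * e2 ^+ 3 - 4%:R * e1 ^+ 3 *
    e3 + 18%:R * e1 * e2 * e3 - 27%:R * e3 ^+ 2.
  by move=> <- <- <-; ring.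
rewrite /diff_prod (disc _ _ _ _ _ _ T1 T2 T3) /Delta !(intrD, intrM); ring.
Qed.

(** The conjugates of [z] have sum 0, so
    [z^2 - (s z)^2 = - (z - s z) (s (s z))]; the remaining product is the norm
    [Q] of [z]. *)
Lemma diff_prod_square z (P Q : int) (p : K) : z \notin 1%VS -> s p = p ->
  z ^+ 3 = P%:~R * z + Q%:~R -> p != 0 ->
  p ^+ 3 * diff_prod (z ^+ 2 / p) = - (diff_prod z * Q%:~R).
Proof.
move=> z1 sp E p0; have [|T1 _ T3] := @cubic_vieta z 0 P Q z1; first by rewrite E mul0r add0r.
have sE y : s (y ^+ 2 / p) = s y ^+ 2 / p by rewrite rmorphM rmorphXn fmorphV /= sp.
rewrite -T3 /diff_prod !sE.
have -> : s (s z) = - z - s z by rewrite -[RHS]addr0 -[X in _ + X]/((0 : int)%:~R) -T1; ring.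
by field.
Qed.

End CyclicCubic.

(** * From a cubic quotient to a power integral basis *)

(** An ideal of [Z] contained in no prime ideal is [Z]; only the primes dividing
    one of its elements matter. *)
Lemma int_ideal_local (P : int -> Prop) (D : int) :
  (forall u a v b, P a -> P b -> P (u * a + v * b)) -> P D -> D != 0 ->
  (forall p : nat, prime p -> (p%:Z %| D)%Z -> exists2 d, ~~ (p%:Z %| d)%Z & P d) -> P 1.
Proof.
move=> PC; have [n] := ubnP `|D|%N; elim: n D => // n IH D Dn PD D0 loc.
have [D1|D1] := eqVneq `|D|%N 1%N.
  have -> : 1 = sgz D * D + 0 * D by rewrite mul0r addr0 -abszEsg D1.
  exact: PC.
set p := pdiv `|D|; have pp : prime p by rewrite pdiv_prime // ltn_neqAle eq_sym D1 absz_gt0.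
have pD : (p%:Z %| D)%Z by rewrite dvdzE pdiv_dvd.
have [d pd Pd] := loc p pp pD.
have [u [v Eg]] := Bezoutz D d.
have Pg : P (gcdz D d) by rewrite -Eg; exact: PC.
have gD : (gcdz D d %| D)%Z := dvdz_gcdl D d.
have g0 : gcdz D d != 0 by rewrite gcdz_eq0 (negbTE D0).
apply: (IH (gcdz D d)) => //; last first.
  by move=> q pq qg; apply: loc => //; exact: dvdz_trans qg gD.
have lt : (`|gcdz D d| < `|D|)%N.
  rewrite ltn_neqAle dvdn_leq ?absz_gt0 // andbT; apply: contra pd => /eqP E.
  apply: dvdz_trans (dvdz_gcdr D d).
  by rewrite dvdzE E -dvdzE.
by move: Dn; rewrite ltnS => Dn; exact: leq_trans lt Dn.
Qed.

Lemma simplest_root_irrational (K : fieldExtType rat) t (theta : K) :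
  simplest_root t theta -> theta \notin 1%VS.
Proof.
move=> rt; have E := (simplest_rootE t theta).1 rt.
apply/negP => /mem1_intP[].
  by apply: (@integer_cubic _ t (t + 3) 1); rewrite E intrD.
move=> n En; move: E; rewrite En.
have -> : (n%:~R ^+ 3 : K) = (n ^+ 3)%:~R by rewrite !intrM.
have -> : t%:~R * n%:~R ^+ 2 + (t%:~R + 3%:R) * n%:~R + 1 = (t * n ^+ 2 + (t + 3) * n +
  1)%:~R :> K.
  by rewrite !(intrD, intrM); ring.
move/intr_ext_inj => H.
have Hn : n * (n ^+ 2 - t * n - t - 3) = 1 by rewrite -[RHS](addrK (t * n ^+ 2 + (t + 3) *
  n)) [1 + _]addrC -H; ring.
have n1 : n = 1 \/ n = -1.
  have : (n %| 1)%Z by apply/dvdzP; exists (n ^+ 2 - t * n - t - 3); rewrite mulrC; exact: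
    esym Hn.
  by rewrite dvdzE /= dvdn1; lia.
by case: n1 H => ->; lia.
Qed.

Lemma dvd3_of_cube t n c : Delta t = c * n%:Z ^+ 3 -> (3 %| n)%N -> (3 %| t)%Z.
Proof.
move=> E /dvdnP[n' En]; apply: (@prime_dvdzX 3 _ 2) => //.
have -> : t ^+ 2 = Delta t - 3 * (t + 3) by rewrite /Delta; ring.
apply: rpredB; last exact: dvdz_mulr.
by rewrite E En PoszM; apply/dvdzP; exists (9 * c * n'%:Z ^+ 3); ring.
Qed.

Lemma logn3_Delta_ndvd t : ~~ (3 %| t)%Z -> logn 3 `|Delta t| = 0%N.
Proof.
move=> t3; rewrite lognE /= absDelta_gt0 -[(3 %| _)%N]/((3%:Z %| Delta t)%Z).
case: ifP => // D3; case/negP: t3; apply: (@prime_dvdzX 3 _ 2) => //.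
have -> : t ^+ 2 = Delta t - 3 * (t + 3) by rewrite /Delta; ring.
by apply: rpredB => //; exact: dvdz_mulr.
Qed.

Lemma logn3_Delta_eq t k (u : int) : Delta t = (3 ^ k)%N%:Z * u -> ~~ (3 %| u)%Z ->
  logn 3 `|Delta t| = k.
Proof.
move=> E u3; rewrite E abszM lognM ?expn_gt0 ?absz_gt0 //; last first.
  by apply: contra u3 => /eqP ->; exact: dvdz0.
rewrite pfactorK // lognE /= absz_gt0 -[(3 %| _)%N]/((3%:Z %| u)%Z) (negbTE u3).
by case: eqP; rewrite addn0.
Qed.

Lemma logn3_Delta_wild1 sg : ~~ (3 %| sg - 1)%Z -> logn 3 `|Delta (3 * sg)| = 2%N.
Proof.
move=> s1; apply: (@logn3_Delta_eq _ _ (sg ^+ 2 + sg + 1)); first by rewrite /Delta; lia.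
apply: contra s1 => H; apply: (@prime_dvdzX 3 _ 2) => //.
have -> : (sg - 1) ^+ 2 = (sg ^+ 2 + sg + 1) - 3 * sg by ring.
by apply: rpredB => //; exact: dvdz_mulr.
Qed.

Lemma logn3_Delta_wild2 k : logn 3 `|Delta (3 + 9 * k)| = 3%N.
Proof.
apply: (@logn3_Delta_eq _ _ (1 + 3 * k + 3 * k ^+ 2)); first by rewrite /Delta; lia.
by apply/dvdzP => -[q]; lia.
Qed.

Section Main.
Variables (K : splittingFieldType rat) (s : 'AEnd(K)).
Hypotheses (dK : \dim {:K} = 3) (s3 : forall x, s (s (s x)) = x).
Hypothesis sfix : forall x, s x = x -> x \in 1%VS.
Implicit Types x y z w g theta : K.

(** The [d] with [d w] in [Z[g]] form an ideal.  It contains [diff_prod g], and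
    at a prime [p] dividing [diff_prod g] the Eisenstein element provides some
    [d] prime to [p]. *)
Lemma power_integral_basis_of_local g (D : int) : integer_elt g -> D != 0 ->
  diff_prod s g = D%:~R ->
  (forall p : nat, prime p -> (p%:Z %| D)%Z -> exists x, Zadj g x /\ eisenstein p x) ->
  power_integral_basis g.
Proof.
move=> Ig D0 ED loc; split => // w; split=> [Iw|[q ->]]; last exact: integer_horner.
change (Zadj g w); rewrite -[w]mul1r -[1]/(1%:~R).
apply: (@int_ideal_local (fun d => Zadj g (d%:~R * w)) D) => //.
- move=> u a v b Pa Pb; rewrite intrD !intrM mulrDl -!mulrA.
  by apply: ZadjD; apply: ZadjM => //; exact: Zadj_int.
- have [a [b [c ->]]] := diff_prod_mul_mem s3 sfix Ig Iw ED.
  apply: ZadjD; [apply: ZadjD|]; do ?apply: ZadjM; do ?exact: Zadj_int; do ?apply: ZadjX;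
    exact: Zadj_gen.
move=> p pp /loc -/(_ pp)[x [Zx ex]].
have [n [pn [a [b [c E]]]]] := eisenstein_maximal dK pp ex Iw.
exists n%:Z; first by rewrite dvdzE.
rewrite -[_%:~R]/(n%:R) E.
by apply: ZadjD; [apply: ZadjD|]; do ?apply: ZadjM; do ?exact: Zadj_int; do ?apply: ZadjX.
Qed.

(** The Eisenstein element at [p <> 3] is the scaled depressed root
    [(3 theta - t) / n], which differs from [3 g] by an integer; at 3 it is
    [theta] shifted by an integer, and [theta = n g + a].  Integrality of [g]
    follows from that of [3 g] and [n g] when 3 does not divide [n]; otherwise
    [t = 12 mod 27] and the depressed equation of [theta - t / 3] can be divided
    by [n^3]. *)
Lemma power_integral_basis_of_cube t (n : nat) theta (a : int) :
  (0 < n)%N -> simplest_root t theta -> Delta t = (conductor_formula t)%:Z * n%:Z ^+ 3 ->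
  third_mod t a n -> power_integral_basis ((theta - a%:~R) / n%:R).
Proof.
move=> n0 rt ED [tm3 tmn3]; set g := (theta - a%:~R) / n%:R; set c := conductor_formula t in
  ED.
have th1 := simplest_root_irrational rt.
have c0 : (0 < c)%N := conductor_formula_gt0 t.
have n0K : (n%:R : K) != 0 by rewrite natr_ext_eq0 -lt0n.
have Eth : theta = n%:R * g + a%:~R by rewrite /g mulrC divfK // subrK.
have ED' : Delta t = n%:Z ^+ 3 * c by rewrite ED mulrC.
have Iz : integer_elt ((3%:R * theta - t%:~R) / n%:R).
  by have := depressed_scaled rt n0 ED'; rewrite -[X in X = _]subr0 subr0 => E;
     apply: (@integer_cubic _ 0 (3 * n%:Z * c) ((2 * t + 3) * c)); rewrite E mul0r add0r.
have Ith : integer_elt theta.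
  by apply: (@integer_cubic _ t (t + 3) 1); rewrite ((simplest_rootE t theta).1 rt) intrD.
have lognD p : prime p -> logn p `|Delta t| = (logn p c + 3 * logn p n)%N.
  by move=> pp; rewrite ED abszM abszX lognM ?lognX // expn_gt0 n0.
(* 3 g differs from the scaled depressed root by an integer *)
have [h Eh] : exists h : int, 3 * a - t = n%:Z * h.
  have [n3|n3] := boolP (3 %| n)%N.
    have /dvdzP[sg Es] := dvd3_of_cube ED n3.
    have := tm3 n3; rewrite Es mulzK // => /eqP; rewrite eqz_mod_dvd => /dvdzP[q Eq].
    exists (3 * q); have -> : a = q * n + sg by rewrite -Eq subrK.
    ring.
  by have := tmn3 n3 => /eqP; rewrite eqz_mod_dvd => /dvdzP[q Eq]; exists q; rewrite Eq mulrC.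
have Ez : (3%:R * theta - t%:~R) / n%:R = 3%:R * g + h%:~R.
  apply: (mulIf n0K); rewrite divfK // Eth.
  have -> : t%:~R = 3%:R * a%:~R - n%:R * h%:~R :> K.
    have -> : t = 3 * a - n%:Z * h by rewrite -Eh; ring.
    by rewrite intrD mulrNz !intrM.
  by ring.
have Ig : integer_elt g.
  have [n3|n3] := boolP (3 %| n)%N.
    have := dvd3_of_cube ED n3 => t3; have /dvdzP[sg Es] := t3.
    have t12 : (t = 12 %[mod 27])%Z.
      have [nr|nr] := boolP (ramified_at3 t); last first.
        by move: nr; rewrite /ramified_at3 t3 /= negbK => /eqP.
      have v3n : (0 < logn 3 n)%N by rewrite logn_gt0 mem_primes n0 n3.
      have := lognD 3%N isT; rewrite logn_conductor_formula //= nr => H; move: v3n H.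
      have [/dvdzP[k Ek]|s1] := boolP (3 %| sg - 1)%Z.
        have -> : t = 3 + 9 * k by clear -Es Ek; lia.
        by rewrite logn3_Delta_wild2 => H1 H; clear -H1 H; lia.
      by rewrite Es mulrC logn3_Delta_wild1 // => H1 H2; clear -H1 H2; lia.
    have [l El] : exists l, t = 12 + 27 * l.
      by exists (t %/ 27)%Z; have := divz_eq t 27; rewrite t12 => H; clear -H; lia.
    have /dvdnP[n' En] := n3.
    have := tm3 n3; rewrite Es mulzK // => /eqP; rewrite eqz_mod_dvd => /dvdzP[q Eq].
    have Est : t = 3 * sg by rewrite Es mulrC.
    have Eg : g = (theta - sg%:~R) / n%:R - q%:~R.
      rewrite /g; have -> : a = sg + q * n by rewrite -Eq; ring.
      by rewrite intrD intrM; field.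
    rewrite Eg; apply: integerB; last exact: integer_int.
    have E := simplest_depressed3 rt Est.
    apply: (@integer_cubic _ 0 (c%:Z * n'%:Z) ((1 + 2 * l) * c%:Z)).
    apply: (mulfI (expf_neq0 3 n0K)); rewrite expr_div_n mulrCA divff ?expf_neq0 // mulr1 E.
    have Ee : sg ^+ 2 + sg + 1 = 3 * (c%:Z * n'%:Z ^+ 3).
      apply: (@mulfI _ (9 : int)) => //; transitivity (Delta t).
        by rewrite /Delta Est; ring.
      by rewrite ED En PoszM; ring.
    have E2 : 2 * sg + 1 = 9 * (1 + 2 * l) by clear -El Est; lia.
    rewrite Ee E2 En natrM !(intrD, intrM).
    have n'0 : (n'%:R : K) != 0.
      by move: n0K; rewrite En natrM mulf_eq0 negb_or => /andP[].
    by field; rewrite n'0 andbT natr_ext_eq0.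
  have cop : coprimez 3 n by rewrite coprimezE prime_coprime.
  have [[u v] /= Euv] := coprimezP _ _ cop.
  have -> : g = u%:~R * (3%:R * g) + v%:~R * (n%:R * g).
    have E1 : u%:~R * 3%:R + v%:~R * n%:R = 1 :> K.
      by rewrite -[RHS]/(1%:~R) -Euv intrD !intrM.
    transitivity ((u%:~R * 3%:R + v%:~R * n%:R) * g); last by ring.
    by rewrite E1 mul1r.
  apply: integerD; apply: integerM; do ?exact: integer_int.
    have -> : 3%:R * g = (3%:R * theta - t%:~R) / n%:R - h%:~R by rewrite Ez addrK.
    by apply: integerB => //; exact: integer_int.
  have -> : n%:R * g = theta - a%:~R by rewrite Eth addrK.
  by apply: integerB => //; exact: integer_int.
have sg : diff_prod s theta = n%:R ^+ 3 * diff_prod s g.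
  apply: (@diff_prod_scale _ s g theta n%:R (- a%:~R)).
  - exact: rmorph_nat.
  - by rewrite rmorphN /= s_int.
  by rewrite opprK.
have [D [D0 cD ED2]] : exists D : int, [/\ D != 0, D = c \/ D = - c%:Z & diff_prod s g =
  D%:~R].
  have n3K := expf_neq0 3 n0K.
  have c0' : c%:Z != 0 by rewrite -lt0n in c0 *.
  case: (diff_prod_simplest s3 sfix th1 rt) => E; [exists c%:Z|exists (- c%:Z)]; split.
  - by [].
  - by left.
  - by apply: (mulfI n3K); rewrite -sg E ED !intrM; ring.
  - by rewrite oppr_eq0.
  - by right.
  - by apply: (mulfI n3K); rewrite -sg E ED mulrNz !intrM; ring.
apply: (power_integral_basis_of_local Ig D0 ED2) => p pp pD.
have pc : (p %| c)%N by case: cD pD => ->; rewrite ?rpredN dvdzE.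
have vc : (0 < logn p c)%N by rewrite logn_gt0 mem_primes pp c0 pc.
have Zg := Zadj_gen g.
have [p3|p3] := eqVneq p 3%N.
  move: vc; rewrite p3 logn_conductor_formula //=; case: ifP => // r3 _.
  have /andP[/dvdzP[s0 Es] _] := r3.
  have Est : t = 3 * s0 by rewrite Es mulrC.
  have [/dvdzP[k Ek]|s1] := boolP (3 %| s0 - 1)%Z.
    have := lognD 3%N isT; rewrite logn_conductor_formula //= r3.
    have -> : t = 3 + 9 * k by clear -Es Ek; lia.
    by rewrite logn3_Delta_wild2 => H; clear -H; lia.
  have [a0 ea] := eisenstein_wild1 rt Est s1; eexists; split; last exact: ea.
  rewrite Eth; apply: ZadjD; last by apply: ZadjN; exact: Zadj_int.
  by apply: ZadjD; [apply: ZadjM => //; exact: Zadj_nat|exact: Zadj_int].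
exists ((3%:R * theta - t%:~R) / n%:R); split.
  by rewrite Ez; apply: ZadjD; [apply: ZadjM => //; exact: Zadj_nat|exact: Zadj_int].
apply: (eisenstein_tame1 rt pp _ n0 ED') => //; first exact/eqP.
rewrite -PoszX dvdzE /= pfactor_dvdn // logn_conductor_formula // (negbTE p3).
by case: (3 %| _)%N.
Qed.

End Main.

(** * From a power integral basis to a simplest cubic *)

Section FromBasis.
Variables (K : splittingFieldType rat) (s : 'AEnd(K)).
Hypotheses (dK : \dim {:K} = 3) (s3 : forall x, s (s (s x)) = x).
Hypothesis sfix : forall x, s x = x -> x \in 1%VS.
Implicit Types x y z w g theta : K.

Lemma exists_irrational : exists x : K, x \notin 1%VS.
Proof.
have : ~~ ({:K} <= 1%VS)%VS by apply/negP => /dimvS; rewrite dK dimv1.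
case/subvPn => x _ x1; exists x.
exact: x1.
Qed.

(** An integral relation [n x^3 = a + b x + c x^2] becomes monic in [n x]. *)
Lemma exists_integer_irrational : exists x : K, integer_elt x /\ x \notin 1%VS.
Proof.
have [x x1] := exists_irrational.
have [n [n0 [a [b [c E]]]]] := span_cubic (x ^+ 3) dK x1.
have n0K : (n%:R : K) != 0 by rewrite natr_ext_eq0 -lt0n.
exists (n%:R * x); split.
  apply: (@integer_cubic _ c (n%:Z * b) (n%:Z ^+ 2 * a)).
  have -> : (n%:R * x) ^+ 3 = n%:R ^+ 2 * (n%:R * x ^+ 3) by ring.
  by rewrite E !(intrM); ring.
apply: contra x1 => nx; have -> : x = n%:R^-1 * (n%:R * x) by rewrite mulKf.
by apply: memvM nx; apply: rpredVr; exact: rpred_nat.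
Qed.

Variable g : K.
Hypothesis pg : power_integral_basis g.

Lemma power_basis_Zadj w : integer_elt w -> Zadj g w.
Proof. by case: pg => _ H /H. Qed.

Lemma power_basis_irrational : g \notin 1%VS.
Proof.
have [x [Ix x1]] := exists_integer_irrational.
apply: contra x1 => g1; have [q ->] := power_basis_Zadj Ix.
have : map_poly (intr : int -> K) q \is a polyOver 1%VS.
  by apply/polyOverP => i; rewrite coef_map /= rpred_int.
by move=> qo; apply: rpred_horner.
Qed.

(** [x] is an integral polynomial in [g], and [s x] is the same polynomial in
    [s g]. *)
Lemma power_basis_diff_dvd x : integer_elt x ->
  exists r, integer_elt r /\ x - s x = (g - s g) * r.
Proof.
case: pg => Ig _ Ix; have [q Eq] := power_basis_Zadj Ix.
have Esx : s x = (map_poly intr q).[s g].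
  rewrite Eq -horner_map -map_poly_comp; congr (_.[s g]).
  by apply: eq_map_poly => n /=; rewrite rmorph_int.
have [r Zr Er] : exists2 r, Zadj g r & (map_poly intr q).[g] = (map_poly intr q).[s g] + (g -
  s g) * r.
  apply: Zadj_horner_sub; [exact: Zadj_gen|exact/power_basis_Zadj/integer_s|].
  by exists 1; [exact: (Zadj_nat g 1)|rewrite mulr1 addrC subrK].
by exists r; split; [exact: integer_Zadj Ig Zr|rewrite Esx Eq Er addrAC subrr add0r].
Qed.

Lemma power_basis_diff_prod_dvd x : integer_elt x ->
  exists n : int, diff_prod s x = diff_prod s g * n%:~R.
Proof.
move=> Ix; have [r [Ir Er]] := power_basis_diff_dvd Ix.
have Ir1 := integer_s s Ir; have Ir2 := integer_s s Ir1.
have [n En] : exists n : int, r * s r * s (s r) = n%:~R.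
  apply: (invariant_int sfix); last by solve_integer.
  by rewrite !rmorphM /= s3; ring.
exists n; rewrite -En.
have E1 : s x - s (s x) = (s g - s (s g)) * s r by rewrite -rmorphB Er rmorphM rmorphB.
have E2 : s (s x) - x = (s (s g) - g) * s (s r).
  by have := congr1 s E1; rewrite rmorphM !rmorphB /= !s3.
by rewrite /diff_prod Er E1 E2; ring.
Qed.

(** The root is [u = s d / d] with [d = g - s g].  It is an integer because
    [s g] is an integral polynomial in [g], and [u (s u) = - (1 + u)] determines
    the conjugates of [u], hence its minimal polynomial, from its trace.  The
    integer [A] is [d^2 + d (s d) + (s d)^2]. *)
Lemma power_basis_simplest_root : exists t theta (A D : int),
  [/\ simplest_root t theta, diff_prod s g = D%:~R & Delta t * D ^+ 2 = A ^+ 3].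
Proof.
have g1 := power_basis_irrational; have [Ig _] := pg.
have Ig1 := integer_s s Ig; have Ig2 := integer_s s Ig1.
have d0 : g - s g != 0 by exact: irrational_neq.
have [u [Iu Eu]] := power_basis_diff_dvd Ig1.
have [D ED] := diff_prod_int s3 sfix Ig.
pose d := g - s g; have Esd : s d = d * u by rewrite /d rmorphB Eu.
have tr : d + s d + s (s d) = 0 by rewrite /d !rmorphB /= s3; ring.
have {}d0 : d != 0 by [].
have Ed : d = g - s g by [].
clearbody d.
have Essd : s (s d) = - d * (1 + u) by apply/eqP; rewrite -subr_eq0 -tr Esd; apply/eqP; ring.
have E1 : u * s u = - (1 + u).
  by apply: (mulfI d0); rewrite mulrA -Esd -rmorphM /= -Esd Essd; ring.
have E2 : s u * s (s u) = - (1 + s u).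
  by have := congr1 s E1; rewrite !(rmorphM, rmorphN, rmorphD, rmorph1).
have E3 : s (s u) * u = - (1 + s (s u)).
  by have := congr1 s E2; rewrite !(rmorphM, rmorphN, rmorphD, rmorph1) /= s3.
have Iu1 := integer_s s Iu; have Iu2 := integer_s s Iu1.
have [t Et] : exists t : int, u + s u + s (s u) = t%:~R.
  apply: (invariant_int sfix); last by solve_integer.
  by rewrite !rmorphD /= s3; ring.
have [A EA] : exists A : int, d ^+ 2 * (1 + u + u ^+ 2) = A%:~R.
  apply: (invariant_int sfix); last by rewrite Ed; solve_integer.
  have -> : d ^+ 2 * (1 + u + u ^+ 2) = d ^+ 2 + d * s d + s d ^+ 2 by rewrite Esd; ring.
  by rewrite !(rmorphD, rmorphM) /= Essd Esd; ring.
have rt : u ^+ 3 = t%:~R * u ^+ 2 + (t%:~R + 3%:R) * u + 1.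
  rewrite -Et; apply/eqP; rewrite -subr_eq0; apply/eqP.
  transitivity (- u * (u * s u) - u * (s (s u) * u) - u * s u - s (s u) * u - u ^+ 2 - 3%:R *
    u - 1); first by ring.
  rewrite E1 E3.
  transitivity (u * s (s u) + 1 + s (s u)); first by ring.
  by rewrite mulrC E3; ring.
exists t, u, A, D; split => //; first exact/simplest_rootE.
apply: (@intr_ext_inj K); rewrite !(intrD, intrM) -ED -EA.
have -> : diff_prod s g = d * s d * s (s d).
  by rewrite /diff_prod Ed !rmorphB /= s3.
rewrite Essd Esd.
have E : t%:~R * (u * (1 + u)) = u ^+ 3 - 3%:R * u - 1 by rewrite rt; ring.
transitivity (d ^+ 6 * ((t%:~R * (u * (1 + u))) ^+ 2 + 3%:R * (t%:~R * (u * (1 + u))) * (u *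
  (1 + u)) + 9%:R * (u * (1 + u)) ^+ 2)); first by ring.
by rewrite E; ring.
Qed.

Variables (t : int) (theta : K) (A D : int).
Hypotheses (rt : simplest_root t theta) (ED : diff_prod s g = D%:~R).
Hypothesis EA : Delta t * D ^+ 2 = A ^+ 3.

Let D0 : D != 0.
Proof. by have := diff_prod_neq0 s3 sfix power_basis_irrational; rewrite ED intr_ext_eq0. Qed.

Lemma power_basis_logn p : (logn p `|Delta t| + 2 * logn p `|D| = 3 * logn p `|A|)%N.
Proof.
have := congr1 (fun n : int => logn p `|n|) EA.
rewrite /= abszM !abszX lognM ?lognX ?expn_gt0 ?absz_gt0 ?D0 //.
by rewrite gt_eqF // Delta_gt0.
Qed.

(** If [v_p(Delta t) = 3 k + 2], the Eisenstein element [x] is [z^2 / p] with [z]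
    the depressed root divided by [p^k], and [diff_prod x] has valuation 1.  It
    is a multiple of [D], so [v_p(D)] is at most 1, whereas
    [3 v_p(A) = v_p(Delta t) + 2 v_p(D)] makes it 2 modulo 3. *)
Lemma power_basis_logn_neq2_mod3 p : prime p -> p <> 3%N -> logn p `|Delta t| <> 2 %[mod 3].
Proof.
move=> pp p3 v2; set v := logn p `|Delta t| in v2; pose k := (v %/ 3)%N.
have Ev : v = (k * 3 + 2)%N by rewrite (divn_eq v 3) v2.
have th1 := simplest_root_irrational rt.
pose n := (p ^ k)%N; have n0 : (0 < n)%N by rewrite expn_gt0 prime_gt0.
have [D' ED'] : exists D', Delta t = n%:Z ^+ 3 * D'.
  have : (p%:Z ^+ (k * 3) %| Delta t)%Z.
    by rewrite -PoszX dvdzE /= pfactor_dvdn ?absDelta_gt0 // -/v Ev leq_addr.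
  by move=> /dvdzP[D' E]; exists D'; rewrite /n PoszX -exprM E mulrC.
have D'0 : D' != 0.
  by have := Delta_gt0 t; rewrite ED'; apply: contraTneq => ->; rewrite mulr0.
have vD' : logn p `|D'| = 2%N.
  have := congr1 (fun n : int => logn p `|n|) ED'.
  rewrite /= abszM abszX lognM ?lognX ?expn_gt0 ?absz_gt0 ?n0 ?(prime_gt0 pp) // (Ev : logn p
    `|Delta t| = _) logn_prime // eqxx => H; clear -H; lia.
have pD' j : (p%:Z ^+ j %| D')%Z = (j <= 2)%N.
  by rewrite -PoszX dvdzE /= pfactor_dvdn // ?absz_gt0 // vD'.
have ex := eisenstein_tame2 rt pp p3 n0 ED' (etrans (pD' 2%N) isT) (negbT (pD' 3%N)).
set z := (3%:R * theta - t%:~R) / n%:R in ex.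
have n0K : (n%:R : K) != 0 by rewrite natr_ext_eq0 -lt0n.
have p0K : (p%:R : K) != 0 by rewrite natr_ext_eq0; case: (p) pp.
have [X EX] := diff_prod_int s3 sfix (eisenstein_integer ex).
have z1 : z \notin 1%VS.
  apply: contra th1 => z1; have -> : theta = 3%:R^-1 * (n%:R * z + t%:~R).
    have three0 : (3%:R : K) != 0 by rewrite natr_ext_eq0.
    have -> : n%:R * z = 3%:R * theta - t%:~R by rewrite /z mulrC divfK.
    by rewrite subrK mulKf.
  apply: memvM; first by apply: rpredVr; exact: rpred_nat.
  by apply: rpredD; [apply: memvM => //; exact: rpred_nat|exact: rpred_int].
have Edz : diff_prod s z = (3%:R / n%:R) ^+ 3 * diff_prod s theta.
  apply: (@diff_prod_scale _ s theta z (3%:R / n%:R) (t%:~R / n%:R)).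
  - by rewrite rmorphM fmorphV /= !rmorph_nat.
  - by rewrite rmorphM fmorphV /= rmorph_nat rmorph_int.
  by rewrite /z; ring.
have sp : s p%:R = p%:R by rewrite rmorph_nat.
have := diff_prod_square s3 sfix z1 sp (depressed_scaled rt n0 ED') p0K.
rewrite EX Edz => E.
have [e Ee] : exists e : int, (e = 1 \/ e = -1) /\ p%:Z ^+ 3 * X = e * (27 * D' * ((2 * t +
  3) * D')).
  have [e [e1 Et]] : exists e : int, (e = 1 \/ e = -1) /\ diff_prod s theta = - (e * Delta
    t)%:~R.
    case: (diff_prod_simplest s3 sfix th1 rt) => ->; [exists (-1)|exists 1]; split; auto.
      by rewrite mulN1r mulrNz opprK.
    by rewrite mul1r.
  exists e; split => //; apply: (@intr_ext_inj K); rewrite !intrM -[p%:~R]/(p%:R).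
  have -> : p%:R * (p%:R * p%:R) * X%:~R = p%:R ^+ 3 * X%:~R :> K by ring.
  by rewrite E Et ED' !intrM -[n%:~R]/(n%:R); field.
have [n1 En1] := power_basis_diff_prod_dvd (eisenstein_integer ex).
have EXD : X = D * n1 by apply: (@intr_ext_inj K); rewrite -EX En1 ED intrM.
have pt : ~~ (p%:Z %| 2 * t + 3)%Z.
  by apply: prime_Delta_dvd => //; rewrite ED' dvdz_mull // -[p%:Z]expr1 pD'.
have X0 : X != 0 by have := diff_prod_neq0 s3 sfix (eisenstein_irrational pp ex); rewrite EX
  intr_ext_eq0.
have t0 : 2 * t + 3 != 0 by apply: contra pt => /eqP ->; exact: dvdz0.
have pz : p%:Z != 0 by case: (p) pp.
have e0 : e != 0 by case: Ee.1 => ->.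
have vX : logn p `|X| = 1%N.
  have := congr1 (fun n : int => logn p `|n|) Ee.2.
  rewrite /= abszM abszX !abszM !lognM ?expn_gt0 ?muln_gt0 ?absz_gt0 ?(prime_gt0 pp) ?D'0 ?t0
    ?X0 ?e0 ?pz //.
  have -> : logn p `|e| = 0%N by case: Ee.1 => ->; rewrite logn1.
  have -> : logn p `|2 * t + 3| = 0%N.
    by rewrite lognE pp absz_gt0 t0 /= -[(p %| _)%N]/((p%:Z %| 2 * t + 3)%Z) (negbTE pt).
  have -> : logn p `|27| = 0%N.
    by rewrite (lognX p 3 3) logn_prime //; case: eqP p3 => // ->.
  by rewrite vD' /= ?lognX !(logn_prime p pp) eqxx => H; clear -H; lia.
have vD : (logn p `|D| <= 1)%N.
  rewrite -[X in (_ <= X)%N]vX EXD; apply: dvdn_leq_log; last by rewrite abszM dvdn_mulr.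
  by rewrite absz_gt0 -EXD.
by have := power_basis_logn p; rewrite (Ev : logn p `|Delta t| = _) => H; clear -H vD; lia.
Qed.

(** Otherwise [v_3(Delta t) = 3], so [v_3(D)] is divisible by 3.  The Eisenstein
    element [x] at 3 has [diff_prod x] of valuation 2; as both [x] and [g]
    generate orders maximal at 3, [v_3(D) = 2]. *)
Lemma power_basis_neq_3_21_mod27 : ~ ((t = 3 %[mod 27])%Z \/ (t = 21 %[mod 27])%Z).
Proof.
move=> t321.
have [k Ek k1] : exists2 k, t = 3 + 9 * k & ~~ (3 %| k - 1)%Z.
  have Et := divz_eq t 27.
  case: t321 => E; rewrite E in Et; [exists (3 * (t %/ 27)%Z)|exists (3 * (t %/ 27)%Z + 2)].
  - by move: Et; rewrite -[(3 %% 27)%Z]/(3 : int) => Et; clear -Et; lia.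
  - by apply/dvdzP => -[q Eq]; clear -Eq; lia.
  - by move: Et; rewrite -[(21 %% 27)%Z]/(21 : int) => Et; clear -Et; lia.
  - by apply/dvdzP => -[q Eq]; clear -Eq; lia.
have th1 := simplest_root_irrational rt.
have ex := eisenstein_wild2 rt Ek k1; set z := theta - (1 + 3 * k)%:~R in ex.
have [X EX] := diff_prod_int s3 sfix (eisenstein_integer ex).
have z1 : z \notin 1%VS.
  apply: contra th1 => z1; rewrite -[theta](subrK (1 + 3 * k)%:~R).
  by apply: rpredD => //; exact: rpred_int.
have Edz : diff_prod s z = 1 ^+ 3 * diff_prod s theta.
  apply: (@diff_prod_scale _ s theta z 1 (1 + 3 * k)%:~R); rewrite ?rmorph1 ?rmorph_int
    ?mul1r //.
have p0K : (3%:R : K) != 0 by rewrite natr_ext_eq0.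
have := diff_prod_square s3 sfix z1 (rmorph_nat s 3) (simplest_depressed9 rt Ek) p0K.
rewrite EX Edz expr1n mul1r => E.
pose e' := 1 + 3 * k + 3 * k ^+ 2.
have EDt : Delta t = 27 * e' by rewrite Ek /Delta /e'; ring.
have X0 : X != 0.
  by have := diff_prod_neq0 s3 sfix (eisenstein_irrational (p := 3) isT ex); rewrite EX
    intr_ext_eq0.
have EX2 : X = 9 * ((1 + 2 * k) * e' * e') \/ X = - (9 * ((1 + 2 * k) * e' * e')).
  have H : 27 * X = - (Delta t * (9 * ((1 + 2 * k) * e'))) \/ 27 * X = Delta t * (9 * ((1 + 2
    * k) * e')).
    case: (diff_prod_simplest s3 sfix th1 rt) => Et; [left|right]; apply: (@intr_ext_inj K).
      rewrite [(27 * X)%:~R]intrM mulrNz [(Delta t * _)%:~R]intrM -Et -E; ring.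
    rewrite [(27 * X)%:~R]intrM [(Delta t * _)%:~R]intrM -[(Delta t)%:~R]opprK -Et mulNr -E;
      ring.
  by case: H; rewrite EDt => H; [right|left]; apply: (@mulfI _ (27 : int)) => //; rewrite H;
    ring.
have u3 : ~~ (3%:Z %| (1 + 2 * k) * e' * e')%Z.
  have e3 : ~~ (3%:Z %| e')%Z by apply/dvdzP => -[q]; rewrite /e' => Eq; clear -Eq; lia.
  rewrite !(prime_dvdzM _ _ (p := 3)) // !negb_or e3 andbT andbT.
  by apply: contra k1 => /dvdzP[q Eq]; apply/dvdzP; exists (k - q); clear -Eq; lia.
set U := (1 + 2 * k) * e' * e' in EX2 u3.
have vX : logn 3 `|X| = 2%N.
  have -> : `|X|%N = (3 ^ 2 * `|U|)%N by case: EX2 => ->; rewrite ?abszN abszM.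
  have u0 : U != 0 by apply: contra u3 => /eqP ->; exact: dvdz0.
  rewrite lognM ?absz_gt0 // pfactorK // lognE /= absz_gt0 u0 /=.
  by rewrite -[(3 %| _)%N]/((3%:Z %| U)%Z) (negbTE u3).
have [n1 En1] := power_basis_diff_prod_dvd (eisenstein_integer ex).
have EXD : X = D * n1 by apply: (@intr_ext_inj K); rewrite -EX En1 ED intrM.
have vD : (logn 3 `|D| <= 2)%N.
  rewrite -[X in (_ <= X)%N]vX EXD; apply: dvdn_leq_log; last by rewrite abszM dvdn_mulr.
  by rewrite absz_gt0 -EXD.
have vDt : logn 3 `|Delta t| = 3%N by rewrite Ek logn3_Delta_wild2.
have [d [d3 [a [b [c Ed]]]]] := eisenstein_maximal dK (p := 3) isT ex (proj1 pg).
have [n2 En2] := diff_prod_transfer s3 sfix (eisenstein_integer ex) (Ed : d%:~R * g = _).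
have E2 : d%:Z ^+ 3 * D = X * n2.
  by apply: (@intr_ext_inj K); rewrite !intrM -ED -EX -En2; ring.
have : (3 ^ 2 %| `|D|)%N.
  have : (3 ^ 2 %| d ^ 3 * `|D|)%N.
    have -> : (d ^ 3 * `|D|)%N = `|(X * n2)%R|%N by rewrite -E2 abszM abszX.
    by rewrite abszM dvdn_mulr // pfactor_dvdn ?vX // absz_gt0.
  by rewrite Gauss_dvdr // coprimeXl // coprimeXr // prime_coprime.
rewrite pfactor_dvdn ?absz_gt0 // => vD2.
by have := power_basis_logn 3; rewrite vDt => H; clear -H vD vD2; lia.
Qed.

End FromBasis.

(** * Comparison of valuations and the theorem *)

Lemma Delta_opp t : Delta (- t - 3) = Delta t.
Proof. by rewrite /Delta; ring. Qed.

(** Inversion exchanges [f_t] and [f_(- t - 3)], which have the same [Delta]; so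
    [t >= -1] can be assumed. *)
Lemma simplest_root_inv (K : fieldExtType rat) t (theta : K) :
  simplest_root t theta -> simplest_root (- t - 3) theta^-1.
Proof.
move/simplest_rootE => E; apply/simplest_rootE.
have th0 : theta != 0.
  apply/eqP => th0; move: E; rewrite th0 !expr0n !mulr0 !add0r => /eqP.
  by rewrite eq_sym oner_eq0.
apply: (mulfI (expf_neq0 3 th0)); rewrite exprVn divff ?expf_neq0 //.
have -> : theta ^+ 3 * ((- t - 3)%:~R * theta^-1 ^+ 2 + ((- t - 3)%:~R + 3%:R) * theta^-1 + 1)
   = theta ^+ 3 - t%:~R * theta ^+ 2 - (t%:~R + 3%:R) * theta.
  by rewrite !(intrD, mulrNz); field.
by rewrite E; ring.
Qed.

Lemma cube_of_logn (M : nat) : (0 < M)%N -> (forall p, prime p -> (3 %| logn p M)%N) ->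
  exists n, (M = n ^ 3)%N.
Proof.
elim/ltn_ind: M => M IH M0 H3.
have [M1|M1] := eqVneq M 1%N; first by exists 1%N.
have pp : prime (pdiv M) by rewrite pdiv_prime // ltn_neqAle eq_sym M1.
set p := pdiv M in pp; have /dvdnP[k Ek] := H3 p pp.
have [m /= pm EM] := pfactor_coprime pp M0.
have v0 : (0 < logn p M)%N by rewrite logn_gt0 mem_primes pp M0 pdiv_dvd.
have m0 : (0 < m)%N by move: M0; rewrite {1}EM muln_gt0 => /andP[].
have pv1 : (1 < p ^ logn p M)%N by rewrite -(exp1n (logn p M)) ltn_exp2r // prime_gt1.
have [||n En] := IH m _ m0.
- by rewrite [X in (_ < X)%N]EM -{1}[m]muln1 ltn_pmul2l.
- move=> q pq; have [->|qp] := eqVneq q p.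
    by rewrite lognE pp m0 /=; move: pm; rewrite prime_coprime // => /negbTE ->.
  have := H3 q pq; rewrite {1}EM lognM // ?expn_gt0 ?prime_gt0 // lognX (logn_prime q pp).
  by rewrite (negbTE qp) muln0 addn0.
by exists (n * p ^ k)%N; rewrite {1}EM En Ek expnMn expnM.
Qed.

Lemma cube_quotient (D c : nat) : (0 < D)%N -> (0 < c)%N ->
  (forall p, prime p -> exists k, logn p D = (logn p c + 3 * k)%N) ->
  exists2 n, (0 < n)%N & (D = c * n ^ 3)%N.
Proof.
move=> D0 c0 H.
have cD : (c %| D)%N.
  apply/dvdn_partP => // p; rewrite mem_primes => /and3P[pp _ _].
  rewrite p_part pfactor_dvdn //; have [k ->] := H p pp.
  exact: leq_addr.
have [||n En] := @cube_of_logn (D %/ c).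
- by rewrite divn_gt0 // dvdn_leq.
- move=> p pp; have [k Ek] := H p pp.
  by rewrite logn_div // Ek addKn dvdn_mulr.
exists n; last by rewrite -En mulnC divnK.
rewrite lt0n; apply: contraTneq D0 => n0.
by rewrite -(divnK cD) En n0.
Qed.

(** If [t / 3 = 1 mod 3], then [t] is 3, 12 or 21 modulo 27. *)
Lemma ramified_mod27 t : ramified_at3 t -> (t <> 3 %[mod 27])%Z -> (t <> 21 %[mod 27])%Z ->
  logn 3 `|Delta t| = 2%N.
Proof.
move=> /andP[/dvdzP[k Ek] t12] t3 t21.
have Et : t = 3 * k by rewrite Ek mulrC.
rewrite Et; apply: logn3_Delta_wild1; apply/dvdzP => -[l El].
have [j [Ej|[Ej|Ej]]] : exists j, l = 3 * j \/ l = 3 * j + 2 \/ l = 1 + 3 * j.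
  exists (l %/ 3)%Z; have := divz_eq l 3; have := modz_ge0 l (isT : 3%Z != 0).
  by have := ltz_pmod l (isT : 0 < 3%Z); clear; lia.
- by apply: t3; have -> : t = j * 27 + 3 by [clear -Et El Ej; lia]; rewrite modzMDl.
- by apply: t21; have -> : t = j * 27 + 21 by [clear -Et El Ej; lia]; rewrite modzMDl.
- by case/eqP: t12; have -> : t = j * 27 + 12 by [clear -Et El Ej; lia]; rewrite modzMDl.
Qed.

Lemma unramified_logn3 t : ~~ ramified_at3 t -> (3 %| logn 3 `|Delta t|)%N.
Proof.
rewrite /ramified_at3 negb_and => /orP[/logn3_Delta_ndvd -> //|].
rewrite negbK => /eqP t12; have -> : t = 3 + 9 * (3 * (t %/ 27)%Z + 1).
  by have := divz_eq t 27; rewrite t12 => H; clear -H; lia.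
by rewrite logn3_Delta_wild2.
Qed.

Lemma mod27_ramified t : (t = 3 %[mod 27])%Z \/ (t = 21 %[mod 27])%Z ->
  ramified_at3 t /\ logn 3 `|Delta t| = 3%N.
Proof.
move=> H; have [k [Ek t12]] : exists k, t = 3 + 9 * k /\ (t != 12 %[mod 27])%Z.
  have := divz_eq t 27; case: H => E; rewrite E.
    by exists (3 * (t %/ 27)%Z); split => //; rewrite {1}H; clear; lia.
  by exists (3 * (t %/ 27)%Z + 2); split => //; rewrite {1}H; clear; lia.
rewrite Ek logn3_Delta_wild2; split => //; rewrite /ramified_at3 -Ek t12 andbT.
by apply/dvdzP; exists (1 + 3 * k); rewrite Ek; ring.
Qed.

Lemma cube_index_of_local t : (t <> 3 %[mod 27])%Z -> (t <> 21 %[mod 27])%Z ->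
  (forall p : nat, prime p -> p <> 3%N -> logn p `|Delta t|%N <> 2%N %[mod 3]) ->
  exists2 n : nat, (0 < n)%N & Delta t = (conductor_formula t)%:Z * n%:Z ^+ 3.
Proof.
move=> t3 t21 H2.
have [|p pp|n n0 En] := @cube_quotient `|Delta t| (conductor_formula t) (absDelta_gt0 t).
- exact: conductor_formula_gt0.
- rewrite logn_conductor_formula //; have [->|/eqP p3] := eqVneq p 3%N.
    have [r3|r3] := boolP (ramified_at3 t); first by exists 0%N; rewrite ramified_mod27.
    by have /dvdnP[k ->] := unramified_logn3 r3; exists k; rewrite mulnC.
  have [/dvdnP[k ->]|v3] := boolP (3 %| _)%N; first by exists k; rewrite mulnC.
  have := H2 p pp p3; have := divn_eq (logn p `|Delta t|) 3.
  have : (logn p `|Delta t| %% 3 < 3)%N by rewrite ltn_mod.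
  move: v3; rewrite /dvdn; case: (_ %% 3)%N => [|[|[|//]]] // _ _ E _.
  by exists (logn p `|Delta t| %/ 3)%N; rewrite {1}E; clear; lia.
exists n => //; rewrite -[LHS]gtz0_abs ?Delta_gt0 // En PoszM PoszX //.
Qed.

Lemma local_of_cube_index t (n : nat) : (0 < n)%N ->
  Delta t = (conductor_formula t)%:Z * n%:Z ^+ 3 ->
  ((t <> 3 %[mod 27])%Z /\ (t <> 21 %[mod 27])%Z) /\
  (forall p : nat, prime p -> p <> 3%N -> logn p `|Delta t|%N <> 2%N %[mod 3]).
Proof.
move=> n0 ED.
have lognD p : prime p -> logn p `|Delta t| = (logn p (conductor_formula t) + 3 * logn p n)%N.
  by move=> pp; rewrite ED abszM abszX lognM ?lognX ?conductor_formula_gt0 // expn_gt0 n0.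
have n321 : ~ ((t = 3 %[mod 27])%Z \/ (t = 21 %[mod 27])%Z).
  case/mod27_ramified => r3 v3; have := lognD 3%N isT.
  by rewrite v3 logn_conductor_formula //= r3; clear; lia.
split; first by split=> E; apply: n321; [left|right].
move=> p pp p3; rewrite lognD // logn_conductor_formula //.
move/eqP: p3 => /negbTE ->; rewrite [(3 * _)%N]mulnC addnC modnMDl.
by case: (3 %| _)%N.
Qed.

Lemma cube_quotient_rat t (c n : nat) : (0 < c)%N ->
  (Delta t)%:~R / c%:R = n%:R ^+ 3 :> rat <-> Delta t = c%:Z * n%:Z ^+ 3.
Proof.
move=> c0; have c0Q : (c%:R : rat) != 0 by rewrite pnatr_eq0 -lt0n.
split=> [E|->].
  apply: (@intr_inj rat); rewrite !intrM -[c%:~R]/(c%:R) -[n%:~R]/(n%:R).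
  by rewrite -[LHS](divfK c0Q) E; ring.
by rewrite !intrM mulrC; field.
Qed.

Lemma third_mod_exists t (n : nat) : exists a, third_mod t a n.
Proof.
have [n3|n3] := boolP (3 %| n)%N.
  by exists (t %/ 3)%Z; split => //; rewrite n3.
have cop : coprimez 3 n by rewrite coprimezE prime_coprime.
have [[u v] /= Euv] := coprimezP _ _ cop.
exists (u * t); split => [|_]; first by rewrite (negbTE n3).
apply/eqP; rewrite eqz_mod_dvd; apply/dvdzP; exists (- (v * t)).
have -> : 3 * (u * t) - t = (u * 3 - 1) * t by ring.
have -> : u * 3 = 1 - v * n by clear -Euv; lia.
ring.
Qed.

Theorem theorem1p1 (K : splittingFieldType rat) (HK : cyclic_cubic K) :
  [<-> (exists g : K, power_integral_basis g);
       (exists t : int, [/\ -1 <= t, is_simplest_cubic K t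
          & exists n : nat, (0 < n)%N /\
              (Delta t)%:~R / (conductor K)%:R = n%:R ^+ 3 :> rat]);
       (exists t : int, [/\ -1 <= t, is_simplest_cubic K t,
            (t <> 3 %[mod 27])%Z /\ (t <> 21 %[mod 27])%Z
          & forall p : nat, prime p -> p <> 3%N ->
              logn p `|Delta t|%N <> 2%N %[mod 3]])]
  /\
  (forall (t : int) (n : nat), -1 <= t -> is_simplest_cubic K t -> (0 < n)%N ->
     (Delta t)%:~R / (conductor K)%:R = n%:R ^+ 3 :> rat ->
     ((3 %| n)%N -> (3 %| t)%Z) /\
     forall (theta : K) (a : int), simplest_root t theta -> third_mod t a n ->
       power_integral_basis ((theta - a%:~R) / n%:R)).
Proof.
have [dK [s [s3 sfix]]] := cyclic_cubic_automorphism HK.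
have cubeE t (n : nat) : is_simplest_cubic K t ->
    (Delta t)%:~R / (conductor K)%:R = n%:R ^+ 3 :> rat <->
    Delta t = (conductor_formula t)%:Z * n%:Z ^+ 3.
  move=> sK; rewrite (conductor_formulaE dK sK); apply: cube_quotient_rat.
  exact: conductor_formula_gt0.
have basis t (n : nat) : is_simplest_cubic K t -> (0 < n)%N ->
    (Delta t)%:~R / (conductor K)%:R = n%:R ^+ 3 :> rat ->
    ((3 %| n)%N -> (3 %| t)%Z) /\
    forall (theta : K) (a : int), simplest_root t theta -> third_mod t a n ->
      power_integral_basis ((theta - a%:~R) / n%:R).
  move=> sK n0 /(cubeE t n sK) ED; split; first exact: dvd3_of_cube ED.
  by move=> theta a rt ta; exact: (power_integral_basis_of_cube dK s3 sfix n0 rt ED ta).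
split; last by move=> t n _; exact: basis.
have to_local : (exists g : K, power_integral_basis g) ->
    exists t : int, [/\ -1 <= t, is_simplest_cubic K t,
            (t <> 3 %[mod 27])%Z /\ (t <> 21 %[mod 27])%Z
          & forall p : nat, prime p -> p <> 3%N ->
              logn p `|Delta t|%N <> 2%N %[mod 3]].
  case=> g pg; have [t [theta [A [D [rt ED EA]]]]] := power_basis_simplest_root dK s3 sfix pg.
  wlog tge : t theta rt EA / -1 <= t.
    move=> W; have [t1|tlt] := boolP (-1 <= t); first exact: W rt EA t1.
    by apply: (W (- t - 3) theta^-1); [exact: simplest_root_inv|rewrite Delta_opp|clear -tlt; lia].
  exists t; split => //.
  - by exists theta; split => //; exact: irrational_generates dK (simplest_root_irrational rt).
  - have H := power_basis_neq_3_21_mod27 dK s3 sfix pg rt ED EA.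
    by split=> E; apply: H; [left|right].
  - by move=> p; exact: (power_basis_logn_neq2_mod3 dK s3 sfix pg rt ED EA).
have of_local : (exists t : int, [/\ -1 <= t, is_simplest_cubic K t,
            (t <> 3 %[mod 27])%Z /\ (t <> 21 %[mod 27])%Z
          & forall p : nat, prime p -> p <> 3%N ->
              logn p `|Delta t|%N <> 2%N %[mod 3]]) ->
    exists t : int, [/\ -1 <= t, is_simplest_cubic K t
          & exists n : nat, (0 < n)%N /\
              (Delta t)%:~R / (conductor K)%:R = n%:R ^+ 3 :> rat].
  case=> t [t1 sK [t3 t21] H2]; have [n n0 ED] := cube_index_of_local t3 t21 H2.
  by exists t; split => //; exists n; split => //; apply/cubeE.
split; first by move/to_local/of_local.
split.
  case=> t [t1 sK [n [n0 /(cubeE t n sK) ED]]]; have [t27 H2] := local_of_cube_index n0 ED.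
  by exists t; split.
move/of_local=> [t [t1 sK [n [n0 E]]]]; have [a ta] := third_mod_exists t n.
have [theta [rt _]] := sK.
by exists ((theta - a%:~R) / n%:R); exact: (basis t n sK n0 E).2.
Qed.
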